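(* Let $\Lambda\subset\mathbb{N}^3$ be a set which is the invariant set of some formal hypersurface in $\mathbb{C}^2$. Suppose that $\Lambda$ contains at least two points and that one of them, say $(\alpha,n,\mu)$, satisfies $n\neq\alpha$. Assume, in addition, that either $\alpha+n=\alpha'+n'$ for some $(\alpha',n',\mu')\in\Lambda$ with $(\alpha',n',\mu')\ne(\alpha,n,\mu)$, or the number $$\frac{(\alpha'+n')\mu-(\alpha+n)\mu'}{(\alpha'+n')-(\alpha+n)}$$ is not the same positive integer for all choices of $(\alpha',n',\mu')\in\Lambda$ with $(\alpha',n',\mu')\neq(\alpha,n,\mu)$. Then all (formal or real-analytic) hypersurfaces $M$ satisfying $\Lambda_M=\Lambda$ have $\mathrm{Aut}_f(M,p)=\{\mathsf{id}\}$ if and only if $$\gcd\{n'-\alpha':(\alpha',n',\mu')\in\Lambda\}=1,$$ there exists $(\alpha',n',\mu')\in\Lambda$ with $\mu'$ even, and at least one of the following two conditions is fulfilled: (i) $n'-\alpha'$ is even for some $(\alpha',n',\mu')\in\Lambda$ with $\mu'$ even; (ii) $n'-\alpha'$ is odd for some $(\alpha',n',\mu')\in\Lambda$ with $\mu'$ odd.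
   Context: $\mathbb{N}=\{0,1,2,\dots\}$. In the gcd, $0$ is regarded as divisible by every integer. A bar over a power series means that its coefficients are conjugated. Formal hypersurfaces: a formal hypersurface $M$ through $p\in\mathbb{C}^2$ is given by a formal power series $\rho(Z,\bar Z)=\sum_{I,J}\rho_{I\bar J}(Z-p)^I\overline{(Z-p)^J}$ with $\rho_{I\bar J}=\overline{\rho_{J\bar I}}$, zero constant term, and $d\rho\neq0$ at $p$. A germ of a real-analytic hypersurface is identified with the formal hypersurface given by the Taylor series of a defining function. A formal invertible map is a pair of formal power series in $Z-p$ with invertible Jacobian matrix at $p$. A formal automorphism of $(M,p)$ is a formal invertible map $H:(\mathbb{C}^2,p)\to(\mathbb{C}^2,p)$ with $\rho(H(Z),\overline{H(Z)})=a(Z,\bar Z)\rho(Z,\bar Z)$ for some formal power series $a$ in $Z-p$, $\overline{Z-p}$; these form the group $\mathrm{Aut}_f(M,p)$. Normal coordinates: these are (formal or local) holomorphic coordinates $(z,w)$ vanishing at $p$ in which $M$ is given by $\operatorname{Im}w=\varphi(z,\bar z,\operatorname{Re}w)$, with $\varphi(z,\chi,s)=\bar\varphi(\chi,z,s)$ and $\varphi(z,0,s)\equiv\varphi(0,\chi,s)\equiv0$. They always exist. Expand $\varphi(z,\chi,s)=\sum_{\alpha\ge1,\mu\ge0}\varphi_{\alpha,\mu}(\chi)z^\alpha s^\mu$. Invariant set: on $\mathbb{N}^2$ let $(\alpha,\mu)\preceq(\beta,\nu)$ iff $\alpha+\mu\le\beta+\nu$ and $\mu\le\nu$; let $\prec$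 mean $\preceq$ and $\neq$. A pair $(\alpha_0,\mu_0)$ is an invariant pair of $M$ if $\varphi_{\alpha_0,\mu_0}\not\equiv0$ but $\varphi_{\alpha,\mu}\equiv0$ for every $(\alpha,\mu)\prec(\alpha_0,\mu_0)$. $Q_M$ is the set of invariant pairs. For $(\alpha,\mu)\in Q_M$ let $n(\alpha,\mu):=\min\{n:\frac{d^n\varphi_{\alpha,\mu}}{d\chi^n}(0)\neq0\}$ (one has $n(\alpha,\mu)\ge\alpha$). The invariant set of $M$ is $\Lambda_M:=\{(\alpha,n,\mu)\in\mathbb{N}^3:(\alpha,\mu)\in Q_M,\ n=n(\alpha,\mu)\}$. The sets $Q_M,\Lambda_M$ do not depend on the choice of normal coordinates. *)

(* Defs.v *)
(* MathComp world; the complex numbers are R[i] for R : realType. *)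
From mathcomp Require Import all_boot all_order all_algebra.
From mathcomp Require Import reals complex.
From mathcomp Require Import mpoly.

Set Implicit Arguments.
Unset Strict Implicit.
Unset Printing Implicit Defensive.

Import Order.TTheory GRing.Theory Num.Theory.
Local Open Scope ring_scope.

Section FormalPowerSeries.
Variable K : comNzRingType.

(* A formal power series in n variables is its family of coefficients. *)
Definition fps (n : nat) := 'X_{1..n} -> K.

Definition fps_poly (n : nat) (p : {mpoly K[n]}) : fps n := fun m => p@_m.

Definition fps_trunc (n d : nat) (f : fps n) : {mpoly K[n]} :=
  \sum_(m : 'X_{1..n < d.+1}) f m *: 'X_[m].

Definition fps_sub (n : nat) (f g : fps n) : fps n := fun m => f m - g m.

(* The coefficient at m of a product only depends on the truncations of the
   factors at total degree |m|. *)
Definition fps_mul (n : nat) (f g : fps n) : fps n := fun m =>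
  (fps_trunc (mdeg m) f * fps_trunc (mdeg m) g)@_m.

(* F (G_0, ..., G_(k-1)), meaningful when every G_i has zero constant term:
   then the coefficient at m only depends on the truncations of F and of the
   G_i at total degree |m|. *)
Definition fps_comp (k n : nat) (F : fps k) (G : 'I_k -> fps n) : fps n :=
  fun m => (fps_trunc (mdeg m) F
              \mPo [tuple fps_trunc (mdeg m) (G i) | i < k])@_m.

Definition fps1_deriv (f : nat -> K) : nat -> K := fun k => f k.+1 *+ k.+1.

End FormalPowerSeries.

Section Hypersurfaces.
Variable R : realType.
Local Notation C := R[i].

Definition fps_conj (n : nat) (f : fps C n) : fps C n := fun m => (f m)^*.

(* Absolute convergence on some polydisc around the origin. *)
Definition fps_convergent (n : nat) (f : fps C n) : Prop :=
  exists r B : R, 0 < r /\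
    forall d, \sum_(m : 'X_{1..n < d})
                ComplexField.Normc.normc (f m) * r ^+ mdeg m <= B.

(* A series in (Z, conj Z), Z in C^2, is a series in 2 + 2 variables: the
   variables lshift 2 i stand for Z_i and rshift 2 i for conj Z_i. *)
Definition mswap (m : 'X_{1..2 + 2}) : 'X_{1..2 + 2} :=
  [multinom m (match split i with
               | inl j => rshift 2 j
               | inr j => lshift 2 j
               end) | i < 2 + 2].

(* The coefficients of [hrho] are those of the expansion of rho at the base
   point, i.e. in powers of Z - p and of its conjugate. *)
Record hypersurface := Hypersurface {
  hbase : 'rV[C]_2;
  hrho : fps C (2 + 2);
  hrho_hermitian : forall m, hrho m = (hrho (mswap m))^*;
  hrho_const : hrho 0%MM = 0;
  hrho_diff : exists i : 'I_(2 + 2), hrho U_(i)%MM != 0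
}.

Definition real_analytic (M : hypersurface) : Prop := fps_convergent (hrho M).

(* Pairs of formal power series in Z - p. *)
Definition formal_map := 'I_2 -> fps C 2.

Definition jacobian (H : formal_map) : 'M[C]_2 :=
  \matrix_(i < 2, j < 2) H i U_(j)%MM.

(* The base point p of the source does not occur: the components of H are
   already expanded in powers of Z - p; q is the image of p. *)
Definition formal_invertible_to (q : 'rV[C]_2) (H : formal_map) : Prop :=
  (forall i, H i 0%MM = q 0 i) /\ jacobian H \in unitmx.

Definition formal_id (p : 'rV[C]_2) : formal_map :=
  fun i => fps_poly ((p 0 i)%:MP + 'X_i).

Definition in_Z (f : fps C 2) : fps C (2 + 2) :=
  fps_comp f (fun i => fps_poly 'X_(lshift 2 i)).

Definition in_conjZ (f : fps C 2) : fps C (2 + 2) :=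
  fps_comp f (fun i => fps_poly 'X_(rshift 2 i)).

(* rho (H (Z), conj (H (Z))), for rho expanded at q = H (p). *)
Definition pullback (q : 'rV[C]_2) (rho : fps C (2 + 2)) (H : formal_map) :
    fps C (2 + 2) :=
  let h j := fps_sub (H j) (fps_poly (q 0 j)%:MP) in
  fps_comp rho (fun i => match split i with
                         | inl j => in_Z (h j)
                         | inr j => in_conjZ (fps_conj (h j))
                         end).

Definition formal_aut (M : hypersurface) (H : formal_map) : Prop :=
  formal_invertible_to (hbase M) H /\
  exists a : fps C (2 + 2),
    pullback (hbase M) (hrho M) H =1 fps_mul a (hrho M).

Definition trivial_aut (M : hypersurface) : Prop :=
  forall H : formal_map, formal_aut M H <-> H =2 formal_id (hbase M).

(* phi (z, chi, s) is a series in 3 variables; [phi_coef phi a n m] is the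
   coefficient of z^a chi^n s^m. *)
Definition phi_coef (phi : fps C 3) (a n m : nat) : C :=
  phi [multinom of [:: a; n; m]].

(* Im w - phi (z, conj z, Re w), as a series in (z, w, conj z, conj w). *)
Definition graph_rho (phi : fps C 3) : fps C (2 + 2) :=
  let z : {mpoly C[2 + 2]} := 'X_(lshift 2 ord0) in
  let w : {mpoly C[2 + 2]} := 'X_(lshift 2 ord_max) in
  let zb : {mpoly C[2 + 2]} := 'X_(rshift 2 ord0) in
  let wb : {mpoly C[2 + 2]} := 'X_(rshift 2 ord_max) in
  fps_sub (fps_poly ((2%:R * 'i%C)^-1 *: (w - wb)))
          (fps_comp phi (fun i =>
             fps_poly (tnth [tuple z; zb; 2%:R^-1 *: (w + wb)] i))).

(* M is given by Im w = phi (z, conj z, Re w) in some formal normal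
   coordinates (z, w) = Phi (Z). *)
Definition normal_form (M : hypersurface) (phi : fps C 3) : Prop :=
  [/\ forall a n m, phi_coef phi a n m = (phi_coef phi n a m)^*,
      forall a m, phi_coef phi a 0 m = 0,
      forall n m, phi_coef phi 0 n m = 0 &
      exists Phi : formal_map,
        formal_invertible_to 0 Phi /\
        exists a : fps C (2 + 2), a 0%MM != 0 /\
          pullback 0 (graph_rho phi) Phi =1 fps_mul a (hrho M)].

(* The univariate series phi_(a,m)(chi). *)
Definition phi_slice (phi : fps C 3) (am : nat * nat) : nat -> C :=
  fun n => phi_coef phi am.1 n am.2.

Definition pair_le (x y : nat * nat) : bool :=
  (x.1 + x.2 <= y.1 + y.2)%N && (x.2 <= y.2)%N.

Definition pair_lt (x y : nat * nat) : bool := pair_le x y && (x != y).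

Definition invariant_pair (phi : fps C 3) (x : nat * nat) : Prop :=
  (exists n, phi_slice phi x n != 0) /\
  forall y, pair_lt y x -> forall n, phi_slice phi y n = 0.

Definition deriv_at0 (f : nat -> C) (n : nat) : C :=
  iter n (@fps1_deriv C) f 0%N.

(* n = min {n : (d/dchi)^n f (0) <> 0} *)
Definition min_order (f : nat -> C) (n : nat) : Prop :=
  deriv_at0 f n != 0 /\ forall k, (k < n)%N -> deriv_at0 f k = 0.

(* Triples are (alpha, n, mu). *)
Definition invariant_triple (phi : fps C 3) (t : nat * nat * nat) : Prop :=
  let: (a, n, m) := t in
  invariant_pair phi (a, m) /\ min_order (phi_slice phi (a, m)) n.

(* L is the invariant set of M.  The invariant set is independent of the
   normal coordinates, so it is read off in any of them. *)
Definition is_invariant_set (M : hypersurface) (L : nat * nat * nat -> Prop) :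
    Prop :=
  exists phi : fps C 3, normal_form M phi /\
    forall t, L t <-> invariant_triple phi t.

End Hypersurfaces.

(* Greatest with respect to divisibility, so that the gcd of {0} is 0. *)
Definition is_gcd (S : int -> Prop) (g : nat) : Prop :=
  (forall x, S x -> (g%:Z %| x)%Z) /\
  (forall d : int, (forall x, S x -> (d %| x)%Z) -> (d %| g%:Z)%Z).

Definition gcd_parity_condition (L : nat * nat * nat -> Prop) : Prop :=
  [/\ is_gcd (fun x => exists a n m, L (a, n, m) /\ x = n%:Z - a%:Z) 1,
      exists a n m, L (a, n, m) /\ ~~ odd m &
      (exists a n m, [/\ L (a, n, m), ~~ odd m & (2 %| n%:Z - a%:Z)%Z])
      \/
      (exists a n m, [/\ L (a, n, m), odd m & ~~ (2 %| n%:Z - a%:Z)%Z])].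

(* ((a' + n') m - (a + n) m') / ((a' + n') - (a + n)), for t = (a, n, m) and
   t' = (a', n', m'). *)
Definition slope (t t' : nat * nat * nat) : rat :=
  let: (a, n, m) := t in
  let: (a', n', m') := t' in
  (((a' + n') * m)%:R - ((a + n) * m')%:R) / ((a' + n')%:R - (a + n)%:R).

(* Main.v *)
Require Import Defs.
From mathcomp Require Import all_boot all_order all_algebra.
From mathcomp Require Import reals.
From mathcomp Require Import complex mpoly zify ring.
From mathcomp Require boolp.

Set Implicit Arguments.
Unset Strict Implicit.
Unset Printing Implicit Defensive.

Import Order.TTheory GRing.Theory Num.Theory.
Local Open Scope ring_scope.

(** Write [L] for the invariant set.  The theorem combines two facts: under
    [gcd_parity_condition L] no hypersurface with invariant set [L] has a
    non-trivial automorphism, and without it some real-analytic one has.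

    Rigidity ([trivial_of_condition]).  A formal inverse of the normal
    coordinates ([formal_inverseK], [formal_inverseKl]) conjugates an automorphism
    into a pair (f, g) of series in (z, w).  The complexified graph is parametrised
    by independent variables (z, x, s), with w = s + i phi(z, x, s) and
    w' = s - i phi(z, x, s), where x and w' stand for the conjugates of z and w.
    Preserving the graph becomes the identity of series [mapping_equation]:
    with f', g' the conjugated series,
      (g(z, w) - g'(x, w')) / 2i
        = phi(f(z, w), f'(x, w'), (g(z, w) + g'(x, w')) / 2)
    ([conjugate_mapping]).  It is solved by induction on the power of w: assume that
    f = z modulo w^k and g = w modulo w^(k+1).
      - At x = 0 the right-hand side is small, and the w^(k+1) coefficient of g is
        a real constant G, independent of z, as soon as f(0, w) is small enough
        ([pure_identity]).
      - Let (a, n, m) be in [L] and compare the coefficients of z^a x^N s^(m+k).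
        The monomials of phi strictly below (a, m) vanish, and replacing one z by
        w^k, or one s inside w by phi, moves a monomial up; therefore only the
        first variation of the slice phi_(a,m)(x) z^a s^m is visible
        ([stage_identity]).  For N = n it reads
          (k + 1) G = a c + n conj(c) + m G,
        where c is the coefficient of z w^k in f.  The unknowns c and G are the
        same for all elements of [L].  An element with n <> a makes c real; then
        G <> 0 would force all slopes to be k + 1, so the hypothesis on slopes
        leaves only c = G = 0 ([balance_linear]).
      - Taking N = n + q - 1, the coefficient of x^q w^k in f' is multiplied by the
        non-zero number n phi_(a,n,m), and vanishes for q > 1 by induction on q.
        The coefficient of w^k in f is seen in the same way from z^(a-1) x^n s^(m+k),
        at an element with a > 1; two distinct elements of [L] provide one.
    The induction starts in the same manner ([zero_identity]): with
    f = lam z + ... and g = r w + ..., the leading coefficients satisfy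
    lam^a conj(lam)^n r^m = r on [L].  Absolute values and the slopes give
    |lam| = |r| = 1, and the greatest common divisor and the parities then give
    lam = r = 1 ([balance_multiplicative]).  The induction is [rigid].

    Converse.  The surface Im w = sum over [L] of (z^a x^n + z^n x^a) s^m, with x the
    conjugate of z and s = Re w, has invariant set [L] because [L] is an antichain
    with a <= n ([model_invariant_set]).  It converges because its coefficients are
    bounded ([model_analytic]).  The map (lam z, eps w) preserves it when
    lam^a conj(lam)^n eps^m = eps on [L] ([diag_aut]).  When the condition fails
    there is such a pair other than (1, 1): a root of unity lam with eps = 1,
    or (1, -1), or (-1, -1) ([symmetry_of_failure]). *)

(** * Polynomials with prescribed support *)

Section Support.
Variables (n : nat) (K : comNzRingType).
Implicit Types (p q : {mpoly K[n]}) (E : 'X_{1..n} -> Prop).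

Definition supp_in E p := forall m, p@_m != 0 -> E m.

Lemma supp_inW E1 E2 p : (forall m, E1 m -> E2 m) -> supp_in E1 p -> supp_in E2 p.
Proof. by move=> sub H m /H /sub. Qed.

Lemma supp_inI E1 E2 p :
  supp_in E1 p -> supp_in E2 p -> supp_in (fun m => E1 m /\ E2 m) p.
Proof. by move=> H1 H2 m nz; split; [apply: H1 | apply: H2]. Qed.

Lemma supp_in0 E : supp_in E 0.
Proof. by move=> m; rewrite mcoeff0 eqxx. Qed.

Lemma supp_inD E p q : supp_in E p -> supp_in E q -> supp_in E (p + q).
Proof.
move=> Hp Hq m; rewrite mcoeffD.
have [->|nz _] := eqVneq p@_m 0; last exact: Hp.
by rewrite add0r; apply: Hq.
Qed.

Lemma supp_inN E p : supp_in E p -> supp_in E (- p).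
Proof. by move=> H m; rewrite mcoeffN oppr_eq0; apply: H. Qed.

Lemma supp_inB E p q : supp_in E p -> supp_in E q -> supp_in E (p - q).
Proof. by move=> Hp Hq; apply: supp_inD => //; apply: supp_inN. Qed.

Lemma supp_inZ E c p : supp_in E p -> supp_in E (c *: p).
Proof.
move=> H m; rewrite mcoeffZ => nz; apply: H.
by apply: contra_neq nz => ->; rewrite mulr0.
Qed.

Lemma supp_inMn E p k : supp_in E p -> supp_in E (p *+ k).
Proof. by move=> H; rewrite -scaler_nat; apply: supp_inZ. Qed.

Lemma supp_in_sum E (I : Type) (r : seq I) (P : pred I) (F : I -> {mpoly K[n]}) :
  (forall i, P i -> supp_in E (F i)) -> supp_in E (\sum_(i <- r | P i) F i).
Proof.
move=> H; elim/big_ind: _ => //; first exact: supp_in0.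
exact: supp_inD.
Qed.

Lemma supp_inM E1 E2 E p q :
  supp_in E1 p -> supp_in E2 q ->
  (forall m1 m2, E1 m1 -> E2 m2 -> E (m1 + m2)%MM) -> supp_in E (p * q).
Proof.
move=> Hp Hq H m; rewrite -mcoeff_msupp => /msuppM_le.
case/allpairsP => -[m1 m2] /= [h1 h2 ->].
by apply: H; [apply: Hp | apply: Hq]; rewrite -mcoeff_msupp.
Qed.

Lemma supp_inX E (m : 'X_{1..n}) : E m -> supp_in E 'X_[m].
Proof.
move=> Em m'; rewrite mcoeffX.
by have [<-|_] := eqVneq m m'; rewrite ?eqxx.
Qed.

Lemma supp_in1 E : E 0%MM -> supp_in E 1.
Proof. by rewrite -mpolyX0; apply: supp_inX. Qed.

Lemma supp_inXn (E : nat -> 'X_{1..n} -> Prop) p k :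
  E 0%N 0%MM -> supp_in (E 1%N) p ->
  (forall i m1 m2, E i m1 -> E 1%N m2 -> E i.+1 (m1 + m2)%MM) ->
  supp_in (E k) (p ^+ k).
Proof.
move=> E0 E1 ES; elim: k => [|k IH]; first by rewrite expr0; apply: supp_in1.
by rewrite exprSr; apply: (supp_inM IH E1) => m1 m2; apply: ES.
Qed.

Definition monomial_ideal E := forall m1 m2, E m1 -> E (m1 + m2)%MM.

Lemma supp_ideal E p q : monomial_ideal E -> supp_in E p -> supp_in E (p * q).
Proof.
move=> idE Hp; apply: (supp_inM (E2 := fun=> True) Hp) => // m1 m2 + _.
exact: idE.
Qed.

(** A congruence modulo a monomial ideal when [E] is one, and otherwise a bound on
    the support of a difference. *)
Definition eqmod E p q := supp_in E (p - q).

Lemma eqmod_refl E p : eqmod E p p.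
Proof. by rewrite /eqmod subrr; apply: supp_in0. Qed.

Lemma eqmod_sym E p q : eqmod E p q -> eqmod E q p.
Proof. by rewrite /eqmod => H; rewrite -opprB; apply: supp_inN. Qed.

Lemma eqmod_trans E p q r : eqmod E p q -> eqmod E q r -> eqmod E p r.
Proof. by rewrite /eqmod => H1 H2; rewrite -(subrKA q); apply: supp_inD. Qed.

Lemma eqmodW E1 E2 p q : (forall m, E1 m -> E2 m) -> eqmod E1 p q -> eqmod E2 p q.
Proof. exact: supp_inW. Qed.

Lemma eqmodD E p q p' q' :
  eqmod E p p' -> eqmod E q q' -> eqmod E (p + q) (p' + q').
Proof. by rewrite /eqmod opprD addrACA; apply: supp_inD. Qed.

Lemma eqmodB E p q p' q' :
  eqmod E p p' -> eqmod E q q' -> eqmod E (p - q) (p' - q').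
Proof.
move=> H1 H2; rewrite /eqmod.
have -> : p - q - (p' - q') = (p - p') - (q - q') by ring.
exact: supp_inB.
Qed.

Lemma eqmodZ E c p q : eqmod E p q -> eqmod E (c *: p) (c *: q).
Proof. by rewrite /eqmod -scalerBr; apply: supp_inZ. Qed.

Lemma eqmod_sum E (I : Type) (r : seq I) (P : pred I) (F G : I -> {mpoly K[n]}) :
  (forall i, P i -> eqmod E (F i) (G i)) ->
  eqmod E (\sum_(i <- r | P i) F i) (\sum_(i <- r | P i) G i).
Proof. by rewrite /eqmod -sumrB; apply: supp_in_sum. Qed.

Section Ideal.
Variable E : 'X_{1..n} -> Prop.
Hypothesis idE : monomial_ideal E.

Lemma eqmodM p q p' q' :
  eqmod E p p' -> eqmod E q q' -> eqmod E (p * q) (p' * q').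
Proof.
move=> H1 H2; apply: (@eqmod_trans _ _ (p' * q)).
  by rewrite /eqmod -mulrBl; apply: supp_ideal.
by rewrite /eqmod -mulrBr mulrC; apply: supp_ideal.
Qed.

Lemma eqmodXn p q k : eqmod E p q -> eqmod E (p ^+ k) (q ^+ k).
Proof.
move=> H; elim: k => [|k IH]; first by rewrite !expr0; apply: eqmod_refl.
by rewrite !exprS; apply: eqmodM.
Qed.

Lemma eqmod_prod (I : Type) (r : seq I) (P : pred I) (F G : I -> {mpoly K[n]}) :
  (forall i, P i -> eqmod E (F i) (G i)) ->
  eqmod E (\prod_(i <- r | P i) F i) (\prod_(i <- r | P i) G i).
Proof.
move=> H; elim/big_ind2: _ => // [|p p' q q']; first exact: eqmod_refl.
exact: eqmodM.
Qed.

End Ideal.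

Lemma eqmod_coef E p q m : eqmod E p q -> ~ E m -> p@_m = q@_m.
Proof.
move=> H nE; apply/eqP; rewrite -subr_eq0 -mcoeffB.
by apply/negPn/negP => /H.
Qed.

Lemma coef_eqmod E p q : (forall m, E m \/ p@_m = q@_m) -> eqmod E p q.
Proof.
move=> H m; rewrite mcoeffB subr_eq0 => nz.
by case: (H m) => // e; rewrite e eqxx in nz.
Qed.

End Support.

(** * Truncated composition of power series *)

(** An identity of formal series is a family of polynomial identities, one for each
    total degree; see [fps_ext]. *)
Notation deg_ge d := (fun m => is_true (d <= mdeg m)%N).
Notation "p =[ d ]= q" := (eqmod (deg_ge d) p q) (at level 70, q at next level).

Section Truncation.
Variable K : comNzRingType.

Lemma deg_ge_ideal n d : monomial_ideal (n := n) (deg_ge d).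
Proof. by move=> m1 m2 /=; rewrite mdegD; lia. Qed.
Hint Resolve deg_ge_ideal : core.

(** Locked, so that comparing two compositions never unfolds the substitution. *)
Fact mcomp_key : unit. Proof. by []. Qed.
Definition mcomp k n (p : {mpoly K[k]}) (G : 'I_k -> {mpoly K[n]}) : {mpoly K[n]} :=
  locked_with mcomp_key (p \mPo [tuple G i | i < k]).
Lemma mcompE k n (p : {mpoly K[k]}) (G : 'I_k -> {mpoly K[n]}) :
  mcomp p G = p \mPo [tuple G i | i < k].
Proof. by rewrite /mcomp unlock. Qed.

Section Comp.
Variables (k n : nat).
Implicit Types (p q : {mpoly K[k]}) (G H : 'I_k -> {mpoly K[n]}).

Lemma mcompD G p q : mcomp (p + q) G = mcomp p G + mcomp q G.
Proof. by rewrite !mcompE raddfD. Qed.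
Lemma mcompB G p q : mcomp (p - q) G = mcomp p G - mcomp q G.
Proof. by rewrite !mcompE raddfB. Qed.
Lemma mcompM G p q : mcomp (p * q) G = mcomp p G * mcomp q G.
Proof. by rewrite !mcompE rmorphM. Qed.
Lemma mcompZ G c p : mcomp (c *: p) G = c *: mcomp p G.
Proof. by rewrite !mcompE comp_mpolyZ. Qed.
Lemma mcompC G c : mcomp c%:MP G = c%:MP.
Proof. by rewrite !mcompE comp_mpolyC. Qed.
Lemma mcomp_sum G (I : Type) (r : seq I) (P : pred I) (F : I -> {mpoly K[k]}) :
  mcomp (\sum_(i <- r | P i) F i) G = \sum_(i <- r | P i) mcomp (F i) G.
Proof. by rewrite mcompE raddf_sum; apply: eq_bigr => i _; rewrite mcompE. Qed.
Lemma mcomp_prod G (I : Type) (r : seq I) (P : pred I) (F : I -> {mpoly K[k]}) :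
  mcomp (\prod_(i <- r | P i) F i) G = \prod_(i <- r | P i) mcomp (F i) G.
Proof. by rewrite mcompE rmorph_prod; apply: eq_bigr => i _; rewrite mcompE. Qed.
Lemma mcompXn G p e : mcomp (p ^+ e) G = mcomp p G ^+ e.
Proof. by rewrite !mcompE rmorphXn. Qed.
Lemma mcompU G i : mcomp 'X_i G = G i.
Proof. by rewrite mcompE comp_mpolyXU -tnth_nth tnth_mktuple. Qed.
Lemma mcompX G m : mcomp 'X_[m] G = \prod_(i < k) G i ^+ m i.
Proof.
by rewrite mcompE comp_mpolyX; apply: eq_bigr => i _; rewrite tnth_mktuple.
Qed.

Lemma eq_mcomp G H p : G =1 H -> mcomp p G = mcomp p H.
Proof. by move=> e; rewrite !mcompE; congr (_ \mPo _); apply: eq_mktuple. Qed.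

(** Substituting series without constant term is what makes composition
    compatible with truncation. *)
Definition nonconst m n (G : 'I_m -> {mpoly K[n]}) := forall i, supp_in (deg_ge 1) (G i).

Lemma supp_prod_nonconst G (m : 'X_{1..k}) : nonconst G ->
  supp_in (deg_ge (mdeg m)) (\prod_(i < k) G i ^+ m i).
Proof.
move=> G1; rewrite mdegE; elim/big_ind2: _ => [|p a q b Hp Hq|i _].
- by apply: supp_in1.
- by apply: (supp_inM Hp Hq) => m1 m2 /=; rewrite mdegD; lia.
- apply: (@supp_inXn _ _ (fun e (m : 'X_{1..n}) => is_true (e <= mdeg m)%N)) => //.
  by move=> e m1 m2 /=; rewrite mdegD; lia.
Qed.

Lemma mcomp_supp_deg d p G : supp_in (deg_ge d) p -> nonconst G ->
  supp_in (deg_ge d) (mcomp p G).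
Proof.
move=> Hp G1; rewrite [p]mpolyE mcomp_sum big_seq; apply: supp_in_sum => m.
rewrite mcoeff_msupp mcompZ mcompX => /Hp le; apply: supp_inZ.
by apply: (supp_inW _ (supp_prod_nonconst G1)) => m'; apply: leq_trans.
Qed.

Lemma eqmod_mcomp d p q G H : p =[d]= q -> (forall i, G i =[d]= H i) ->
  nonconst H -> mcomp p G =[d]= mcomp q H.
Proof.
move=> Hp HG H1; apply: (@eqmod_trans _ _ _ _ (mcomp p H)).
  rewrite [p]mpolyE !mcomp_sum; apply: eqmod_sum => m _; rewrite !mcompZ !mcompX.
  by apply: eqmodZ; apply: eqmod_prod => // i _; apply: eqmodXn.
by rewrite /eqmod -mcompB; apply: mcomp_supp_deg.
Qed.

End Comp.

Lemma mcompA k l n (p : {mpoly K[k]}) (G : 'I_k -> {mpoly K[l]})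
    (H : 'I_l -> {mpoly K[n]}) :
  mcomp (mcomp p G) H = mcomp p (fun i => mcomp (G i) H).
Proof.
rewrite [p]mpolyE !mcomp_sum. apply: eq_bigr => m _.
rewrite !mcompZ !mcompX mcomp_prod; congr (_ *: _); apply: eq_bigr => i _; exact: mcompXn.
Qed.

Lemma mcomp_id n (p : {mpoly K[n]}) : mcomp p (fun i => 'X_i) = p.
Proof. by rewrite mcompE; apply: comp_mpoly_id. Qed.

Lemma mcomp_nonconst k l n (G : 'I_k -> {mpoly K[l]}) (H : 'I_l -> {mpoly K[n]}) :
  nonconst G -> nonconst H -> nonconst (fun i => mcomp (G i) H).
Proof. by move=> G1 H1 i; apply: mcomp_supp_deg. Qed.

Lemma truncE n D (f : fps K n) m :
  (fps_trunc D f)@_m = if (mdeg m <= D)%N then f m else 0.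
Proof.
case: ifP => [le|/negbT nle]; first by rewrite /fps_trunc mcoeff_mpoly.
rewrite /fps_trunc raddf_sum big1 // => i _ /=.
rewrite mcoeffZ mcoeffX; case: eqP => [e|]; last by rewrite mulr0.
by case/negP: nle; rewrite -e -ltnS bmdeg.
Qed.

Lemma eqmod_deg n D (p q : {mpoly K[n]}) :
  (forall m, (mdeg m <= D)%N -> p@_m = q@_m) -> p =[D.+1]= q.
Proof.
move=> H; apply: coef_eqmod => m.
by case: (leqP (mdeg m) D) => [/H|]; [right|left].
Qed.

Lemma eqmod_degE n D (p q : {mpoly K[n]}) m :
  p =[D.+1]= q -> (mdeg m <= D)%N -> p@_m = q@_m.
Proof. by move=> H le; apply: (eqmod_coef H); rewrite ltnNge le. Qed.

Lemma trunc_le n d D (f : fps K n) : (d <= D)%N ->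
  fps_trunc D f =[d.+1]= fps_trunc d f.
Proof. by move=> le; apply: eqmod_deg => m ld; rewrite !truncE ld (leq_trans ld). Qed.

Lemma trunc_poly n D (p : {mpoly K[n]}) : fps_trunc D (fps_poly p) =[D.+1]= p.
Proof. by apply: eqmod_deg => m le; rewrite truncE le. Qed.

Lemma trunc_sub n D (f g : fps K n) :
  fps_trunc D (fps_sub f g) = fps_trunc D f - fps_trunc D g.
Proof. by apply/mpolyP => m; rewrite mcoeffB !truncE; case: ifP => //; rewrite subr0. Qed.

Lemma eq_trunc n D (f g : fps K n) : f =1 g -> fps_trunc D f = fps_trunc D g.
Proof. by move=> e; apply/mpolyP => m; rewrite !truncE e. Qed.

Lemma trunc_nonconst k n D (G : 'I_k -> fps K n) :
  (forall i, G i 0%MM = 0) -> nonconst (fun i => fps_trunc D (G i)).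
Proof.
move=> G0 i m; rewrite truncE; case: ifP => [_|]; last by rewrite eqxx.
by rewrite lt0n mdeg_eq0; apply: contra_neqN => /eqP ->.
Qed.

Lemma trunc_mul n D (f g : fps K n) :
  fps_trunc D (fps_mul f g) =[D.+1]= fps_trunc D f * fps_trunc D g.
Proof.
apply: eqmod_deg => m le; rewrite truncE le /fps_mul.
apply: (eqmod_degE (D := mdeg m)) => //; apply: eqmod_sym.
by apply: eqmodM => //; apply: trunc_le.
Qed.

Lemma trunc_mcomp k n D (F : fps K k) (G : 'I_k -> fps K n) :
  (forall i, G i 0%MM = 0) ->
  fps_trunc D (fps_comp F G) =[D.+1]= mcomp (fps_trunc D F) (fun i => fps_trunc D (G i)).
Proof.
move=> G0; apply: eqmod_deg => m le; rewrite truncE le /fps_comp -mcompE.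
apply: (eqmod_degE (D := mdeg m)) => //; apply: eqmod_sym; apply: eqmod_mcomp.
- exact: trunc_le.
- by move=> i; apply: trunc_le.
- exact: trunc_nonconst.
Qed.

Lemma fps_ext n (f g : fps K n) :
  (forall D, fps_trunc D f =[D.+1]= fps_trunc D g) -> f =1 g.
Proof.
move=> H m; have /(eqmod_degE (m := m)) := H (mdeg m).
by rewrite !truncE leqnn => ->.
Qed.

Lemma mcomp_trunc k n D (F : fps K k) (G : 'I_k -> {mpoly K[n]}) :
  mcomp (fps_trunc D F) G = \sum_(m : 'X_{1..k < D.+1}) F m *: \prod_(i < k) G i ^+ m i.
Proof. by rewrite mcomp_sum; apply: eq_bigr => m _; rewrite mcompZ mcompX. Qed.

End Truncation.
#[export] Hint Resolve deg_ge_ideal : core.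

(** * Supports in three variables *)

Definition i0 : 'I_3 := @Ordinal 3 0 isT.
Definition i1 : 'I_3 := @Ordinal 3 1 isT.
Definition i2 : 'I_3 := @Ordinal 3 2 isT.

Definition mon3 (a b c : nat) : 'X_{1..3} := [multinom of [:: a; b; c]].
Definition mon2 (a b : nat) : 'X_{1..2} := [multinom of [:: a; b]].

Lemma mon3E a b c : (mon3 a b c i0 = a) * (mon3 a b c i1 = b) * (mon3 a b c i2 = c).
Proof. by rewrite /mon3 !multinomE !(tnth_nth 0%N). Qed.

Lemma mon3K (m : 'X_{1..3}) : mon3 (m i0) (m i1) (m i2) = m.
Proof.
apply/mnmP => i; case: i => -[|[|[|//]]] lti; rewrite multinomE (tnth_nth 0%N) /=;
  by congr (m _); apply/val_inj.
Qed.

Lemma mon2E a b : (mon2 a b ord0 = a) * (mon2 a b ord_max = b).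
Proof. by rewrite /mon2 !multinomE !(tnth_nth 0%N). Qed.

Lemma mon2K (m : 'X_{1..2}) : mon2 (m ord0) (m ord_max) = m.
Proof.
apply/mnmP => i; case: i => -[|[|//]] lti; rewrite multinomE (tnth_nth 0%N) /=;
  by congr (m _); apply/val_inj.
Qed.

Lemma mdeg3 (m : 'X_{1..3}) : mdeg m = (m i0 + m i1 + m i2)%N.
Proof.
rewrite mdegE !big_ord_recr big_ord0 /= add0n.
by congr (_ + _ + _)%N; congr (m _); apply/val_inj.
Qed.

Lemma mdeg2 (m : 'X_{1..2}) : mdeg m = (m ord0 + m ord_max)%N.
Proof.
rewrite mdegE !big_ord_recr big_ord0 /= add0n.
by congr (_ + _)%N; congr (m _); apply/val_inj.
Qed.

Section Supp3.
Variable K : comNzRingType.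
Implicit Types (E : nat -> nat -> nat -> Prop) (p q : {mpoly K[3]}).

(** Exponents are given by their three components, so that every claim on
    supports below ends in linear arithmetic. *)
Definition on3 E : 'X_{1..3} -> Prop := fun m => E (m i0) (m i1) (m i2).
Definition supp3 E p := supp_in (on3 E) p.
Definition eqmod3 E p q := eqmod (on3 E) p q.

Definition zv : {mpoly K[3]} := 'X_i0.
Definition xv : {mpoly K[3]} := 'X_i1.
Definition sv : {mpoly K[3]} := 'X_i2.

Lemma mpolyX3 (m : 'X_{1..3}) : 'X_[m] = zv ^+ m i0 * xv ^+ m i1 * sv ^+ m i2.
Proof.
rewrite mpolyXE_id !big_ord_recr big_ord0 /= mul1r.
by congr (_ * _ * _); congr ('X_ _ ^+ m _); apply/val_inj.
Qed.

Lemma supp3W E1 E2 p : supp3 E1 p -> (forall x y s, E1 x y s -> E2 x y s) -> supp3 E2 p.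
Proof. by move=> H sub; apply: supp_inW H => m; apply: sub. Qed.

Lemma supp3I E1 E2 p : supp3 E1 p -> supp3 E2 p ->
  supp3 (fun x y s => E1 x y s /\ E2 x y s) p.
Proof. by move=> H1 H2; apply: supp_inI. Qed.

Lemma supp3M E1 E2 E p q : supp3 E1 p -> supp3 E2 q ->
  (forall x y s x' y' s', E1 x y s -> E2 x' y' s' -> E (x + x')%N (y + y')%N (s + s')%N) ->
  supp3 E (p * q).
Proof.
by move=> H1 H2 H; apply: (supp_inM H1 H2) => m1 m2; rewrite /on3 !mnmDE; apply: H.
Qed.

Lemma supp3D E p q : supp3 E p -> supp3 E q -> supp3 E (p + q).
Proof. exact: supp_inD. Qed.

Lemma supp3Z E c p : supp3 E p -> supp3 E (c *: p).
Proof. exact: supp_inZ. Qed.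

Lemma supp3_big E (I : Type) (r : seq I) (Q : pred I) (F : I -> {mpoly K[3]}) :
  (forall i, Q i -> supp3 E (F i)) -> supp3 E (\sum_(i <- r | Q i) F i).
Proof. exact: supp_in_sum. Qed.

Lemma supp3m E a b c : E a b c -> supp3 E (zv ^+ a * xv ^+ b * sv ^+ c).
Proof.
move=> H; have := mpolyX3 (mon3 a b c); rewrite !mon3E => <-.
by apply: supp_inX; rewrite /on3 !mon3E.
Qed.

Lemma supp3z E a : E a 0%N 0%N -> supp3 E (zv ^+ a).
Proof. by move=> /supp3m; rewrite !expr0 !mulr1. Qed.

Lemma supp3x E b : E 0%N b 0%N -> supp3 E (xv ^+ b).
Proof. by move=> /supp3m; rewrite !expr0 mulr1 mul1r. Qed.

Lemma supp3s E c : E 0%N 0%N c -> supp3 E (sv ^+ c).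
Proof. by move=> /supp3m; rewrite !expr0 !mul1r. Qed.

Lemma supp3Xn (E : nat -> nat -> nat -> nat -> Prop) p k :
  E 0%N 0%N 0%N 0%N -> supp3 (E 1%N) p ->
  (forall i x y s x' y' s', E i x y s -> E 1%N x' y' s' ->
     E i.+1 (x + x')%N (y + y')%N (s + s')%N) ->
  supp3 (E k) (p ^+ k).
Proof.
move=> E0 E1 ES; apply: (supp_inXn (E := fun i => on3 (E i))) => //.
- by rewrite /on3 !mnm0E.
- by move=> i m1 m2; rewrite /on3 !mnmDE; apply: ES.
Qed.

Lemma coef3m a b c x y s :
  (zv ^+ a * xv ^+ b * sv ^+ c)@_(mon3 x y s) = ((a == x) && (b == y) && (c == s))%:R.
Proof.
have := mpolyX3 (mon3 a b c); rewrite !mon3E => <-; rewrite mcoeffX.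
congr (nat_of_bool _)%:R; apply/eqP/andP => [e|[/andP[/eqP-> /eqP->] /eqP->]//].
have := congr1 (fun m : 'X_{1..3} => m i0) e.
have := congr1 (fun m : 'X_{1..3} => m i1) e.
have := congr1 (fun m : 'X_{1..3} => m i2) e.
by rewrite !mon3E => -> -> ->; rewrite !eqxx.
Qed.

Lemma coef3_supp E p x y s : supp3 E p -> ~ E x y s -> p@_(mon3 x y s) = 0.
Proof.
move=> H nE; apply/eqP/negPn/negP => /H.
by rewrite /on3 !mon3E.
Qed.

(** The right-hand side is of second order in [x - y], since each
    [x ^+ l - y ^+ l] is again divisible by [x - y]; kept in factored form, the
    supports of the two factors can be bounded separately. *)
Lemma subrX_linear (x y : {mpoly K[3]}) n :
  x ^+ n - y ^+ n - (y ^+ n.-1 *+ n) * (x - y) =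
  (x - y) * \sum_(i < n) (x ^+ (n.-1 - i) - y ^+ (n.-1 - i)) * y ^+ i.
Proof.
rewrite subrXX [_ *+ n * _]mulrC -mulrBr; congr (_ * _).
have -> : y ^+ n.-1 *+ n = \sum_(i < n) y ^+ (n.-1 - i) * y ^+ i.
  rewrite (eq_bigr (fun=> y ^+ n.-1)); first by rewrite sumr_const card_ord.
  by move=> i _; rewrite -exprD; congr (_ ^+ _); case: i => i /=; lia.
by rewrite -sumrB; apply: eq_bigr => i _; rewrite mulrBl.
Qed.

End Supp3.

Section Evaluation.
Variable K : comNzRingType.

Definition ev2 (F : fps K 2) D n (x y : {mpoly K[n]}) : {mpoly K[n]} :=
  mcomp (fps_trunc D F) (fun i : 'I_2 => if i == ord0 then x else y).

Definition ev3 (F : fps K 3) D n (x y s : {mpoly K[n]}) : {mpoly K[n]} :=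
  mcomp (fps_trunc D F) (fun i : 'I_3 => if i == i0 then x else if i == i1 then y else s).

Lemma ev2E F D n (x y : {mpoly K[n]}) :
  ev2 F D x y = \sum_(m : 'X_{1..2 < D.+1}) F m *: (x ^+ m ord0 * y ^+ m ord_max).
Proof.
rewrite /ev2 mcomp_trunc; apply: eq_bigr => m _.
rewrite !big_ord_recr big_ord0 /= mul1r.
by congr (_ *: (_ ^+ (m : 'X_{1..2}) _ * _ ^+ (m : 'X_{1..2}) _)); apply/val_inj.
Qed.

Lemma ev3E F D n (x y s : {mpoly K[n]}) :
  ev3 F D x y s =
  \sum_(m : 'X_{1..3 < D.+1}) F m *: (x ^+ m i0 * y ^+ m i1 * s ^+ m i2).
Proof.
rewrite /ev3 mcomp_trunc; apply: eq_bigr => m _.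
rewrite !big_ord_recr big_ord0 /= mul1r.
congr (_ *: (_ ^+ (m : 'X_{1..3}) _ * _ ^+ (m : 'X_{1..3}) _ * _ ^+ (m : 'X_{1..3}) _));
  by apply/val_inj.
Qed.

Lemma trunc3E (F : fps K 3) D : fps_trunc D F =
  \sum_(m : 'X_{1..3 < D.+1}) F m *: (zv K ^+ m i0 * xv K ^+ m i1 * sv K ^+ m i2).
Proof. by apply: eq_bigr => m _; rewrite mpolyX3. Qed.

Lemma supp3_sum E D n (P : pred 'X_{1..n < D}) (F : fps K n) (t : 'X_{1..n < D} -> {mpoly K[3]}) :
  (forall m, P m -> F m != 0 -> supp3 E (t m)) ->
  supp3 E (\sum_(m : 'X_{1..n < D} | P m) F m *: t m).
Proof.
move=> H; apply: supp_in_sum => m Pm.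
have [->|nz] := eqVneq (F m) 0; first by rewrite scale0r; apply: supp_in0.
by apply: supp_inZ; apply: H.
Qed.

(** Separates the part of [F] known by the induction on the power of w, a single
    monomial, from the part of order at least [k] in w. *)
Lemma sum_split_low D (F : fps K 2) (t : 'X_{1..2} -> {mpoly K[3]}) a b k :
  (b < k)%N -> (a + b <= D)%N ->
  (forall m : 'X_{1..2}, (m ord_max < k)%N -> F m = (m == mon2 a b)%:R) ->
  \sum_(m : 'X_{1..2 < D.+1}) F m *: t m =
  t (mon2 a b) + \sum_(m : 'X_{1..2 < D.+1} | (k <= (m : 'X_{1..2}) ord_max)%N) F m *: t m.
Proof.
move=> bk abD HF; rewrite (bigID (fun m : 'X_{1..2 < D.+1} => k <= (m : 'X_{1..2}) ord_max)%N) /=.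
rewrite addrC; congr (_ + _).
have lt : (mdeg (mon2 a b) < D.+1)%N by rewrite mdeg2 !mon2E.
rewrite (bigD1 (BMultinom lt)) /=; last by rewrite mon2E -ltnNge.
rewrite HF ?mon2E // eqxx scale1r big1 ?addr0 // => m /andP[mk ne].
rewrite HF ?ltnNge // (_ : (_ == _) = false) ?scale0r //.
by apply: contraNF ne => /eqP e; apply/eqP/val_inj.
Qed.

Lemma ev2_split (F : fps K 2) D (u v : {mpoly K[3]}) a b k :
  (b < k)%N -> (a + b <= D)%N ->
  (forall m : 'X_{1..2}, (m ord_max < k)%N -> F m = (m == mon2 a b)%:R) ->
  ev2 F D u v = u ^+ a * v ^+ b +
    \sum_(m : 'X_{1..2 < D.+1} | (k <= (m : 'X_{1..2}) ord_max)%N)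
       F m *: (u ^+ (m : 'X_{1..2}) ord0 * v ^+ (m : 'X_{1..2}) ord_max).
Proof.
move=> bk abD HF; rewrite ev2E.
by rewrite (sum_split_low (fun m => u ^+ m ord0 * v ^+ m ord_max) bk abD HF) !mon2E.
Qed.

(** Summing over the monomials of [phi] with z-exponent [al] and s-exponent [mu]
    a term that is [A] at the x-exponent [j] only: the coefficient comparisons
    below produce their right-hand sides in this shape. *)
Lemma sum_slice (phi : fps K 3) D al mu j (A : K) : (al + j + mu <= D)%N \/ A = 0 ->
  \sum_(m : 'X_{1..3 < D.+1}) phi m *
    (if ((m : 'X_{1..3}) i0 == al) && ((m : 'X_{1..3}) i2 == mu)
     then A *+ ((m : 'X_{1..3}) i1 == j) else 0) = phi (mon3 al j mu) * A.
Proof.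
case=> [le|->]; last by rewrite mulr0 big1 // => m _; rewrite mul0rn if_same mulr0.
have lt : (mdeg (mon3 al j mu) < D.+1)%N by rewrite mdeg3 !mon3E.
rewrite (bigD1 (BMultinom lt)) //= !mon3E !eqxx mulr1n /=.
rewrite big1 ?addr0 // => m nem; case: ifP => [/andP[/eqP e0 /eqP e2]|_]; last exact: mulr0.
case: eqP => [e1|]; last by rewrite mulr0n mulr0.
by case/eqP: nem; apply/val_inj; rewrite /= -[LHS]mon3K e0 e1 e2.
Qed.

End Evaluation.

(** * The mapping equation *)

Section Stage.
Variables (K : numClosedFieldType) (iota : K).
Hypothesis iota0 : iota != 0.

Local Notation z := (zv K).
Local Notation x := (xv K).
Local Notation s := (sv K).

(** The series w = s + iota phi and its conjugate w' = s - iota phi, on the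
    complexified graph; [iota] is a square root of -1 in the applications. *)
Definition graph_param phi D : {mpoly K[3]} := s + iota *: fps_trunc D phi.
Definition graph_param' phi D : {mpoly K[3]} := s - iota *: fps_trunc D phi.

(** The image of the parametrised graph under (f, g) lies in the graph.  The
    conjugated series are separate arguments: the coefficient comparisons treat
    the four series as independent. *)
Definition mapping_equation (phi : fps K 3) (f g f' g' : fps K 2) := forall D,
  let G := ev2 g D z (graph_param phi D) in
  let G' := ev2 g' D x (graph_param' phi D) in
  (2 * iota)^-1 *: (G - G') =[D.+1]=
  ev3 phi D (ev2 f D z (graph_param phi D)) (ev2 f' D x (graph_param' phi D))
    (2^-1 *: (G + G')).

Variables (phi : fps K 3) (f g f' g' : fps K 2).
Hypothesis Heq : mapping_equation phi f g f' g'.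

(* Coefficients are compared at z^T x^N s^(mu + k) with T = al - 1 + de.  For
   de = 1 this detects z w^k in f, w^(k+1) in g and x^q w^k in f'; for de = 0
   it detects w^k in f alone. *)
Variables (al mu de T N k : nat).
Hypotheses (al_gt0 : (0 < al)%N) (almu : (1 < al + mu)%N) (T_gt0 : (0 < T)%N)
  (T_de : (T + 1 = al + de)%N) (de_le1 : (de <= 1)%N) (N_gt0 : (0 < N)%N).
(* Minimality of the invariant pair (al, mu). *)
Hypothesis Hphi : forall m, phi m != 0 ->
  [/\ (0 < m i0)%N, (0 < m i1)%N &
      [\/ m i0 = al /\ m i2 = mu, (mu < m i2)%N | (al + mu < m i0 + m i2)%N]].
Variable G : K.

Local Notation D := (T + N + mu + k)%N.
(* The monomials that do not divide the target.  They form an ideal, and a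
   series can be changed modulo it without changing the coefficient. *)
Local Notation ND := (fun a b c : nat => T < a \/ N < b \/ mu + k < c)%N.
Local Notation P := (fps_trunc D phi).
Local Notation w := (graph_param phi D).
Local Notation w' := (graph_param' phi D).

Local Lemma ND_ideal : monomial_ideal (on3 ND).
Proof. by move=> m1 m2; rewrite /on3 !mnmDE; lia. Qed.

Local Lemma ND_deg (p q : {mpoly K[3]}) : p =[D.+1]= q -> eqmod (on3 ND) p q.
Proof. by apply: eqmodW => m; rewrite /on3 mdeg3; lia. Qed.

Local Notation Phi := (fun a b c : nat => ND a b c \/
  (al <= a /\ mu <= c) \/ (1 <= a /\ mu + 1 <= c))%N.

(** As T <= al, a monomial of phi that divides the target and has al + mu < a + c
    has mu < c: among the divisors of the target, phi starts at z^al s^mu, with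
    anything else of higher order in s. *)
Lemma stageP : supp3 Phi P.
Proof.
rewrite trunc3E; apply: supp3_sum => m _ /Hphi [m0 m1 H]; apply: supp3m.
by case: H => [[-> ->]||]; lia.
Qed.

(* In a divisor of the target, w^l contributes s^l, or l - 1 factors s and one
   factor phi. *)
Local Notation W l := (fun a b c : nat => ND a b c \/ l <= c \/ (al <= a /\ l + mu <= c + 1))%N.

Lemma stageW (e : K) l : supp3 (W l) ((s + e *: P) ^+ l).
Proof.
have H1 : supp3 (W 1%N) (s + e *: P).
  apply: supp3D; first by rewrite -[s]expr1; apply: supp3s; lia.
  by apply: supp3Z; apply: (supp3W stageP) => *; lia.
by apply: (supp3Xn (E := fun l => W l)) => // *; lia.
Qed.
Arguments stageW : clear implicits.

(** The factor z of phi: once z^al has been used, a further term of w - s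
    exceeds the exponent T of z. *)
Lemma stageWz (e : K) l : eqmod3 (fun a _ _ => 0 < a)%N ((s + e *: P) ^+ l) (s ^+ l).
Proof.
have idz : monomial_ideal (on3 (fun a _ _ : nat => (0 < a)%N)).
  by move=> m1 m2; rewrite /on3 !mnmDE; lia.
apply: eqmodXn => //; rewrite /eqmod addrAC subrr add0r; apply: supp3Z.
by rewrite trunc3E; apply: supp3_sum => m _ /Hphi [m0 m1 H]; apply: supp3m.
Qed.
Arguments stageWz : clear implicits.

(** The difference contains at least one factor phi, hence always a factor z. *)
Lemma stageWs (e : K) l :
  supp3 (fun a b c => ND a b c \/ (al <= a /\ l + mu <= c + 1)
     \/ (1 <= a /\ mu + l <= c))%N ((s + e *: P) ^+ l - s ^+ l).
Proof.
case: l => [|l]; first by rewrite !expr0 subrr; apply: supp_in0.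
rewrite subrXX; apply: (supp3M (E1 := Phi) (E2 := W l)).
- by rewrite addrAC subrr add0r; apply: supp3Z; apply: stageP.
- apply: supp3_big => i _; have il := ltn_ord i.
apply: (supp3M (stageW e (l.+1.-1 - i)) (E2 := fun _ _ c => i <= c)%N).
    by apply: supp3s.
  by move=> a b c a' b' c'; lia.
- by move=> a b c a' b' c'; lia.
Qed.
Arguments stageWs : clear implicits.

(** Two factors phi already exceed z^T s^(mu+k): each contains z, and in addition
    z^al or s^(mu+1). *)
Lemma stageWk (e : K) :
  eqmod (on3 ND) ((s + e *: P) ^+ k.+1) (s ^+ k.+1 + (e * k.+1%:R) *: (s ^+ k * P)).
Proof.
have -> : (e * k.+1%:R) *: (s ^+ k * P) = (s ^+ k.+1.-1 *+ k.+1) * (s + e *: P - s).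
  by rewrite addrAC subrr add0r mulrnAl -scalerAr -scaler_nat scalerA mulrC.
rewrite /eqmod opprD addrA subrX_linear.
apply: (supp3M (E1 := Phi) (E2 := fun a b c => ND a b c \/
   1 <= a /\ (k <= c \/ al <= a))%N).
- by rewrite addrAC subrr add0r; apply: supp3Z; apply: stageP.
- apply: supp3_big => i _; have il := ltn_ord i.
  apply: (supp3M (supp3I (stageWs e (k.+1.-1 - i)) (stageWz e (k.+1.-1 - i)))
     (E2 := fun _ _ c => i <= c)%N).
    by apply: supp3s.
  by move=> a b c a' b' c'; lia.
- by move=> a b c a' b' c'; lia.
Qed.
Arguments stageWk : clear implicits.

Local Notation NE := (fun a b c : nat => ~ (a = T /\ b = N /\ c = mu + k))%N.
Local Notation tgt := (mon3 T N (mu + k)).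

Lemma stage_coef0 (p : {mpoly K[3]}) : supp3 NE p -> p@_tgt = 0.
Proof. by move=> H; apply: (coef3_supp H); case. Qed.

Lemma stage_coef (p q : {mpoly K[3]}) : eqmod (on3 ND) p q -> p@_tgt = q@_tgt.
Proof. by move=> H; apply: (eqmod_coef H); rewrite /on3 !mon3E; lia. Qed.

Lemma stage_skP : (s ^+ k * P)@_tgt = phi (mon3 T N mu).
Proof.
have -> : s ^+ k = 'X_[mon3 0 0 k] by rewrite mpolyX3 !mon3E !expr0 !mul1r.
have -> : tgt = (mon3 0 0 k + mon3 T N mu)%MM.
  apply/mnmP => i; rewrite mnmDE /mon3 !multinomE !(tnth_nth 0%N).
  by case: i => -[|[|[|//]]] ? /=; lia.
by rewrite mulrC mcoeffMX truncE mdeg3 !mon3E ifT //; lia.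
Qed.

(** The part of g (or g') of order larger than k in w: pure powers z^i s^l or
    x^i s^l do not contain both z and x, so one factor phi must be used, and only
    G w^(k+1) is small enough; for de = 0 nothing is. *)
Lemma stage_tail (e : K) (F : fps K 2) (u : {mpoly K[3]}) : u = z \/ u = x ->
  (de = 1%N -> forall i, F (mon2 i k.+1) = G *+ (i == 0%N)) ->
  (\sum_(m : 'X_{1..2 < D.+1} | (k < (m : 'X_{1..2}) ord_max)%N)
     F m *: (u ^+ (m : 'X_{1..2}) ord0 * (s + e *: P) ^+ (m : 'X_{1..2}) ord_max))@_tgt =
  (e * k.+1%:R * G * phi (mon3 al N mu)) *+ de.
Proof.
move=> Hu HF.
have u_supp i : supp3 (fun a b c => c = 0 /\ ((a = i /\ b = 0) \/ (a = 0 /\ b = i)))%N (u ^+ i).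
  by case: Hu => ->; [apply: supp3z | apply: supp3x]; lia.
have us_coef i l : (u ^+ i * s ^+ l)@_tgt = 0.
  apply: stage_coef0; apply: (supp3M (u_supp i) (E2 := fun a b c => a = 0 /\ b = 0)%N).
    by apply: supp3s.
  by move=> *; lia.
have Wcoef i l : (k < l)%N -> (de = 1%N -> (k.+1 < l)%N \/ (0 < i)%N) ->
    u = z \/ de = 0%N \/ (k.+1 < l)%N -> (u ^+ i * (s + e *: P) ^+ l)@_tgt = 0.
  move=> kl Hil Hz.
  have -> : u ^+ i * (s + e *: P) ^+ l =
    u ^+ i * s ^+ l + u ^+ i * ((s + e *: P) ^+ l - s ^+ l) by ring.
  rewrite mcoeffD us_coef add0r; apply: stage_coef0.
  have [uz|nuz] := eqVneq u z.
    apply: (supp3M (E1 := fun a b c => a = i) _ (stageWs e l)); first by rewrite uz; apply: supp3z.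
    by move=> *; lia.
  apply: (supp3M (u_supp i) (stageWs e l)) => a b c a' b' c'.
  by case: Hz => [uz|]; [rewrite uz eqxx in nuz | lia].
have lt : (mdeg (mon2 0 k.+1) < D.+1)%N by rewrite mdeg2 !mon2E; lia.
rewrite raddf_sum /= (bigD1 (BMultinom lt)) /=; last by rewrite mon2E.
rewrite big1 ?addr0 => [|m /andP[km nem]].
  rewrite !mon2E expr0 mul1r mcoeffZ.
  have [de1|de0] : de = 1%N \/ de = 0%N by lia.
    rewrite (stage_coef (stageWk e)) mcoeffD mcoeffZ stage_skP (HF de1) de1 !mulr1n.
    have /= := us_coef 0%N k.+1; rewrite expr0 mul1r => ->.
    have -> : T = al by lia.
    by ring.
  by have /= := Wcoef 0%N k.+1; rewrite expr0 mul1r => ->; rewrite ?mulr0 ?de0 //; lia.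
rewrite mcoeffZ.
have [de1|de0] : de = 1%N \/ de = 0%N by lia.
  have [lk|nlk] := eqVneq (m : 'X_{1..2}) (mon2 ((m : 'X_{1..2}) ord0) k.+1).
    have i0 : ((m : 'X_{1..2}) ord0 == 0%N) = false.
      apply: contraNF nem => /eqP e0; apply/eqP/val_inj; by rewrite /= lk e0.
    by rewrite [F _](_ : _ = 0) ?mul0r // lk (HF de1) i0.
  have lk : (k.+1 < (m : 'X_{1..2}) ord_max)%N.
    rewrite ltn_neqAle km andbT eq_sym; apply: contra_neq nlk => e1.
    by rewrite -[LHS]mon2K e1.
  by rewrite Wcoef ?mulr0 //; lia.
by rewrite Wcoef ?mulr0 //; lia.
Qed.

Hypothesis k_gt0 : (0 < k)%N.
Hypothesis Hf : forall m : 'X_{1..2}, (m ord_max < k)%N -> f m = (m == mon2 1 0)%:R.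
Hypothesis Hf' : forall m : 'X_{1..2}, (m ord_max < k)%N -> f' m = (m == mon2 1 0)%:R.
Hypothesis Hg : forall m : 'X_{1..2}, (m ord_max < k.+1)%N -> g m = (m == mon2 0 1)%:R.
Hypothesis Hg' : forall m : 'X_{1..2}, (m ord_max < k.+1)%N -> g' m = (m == mon2 0 1)%:R.
Hypothesis Hf0 : de = 1%N -> f (mon2 0 k) = 0.
Hypothesis HG : de = 1%N -> forall i, g (mon2 i k.+1) = G *+ (i == 0%N).
Hypothesis HG' : de = 1%N -> forall i, g' (mon2 i k.+1) = G *+ (i == 0%N).

(** The two conjugate contributions e = iota and e = - iota add up, which
    accounts for the division by 2 iota. *)
Lemma stageLHS : ((2 * iota)^-1 *: (ev2 g D z w - ev2 g' D x w'))@_tgt =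
  P@_tgt + (k.+1%:R * G * phi (mon3 al N mu)) *+ de.
Proof.
have w'E : w' = s + (- iota) *: P by rewrite scaleNr.
rewrite (ev2_split (a := 0) (b := 1) _ _ _ _ Hg) //; last by lia.
rewrite (ev2_split (a := 0) (b := 1) _ _ _ _ Hg') //; last by lia.
rewrite !expr0 !expr1 !mul1r w'E mcoeffZ.
rewrite opprD addrACA mcoeffD.
have -> : w - (s + - iota *: P) = (2 * iota) *: P.
  by rewrite /graph_param scaleNr opprB addrC addrA subrK -scalerDl mulr_natl mulr2n.
rewrite mcoeffZ mulrDr mulrA mulVf ?mulf_neq0 ?pnatr_eq0 // mul1r; congr (_ + _).
rewrite mcoeffB [X in _ * (X - _)](stage_tail iota (or_introl erefl) HG).
rewrite [X in _ * (_ - X)](stage_tail (- iota) (or_intror erefl) HG').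
have [->|->] : de = 1%N \/ de = 0%N by lia.
  by rewrite !mulr1n; field; rewrite iota0.
by rewrite !mulr0n subrr mulr0.
Qed.

Local Notation dX := (ev2 f D z w - z).
Local Notation dY := (ev2 f' D x w' - x).
Local Notation dZ := (2^-1 *: (ev2 g D z w + ev2 g' D x w') - s).

Local Notation tail l F u v := (\sum_(m : 'X_{1..2 < D.+1} | (l <= (m : 'X_{1..2}) ord_max)%N)
     F m *: (u ^+ (m : 'X_{1..2}) ord0 * v ^+ (m : 'X_{1..2}) ord_max)).

Lemma stage_dXE : dX = tail k f z w.
Proof.
rewrite (ev2_split (a := 1) (b := 0) _ _ _ _ Hf) //; last by lia.
by rewrite expr0 expr1 mulr1 addrAC subrr add0r.
Qed.

Lemma stage_dYE : dY = tail k f' x w'.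
Proof.
rewrite (ev2_split (a := 1) (b := 0) _ _ _ _ Hf') //; last by lia.
by rewrite expr0 expr1 mulr1 addrAC subrr add0r.
Qed.

Lemma stage_dZE : dZ = 2^-1 *: (tail k.+1 g z w + tail k.+1 g' x w').
Proof.
rewrite (ev2_split (a := 0) (b := 1) _ _ _ _ Hg) //; last by lia.
rewrite (ev2_split (a := 0) (b := 1) _ _ _ _ Hg') //; last by lia.
rewrite !expr0 !expr1 !mul1r addrACA scalerDr addrAC.
have -> : w + w' = 2 *: s.
  by rewrite /graph_param /graph_param' addrACA subrr addr0 scaler_nat mulr2n.
by rewrite scalerA mulVf ?pnatr_eq0 // scale1r subrr add0r.
Qed.

(* The displacements (dX, dY, dZ) of the arguments (z, x, s) of phi are of order k
   in s, up to the terms with a factor phi.  The term w^k of f carries no factor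
   z: Acl excludes it when de = 1, by the hypothesis that its coefficient
   vanishes. *)
Local Notation Acl := (fun a b c : nat => ND a b c \/ (k <= c /\ k + de <= a + c))%N.
Local Notation Bcl := (fun a b c : nat => ND a b c \/ k <= c \/ (al <= a /\ k + mu <= c + 1))%N.
Local Notation Ccl := (fun a b c : nat => ND a b c \/ k + 1 <= c \/ (al <= a /\ k + mu <= c))%N.

Lemma stage_low_f (m : 'X_{1..2}) :
  f m != 0 -> m ord_max = k -> (de <= m ord0)%N.
Proof.
move=> nz e; have [//|lt] := leqP; have [de1 m0] : de = 1%N /\ m ord0 = 0%N by lia.
by move: nz; rewrite -[m]mon2K e m0 (Hf0 de1) eqxx.
Qed.

Lemma stage_dX : supp3 Acl dX.
Proof.
rewrite stage_dXE; apply: supp3_sum => m km nz.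
have H := stage_low_f nz.
apply: (supp3M (E1 := fun a b c => a = (m : 'X_{1..2}) ord0) _ (stageW iota _)).
  exact: supp3z.
by move=> *; lia.
Qed.

Lemma stage_dY : supp3 Bcl dY.
Proof.
rewrite stage_dYE; apply: supp3_sum => m km nz.
rewrite /graph_param' -scaleNr.
apply: (supp3M (E1 := fun a b c => True) _ (stageW (- iota) _)).
  exact: supp3x.
by move=> *; lia.
Qed.

Lemma stage_dZ : supp3 Ccl dZ.
Proof.
rewrite stage_dZE; apply: supp3Z; apply: supp3D; apply: supp3_sum => m km nz.
  apply: (supp3M (E1 := fun a b c => True) _ (stageW iota _)); first exact: supp3z.
  by move=> *; lia.
rewrite /graph_param' -scaleNr.
apply: (supp3M (E1 := fun a b c => True) _ (stageW (- iota) _)); first exact: supp3x.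
by move=> *; lia.
Qed.

Local Notation X := (ev2 f D z w).
Local Notation Y := (ev2 f' D x w').
Local Notation Z := (2^-1 *: (ev2 g D z w + ev2 g' D x w')).
(* Supports of X^e and of X^e - z^e: each factor z is kept or replaced by a
   monomial of dX, which brings s^k, and z s^k or a larger total exponent if
   de = 1. *)
Local Notation KK e := (fun a b c : nat => ND a b c \/ e <= a \/ (k <= c /\ k + e + de <= a + c + 1))%N.
Local Notation XD e := (fun a b c : nat => ND a b c \/ (k <= c /\ k + e + de <= a + c + 1))%N.

Lemma stageX e : supp3 (KK e) (X ^+ e).
Proof.
apply: (supp3Xn (E := fun e => KK e)); [by lia| |by move=> *; lia].
have -> : X = z ^+ 1 + dX by rewrite expr1 [RHS]addrC subrK.
by apply: supp3D; [apply: supp3z; lia | apply: (supp3W stage_dX) => *; lia].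
Qed.

Lemma stageXD e : supp3 (XD e) (X ^+ e - z ^+ e).
Proof.
case: e => [|e]; first by rewrite !expr0 subrr; apply: supp_in0.
rewrite subrXX; apply: (supp3M stage_dX (E2 := KK e)); last by move=> *; lia.
apply: supp3_big => i _; have il := ltn_ord i.
apply: (supp3M (@stageX _) (E2 := fun a b c => i <= a)%N); first by apply: supp3z.
by move=> *; lia.
Qed.

Lemma stageYD e : supp3 Bcl (Y ^+ e - x ^+ e).
Proof.
rewrite subrXX; apply: (supp3M stage_dY (E2 := fun _ _ _ => True)) => //.
by move=> *; lia.
Qed.

Lemma stageZ e : supp3 (fun a b c => ND a b c \/ e <= c)%N (Z ^+ e).
Proof.
apply: (supp3Xn (E := fun e a b c => ND a b c \/ e <= c)%N); [by lia| |by move=> *; lia].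
have -> : Z = s ^+ 1 + dZ by rewrite expr1 [RHS]addrC subrK.
by apply: supp3D; [apply: supp3s; lia | apply: (supp3W stage_dZ) => *; lia].
Qed.

Lemma stageZD e : supp3 (fun a b c => ND a b c \/ e + k <= c \/ (0 < e /\ al <= a /\ k + mu + e <= c + 1))%N
  (Z ^+ e - s ^+ e).
Proof.
case: e => [|e]; first by rewrite !expr0 subrr; apply: supp_in0.
rewrite subrXX; apply: (supp3M stage_dZ (E2 := fun a b c => ND a b c \/ e <= c)%N); last by move=> *; lia.
apply: supp3_big => i _; have il := ltn_ord i.
apply: (supp3M (@stageZ _) (E2 := fun a b c => i <= c)%N); first by apply: supp3s.
by move=> *; lia.
Qed.

(* The first variation of z^al x^j s^mu. *)
Local Notation variation j := (z ^+ al.-1 * dX * x ^+ j * s ^+ mu *+ al +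
  z ^+ al * (x ^+ j.-1 * dY) * s ^+ mu *+ j + z ^+ al * x ^+ j * (s ^+ mu.-1 * dZ) *+ mu).

Lemma stage_ideal (p q : {mpoly K[3]}) : supp3 ND p -> supp3 ND (p * q).
Proof. by move=> H; apply: supp_ideal H; apply: ND_ideal. Qed.

(** The key estimate.  Passing from (z, x, s) to (X, Y, Z) in a monomial of phi
    outside the slice (al, mu) never reaches the target, and on the slice (al, mu) only the
    first variation does: X^be Y^j Z^nu - z^be x^j s^nu is telescoped into three
    differences, and each is linearised by [subrX_linear]. *)
Lemma stage_monomial be j nu : (0 < be)%N ->
  [\/ be = al /\ nu = mu, (mu < nu)%N | (al + mu < be + nu)%N] ->
  eqmod (on3 ND) (X ^+ be * Y ^+ j * Z ^+ nu - z ^+ be * x ^+ j * s ^+ nu)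
    (if (be == al) && (nu == mu) then variation j else 0).
Proof.
move=> be_gt0 H.
have -> : X ^+ be * Y ^+ j * Z ^+ nu - z ^+ be * x ^+ j * s ^+ nu =
  (X ^+ be - z ^+ be) * Z ^+ nu * Y ^+ j + z ^+ be * ((Y ^+ j - x ^+ j) * Z ^+ nu) +
  z ^+ be * x ^+ j * (Z ^+ nu - s ^+ nu) by ring.
case: ifP => [/andP[/eqP -> /eqP ->]|main]; last first.
  rewrite /eqmod subr0 -/(supp3 ND _); apply: supp3D; first apply: supp3D.
  - apply: stage_ideal.
    apply: (supp3M (@stageXD be) (@stageZ nu)) => a b c a' b' c' H1 H2.
    by case: H => [[e1 e2]|lt|lt]; [rewrite e1 e2 !eqxx in main | lia | lia].
  - apply: (supp3M (E1 := fun a b c => a = be) (E2 := fun a b c => ND a b c \/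
       nu + k <= c \/ al <= a)%N); first exact: supp3z.
      by apply: (supp3M (@stageYD j) (@stageZ nu)) => a b c a' b' c' H1 H2; lia.
    move=> a b c a' b' c' H1 H2.
    by case: H => [[e1 e2]|lt|lt]; [rewrite e1 e2 !eqxx in main | lia | lia].
  - rewrite -mulrA [x ^+ j * _]mulrC.
    apply: (supp3M (E1 := fun a b c => a = be) (E2 := fun a b c => ND a b c \/
       nu + k <= c \/ al <= a)%N); first exact: supp3z.
      by apply: (supp3M (@stageZD nu) (E2 := fun _ _ _ => True)) => // *; lia.
    move=> a b c a' b' c' H1 H2.
    by case: H => [[e1 e2]|lt|lt]; [rewrite e1 e2 !eqxx in main | lia | lia].
apply: eqmodD; first apply: eqmodD.
- rewrite /eqmod.
  have -> : (X ^+ al - z ^+ al) * Z ^+ mu * Y ^+ j - z ^+ al.-1 * dX * x ^+ j * s ^+ mu *+ al =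
    (X ^+ al - z ^+ al) * (Z ^+ mu * (Y ^+ j - x ^+ j)) +
    (X ^+ al - z ^+ al) * (Z ^+ mu - s ^+ mu) * x ^+ j +
    (X ^+ al - z ^+ al - (z ^+ al.-1 *+ al) * dX) * s ^+ mu * x ^+ j by ring.
  rewrite -/(supp3 ND _); apply: supp3D; first apply: supp3D.
  + apply: (supp3M (@stageXD al) (E2 := fun a b c => ND a b c \/
       mu + k <= c \/ (al <= a /\ k + mu + mu <= c + 1))%N).
      by apply: (supp3M (@stageZ mu) (@stageYD j)) => *; lia.
    by move=> *; lia.
  + apply: stage_ideal.
    by apply: (supp3M (@stageXD al) (@stageZD mu)) => *; lia.
  + apply: stage_ideal.
    rewrite subrX_linear.
    apply: (supp3M (E1 := (fun a b c => ND a b c \/ k + k <= c)%N)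
       (E2 := fun a b c => c = mu)); [|exact: supp3s|by move=> *; lia].
    apply: (supp3M stage_dX (E2 := fun a b c => ND a b c \/ k <= c)%N); last by move=> *; lia.
    apply: supp3_big => i _.
    apply: (supp3M (@stageXD _) (E2 := fun a b c => True)); first by apply: supp3z.
    by move=> *; lia.
- rewrite /eqmod.
  have -> : z ^+ al * ((Y ^+ j - x ^+ j) * Z ^+ mu) - z ^+ al * (x ^+ j.-1 * dY) * s ^+ mu *+ j =
    z ^+ al * ((Y ^+ j - x ^+ j) * (Z ^+ mu - s ^+ mu)) +
    z ^+ al * ((Y ^+ j - x ^+ j - (x ^+ j.-1 *+ j) * dY) * s ^+ mu) by ring.
  rewrite -/(supp3 ND _); apply: supp3D.
  + apply: (supp3M (E1 := fun a b c => a = al) (E2 := fun a b c => ND a b c \/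
       mu + k < c \/ al <= a)%N); first exact: supp3z.
      by apply: (supp3M (@stageYD j) (@stageZD mu)) => *; lia.
    by move=> *; lia.
  + apply: (supp3M (E1 := fun a b c => a = al) (E2 := fun a b c => ND a b c \/
       mu + k < c \/ al <= a)%N); first exact: supp3z.
      rewrite subrX_linear.
      apply: (supp3M (E1 := (fun a b c => ND a b c \/ k + k <= c \/ al <= a)%N)
        (E2 := fun a b c => c = mu)); [|exact: supp3s|by move=> *; lia].
      apply: (supp3M stage_dY (E2 := Bcl)); last by move=> *; lia.
      apply: supp3_big => i _.
      apply: (supp3M (@stageYD _) (E2 := fun a b c => True)); first by apply: supp3x.
      by move=> *; lia.
    by move=> *; lia.
- rewrite /eqmod.
  rewrite -mulrnAr -mulrBr -mulrnAl [z ^+ al * x ^+ j]mulrC -mulrA mulrC.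
  rewrite -/(supp3 ND _); apply: stage_ideal.
  apply: (supp3M (E1 := fun a b c => a = al) (E2 := fun a b c => ND a b c \/
       mu + k < c \/ al <= a)%N); [exact: supp3z| |by move=> *; lia].
  rewrite subrX_linear.
  apply: (supp3M stage_dZ (E2 := fun a b c => ND a b c \/ mu + k <= c + 1 \/ al <= a)%N); last by move=> *; lia.
  apply: supp3_big => i _; have il := ltn_ord i.
  apply: (supp3M (@stageZD _) (E2 := fun a b c => c = i)); first by apply: supp3s.
  by move=> *; lia.
Qed.

(** With k factors s and T - al + 1 = de factors z to be supplied by dX, only the
    monomial z^de w^k of f is left. *)
Lemma stage_var_z j :
  (z ^+ al.-1 * dX * x ^+ j * s ^+ mu)@_tgt = f (mon2 de k) *+ (j == N).
Proof.
pose lead : {mpoly K[3]} := f (mon2 de k) *: (z ^+ de * s ^+ k).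
have H : supp3 (fun a b c => ND a b c \/ de + 1 <= a \/ k + 1 <= c \/ (al <= a /\ k + mu <= c))%N
    (dX - lead).
  have lt : (mdeg (mon2 de k) < D.+1)%N by rewrite mdeg2 !mon2E; lia.
  rewrite stage_dXE (bigD1 (BMultinom lt)) /=; last by rewrite mon2E.
  rewrite !mon2E addrAC; apply: supp3D.
    rewrite /lead -scalerBr -mulrBr; apply: supp3Z.
    apply: (supp3M (E1 := fun a b c => a = de) _ (stageWz iota k)); first exact: supp3z.
    by move=> *; lia.
  apply: supp3_sum => m /andP[km nem] nz.
  have Hde := stage_low_f nz.
  have ne : (m : 'X_{1..2}) ord_max = k -> (m : 'X_{1..2}) ord0 <> de.
    by move=> e1 e2; case/eqP: nem; apply/val_inj; rewrite /= -[LHS]mon2K e1 e2.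
  apply: (supp3M (E1 := fun a b c => a = (m : 'X_{1..2}) ord0) _ (stageW iota _)).
    exact: supp3z.
  by move=> *; lia.
have E (u v : {mpoly K[3]}) : z ^+ al.-1 * u * x ^+ j * s ^+ mu =
    z ^+ al.-1 * v * x ^+ j * s ^+ mu + (u - v) * (z ^+ al.-1 * x ^+ j * s ^+ mu) by ring.
rewrite (E _ lead).
rewrite mcoeffD addrC [X in X + _]stage_coef0 ?add0r; last first.
  apply: (supp3M H (E2 := fun a b c => a = al.-1 /\ c = mu)); first by apply: supp3m.
  by move=> *; lia.
rewrite /lead -scalerAr -!scalerAl mcoeffZ.
have -> : z ^+ al.-1 * (z ^+ de * s ^+ k) * x ^+ j * s ^+ mu = z ^+ T * x ^+ j * s ^+ (mu + k).
  have -> : T = (al.-1 + de)%N by lia.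
  by rewrite !exprD; ring.
by rewrite coef3m !eqxx andbT /= mulr_natr.
Qed.

(** T <= al leaves no room for the factor z in w - s. *)
Lemma stage_tail_al (l : nat) (e : K) (F : fps K 2) (u r : {mpoly K[3]}) :
  (z ^+ al * tail l F u (s + e *: P) * r)@_tgt = (z ^+ al * tail l F u s * r)@_tgt.
Proof.
apply: stage_coef; rewrite /eqmod -mulrBl -mulrBr -/(supp3 ND _); apply: stage_ideal.
apply: (supp3M (E1 := fun a b c => a = al) (E2 := fun a b c => 0 < a)%N).
- exact: supp3z.
- rewrite -sumrB; apply: supp3_big => m _; rewrite -scalerBr -mulrBr; apply: supp3Z.
  apply: (supp3M (E1 := fun a b c => True) _ (stageWz e _)); first by [].
  by move=> *; lia.
- by move=> *; lia.
Qed.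

Lemma stage_tail_coef (l : nat) (F : fps K 2) (j c0 : nat) (isx : bool) :
  (z ^+ al * tail l F (if isx then x else z) s * (x ^+ j * s ^+ c0))@_tgt =
  \sum_(m : 'X_{1..2 < D.+1} | (l <= (m : 'X_{1..2}) ord_max)%N)
     F m *+ [&& al + (if isx then 0 else (m : 'X_{1..2}) ord0) == T,
       j + (if isx then (m : 'X_{1..2}) ord0 else 0) == N &
       c0 + (m : 'X_{1..2}) ord_max == mu + k]%N.
Proof.
rewrite mulr_sumr mulr_suml raddf_sum /=; apply: eq_bigr => m _.
rewrite -scalerAr -scalerAl mcoeffZ -mulr_natr; congr (_ * _).
move: {m}(m : 'X_{1..2}) => m; rewrite andbA -coef3m; congr (_@__).
by case: isx; rewrite ?addn0 !exprD; ring.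
Qed.

(* n is the order of the slice phi_(al,mu)(x), and q the exponent of the
   monomial x^q w^k of f' that replaces one of its n factors x. *)
Variables (n q : nat).
Hypotheses (n_gt0 : (0 < n)%N) (q_gt0 : (0 < q)%N) (Nnq : (N + 1 = n + q)%N).
Hypothesis Hn : forall j, (j < n)%N -> phi (mon3 al j mu) = 0.
Hypothesis Hq : de = 1%N -> forall i, (i < q)%N -> f' (mon2 i k) = 0.

Lemma stage_var_x j : (n <= j)%N ->
  (z ^+ al * (x ^+ j.-1 * dY) * s ^+ mu)@_tgt = f' (mon2 q k) *+ (j == n) *+ de.
Proof.
move=> nj; rewrite stage_dYE /graph_param' -scaleNr.
have -> : forall u, z ^+ al * (x ^+ j.-1 * u) * s ^+ mu = z ^+ al * u * (x ^+ j.-1 * s ^+ mu).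
  by move=> u; ring.
rewrite stage_tail_al (stage_tail_coef k f' j.-1 mu true).
have [de0|de1] : de = 0%N \/ de = 1%N by lia.
  rewrite big1 => [|m _]; first by rewrite de0.
  by rewrite addn0 (_ : (al == T) = false) //; apply/eqP; lia.
have lt : (mdeg (mon2 q k) < D.+1)%N by rewrite mdeg2 !mon2E; lia.
rewrite (bigD1 (BMultinom lt)) /=; last by rewrite mon2E.
rewrite big1 => [|m /andP[km nem]].
  rewrite !mon2E addr0 de1 mulr1n addn0 eqxx andbT; congr (_ *+ nat_of_bool _).
  by apply/andP/eqP; [case=> /eqP ? /eqP ?|move=> ?; split; apply/eqP]; lia.
have [mq|qm] := ltnP ((m : 'X_{1..2}) ord0) q.
  have [mk|mk] := eqVneq ((m : 'X_{1..2}) ord_max) k.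
    by rewrite -[X in f' X]mon2K mk Hq // mul0rn.
  by rewrite eqn_add2l (negbTE mk) !andbF.
rewrite addn0 (_ : _ && _ = false) //; apply/negP => /and3P[_ /eqP e1 /eqP e2].
by case/eqP: nem; apply/val_inj; rewrite /= -[LHS]mon2K; congr (mon2 _ _); lia.
Qed.

Lemma stage_var_s j : (0 < mu)%N ->
  (z ^+ al * x ^+ j * (s ^+ mu.-1 * dZ))@_tgt = G *+ (j == N) *+ de.
Proof.
move=> mu_gt0; rewrite stage_dZE.
have -> : forall u v, z ^+ al * x ^+ j * (s ^+ mu.-1 * (2^-1 *: (u + v))) =
  2^-1 *: (z ^+ al * u * (x ^+ j * s ^+ mu.-1) + z ^+ al * v * (x ^+ j * s ^+ mu.-1)).
  by move=> u v; rewrite -!scalerAr; congr (_ *: _); ring.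
rewrite mcoeffZ mcoeffD /graph_param' -scaleNr.
rewrite [X in _ * (X + _)]stage_tail_al [X in _ * (_ + X)]stage_tail_al.
rewrite [X in _ * (X + _)](stage_tail_coef k.+1 g j mu.-1 false).
rewrite [X in _ * (_ + X)](stage_tail_coef k.+1 g' j mu.-1 true).
have [de0|de1] : de = 0%N \/ de = 1%N by lia.
  rewrite de0 !big1 ?addr0 ?mulr0 // => m _.
    by rewrite addn0 (_ : (al == T) = false) //; apply/eqP; lia.
  by rewrite (_ : (_ + _ == T)%N = false) //; apply/eqP; lia.
have lt : (mdeg (mon2 0 k.+1) < D.+1)%N by rewrite mdeg2 !mon2E; lia.
have pick (F : fps K 2) (isx : bool) : (forall i, F (mon2 i k.+1) = G *+ (i == 0%N)) ->
  \sum_(m : 'X_{1..2 < D.+1} | (k < (m : 'X_{1..2}) ord_max)%N)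
     F m *+ [&& al + (if isx then 0 else (m : 'X_{1..2}) ord0) == T,
       j + (if isx then (m : 'X_{1..2}) ord0 else 0) == N &
       mu.-1 + (m : 'X_{1..2}) ord_max == mu + k]%N = G *+ (j == N).
  move=> HF; rewrite (bigD1 (BMultinom lt)) /=; last by rewrite mon2E.
  rewrite big1 => [|m /andP[km nem]].
    rewrite !mon2E HF eqxx mulr1n addr0 !if_same !addn0.
    congr (_ *+ nat_of_bool _); apply/and3P/eqP => [[_ /eqP]//|->].
    by split; apply/eqP; lia.
  have [mk|mk] := eqVneq ((m : 'X_{1..2}) ord_max) k.+1; last first.
    rewrite (_ : [&& _, _ & _] = false) //; apply/negP => /and3P[_ _ /eqP e1].
    by case/eqP: mk; lia.
  rewrite -[X in F X]mon2K mk HF; case: eqP => [m0|]; last by rewrite mulr0n mul0rn.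
  by case/eqP: nem; apply/val_inj; rewrite /= -[LHS]mon2K m0 mk.
rewrite [X in _ * (X + _)](pick g false (HG de1)) [X in _ * (_ + X)](pick g' true (HG' de1)) de1.
by rewrite mulr1n; move: (G *+ _) => u; field.
Qed.

(** Comparing the two sides of the mapping equation at the target: G enters on the
    left through w^(k+1), on the right through the displacement of s. *)
Lemma stage_identity :
  (k.+1%:R * G * phi (mon3 al N mu)) *+ de =
  al%:R * f (mon2 de k) * phi (mon3 al N mu) +
  (n%:R * f' (mon2 q k) * phi (mon3 al n mu) + mu%:R * G * phi (mon3 al N mu)) *+ de.
Proof.
have E := etrans (esym stageLHS) (stage_coef (ND_deg (@Heq D))).
apply: (addrI P@_tgt); apply: (etrans E) => {E}.
rewrite ev3E trunc3E [LHS](raddf_sum (mcoeff tgt)) [X in _ = X + _](raddf_sum (mcoeff tgt)).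
have de01 : de = 0%N \/ de = 1%N by lia.
have nD : (al + n + mu <= D)%N by lia.
have ND' : (al + N + mu <= D)%N by lia.
pose A := al%:R * f (mon2 de k) + mu%:R * G *+ de.
pose B := n%:R * f' (mon2 q k) *+ de.
transitivity (\sum_(m : 'X_{1..3 < D.+1}) (phi m *: (z ^+ (m : 'X_{1..3}) i0 * x ^+ (m : 'X_{1..3}) i1 * s ^+ (m : 'X_{1..3}) i2))@_tgt + (phi (mon3 al N mu) * A + phi (mon3 al n mu) * B)); last first.
  by congr (_ + _); rewrite /A /B; case: de01 => ->; rewrite ?mulr0n ?mulr1n; ring.
rewrite -(sum_slice phi (or_introl ND')) -(sum_slice phi (or_introl nD)) -!big_split /=; apply: eq_bigr => m _.
rewrite [LHS]mcoeffZ [X in _ = X + _]mcoeffZ -!mulrDr.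
have [->|nz] := eqVneq (phi m) 0; first by rewrite !mul0r.
congr (_ * _); have [m0 m1 mc] := Hphi nz.
have /stage_coef := @stage_monomial _ ((m : 'X_{1..3}) i1) _ m0 mc.
have shift (u v t : K) : u - v = t -> u = v + t by move=> <-; rewrite addrC subrK.
rewrite mcoeffB => /shift ->; congr (_ + _).
case: (boolP (((m : 'X_{1..3}) i0 == al) && ((m : 'X_{1..3}) i2 == mu))) =>
  [/andP[/eqP e0 /eqP e2]|_]; last by rewrite mcoeff0 /= addr0.
have nm : (n <= (m : 'X_{1..3}) i1)%N.
  by rewrite leqNgt; apply: contraNN nz => /Hn e; rewrite -[X in phi X]mon3K e0 e2 e.
have cond (u v : K) r : ((0 < r)%N -> u = v) -> u *+ r = v *+ r by case: r => // r ->.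
rewrite !mcoeffD !mcoeffMn stage_var_z stage_var_x // (cond _ _ _ (@stage_var_s _)) /A /B.
by case: de01 => ->; do 2 case: eqP => [->|_]; rewrite ?mulr0n ?mulr1n ?mul0rn ?addr0 ?add0r //; ring.
Qed.

End Stage.

(** * The mapping equation at x = 0 *)

Section Pure.
Variables (K : numClosedFieldType) (iota : K).
Hypothesis iota0 : iota != 0.

Local Notation z := (zv K).
Local Notation x := (xv K).
Local Notation s := (sv K).

Variables (phi : fps K 3) (f g f' g' : fps K 2).
Hypothesis Heq : mapping_equation iota phi f g f' g'.
Hypothesis phi_x : forall m, phi m != 0 -> (0 < m i1)%N.
(* Every monomial of phi contains x^2 or x s. *)
Hypothesis phi_x1 : forall m, phi m != 0 -> ~ (m i1 = 1%N /\ m i2 = 0%N).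

Variables (i k : nat).
Hypothesis Hf'0 : f' (mon2 0 0) = 0.
Hypothesis Hf' : forall l, (l < k)%N -> f' (mon2 0 l) = 0.
Hypothesis Hg : (0 < k)%N -> forall j, g (mon2 j 0) = 0.
Hypothesis Hg' : (0 < k)%N -> forall j, g' (mon2 j 0) = 0.

Local Notation D := (i + k)%N.
Local Notation ND := (fun a b c : nat => i < a \/ 0 < b \/ k < c)%N.

Let ND_ideal : monomial_ideal (on3 (fun a b c : nat => i < a \/ 0 < b \/ k < c)%N).
Proof. by move=> m1 m2; rewrite /on3 !mnmDE; lia. Qed.

Lemma pure_param (e : K) l :
  eqmod (on3 ND) ((s + e *: fps_trunc D phi) ^+ l) (s ^+ l).
Proof.
apply: eqmodXn => //; rewrite /eqmod addrAC subrr add0r; apply: supp_inZ.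
by rewrite trunc3E; apply: supp3_sum => m _ /phi_x H; apply: supp3m; lia.
Qed.

Lemma pure_param_supp (e : K) l :
  supp3 (fun a b c => ND a b c \/ l <= c)%N ((s + e *: fps_trunc D phi) ^+ l).
Proof.
rewrite -[X in supp3 _ X](subrK (s ^+ l)); apply: supp3D.
  by apply: (supp3W (@pure_param e l)) => *; lia.
by apply: supp3s; lia.
Qed.

Lemma pure_coef (e : K) (F : fps K 2) (isx : bool) :
  (ev2 F D (if isx then x else z) (s + e *: fps_trunc D phi))@_(mon3 i 0 k) =
  if isx then F (mon2 0 k) *+ (i == 0%N) else F (mon2 i k).
Proof.
have H : eqmod (on3 ND) (ev2 F D (if isx then x else z) (s + e *: fps_trunc D phi))
    (ev2 F D (if isx then x else z) s).
  rewrite !ev2E; apply: eqmod_sum => m _; apply: eqmodZ; apply: eqmodM => //.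
    exact: eqmod_refl.
  exact: pure_param.
rewrite (eqmod_coef H); last by rewrite /on3 !mon3E; lia.
have coefE (m : 'X_{1..2}) : ((if isx then x else z) ^+ m ord0 * s ^+ m ord_max)@_(mon3 i 0 k) =
    ((if isx then 0 else m ord0) == i)%:R * ((if isx then m ord0 else 0) == 0)%:R *
    (m ord_max == k)%:R.
  rewrite -!natrM !mulnb -coef3m; congr (_@__).
  by case: (isx); rewrite expr0 ?mul1r ?mulr1.
rewrite ev2E raddf_sum /=.
pose i' := if isx then 0%N else i.
have lt : (mdeg (mon2 i' k) < D.+1)%N by rewrite mdeg2 !mon2E /i'; case: (isx); lia.
rewrite (bigD1 (BMultinom lt)) //= mcoeffZ coefE !mon2E big1 ?addr0 => [|m nem].
  rewrite eqxx mulr1 /i'; case: (isx); rewrite ?eqxx !mulr1 //.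
  by rewrite eq_sym mulr_natr.
rewrite mcoeffZ coefE; have [mk|_] := eqVneq ((m : 'X_{1..2}) ord_max) k; last by rewrite !mulr0.
have {}nem : (m : 'X_{1..2}) ord0 != i'.
  apply: contra_neq nem => e0; apply/val_inj; by rewrite /= -[LHS]mon2K e0 mk.
by move: nem; rewrite /i'; case: (isx) => /negbTE ->; rewrite !(mulr0, mul0r).
Qed.

(** At x = 0 one has w = w' = s, and the equation reads
    g(z, s) - g'(0, s) = 2 iota phi(f(z, s), f'(0, s), ...).  As f'(0, s) is
    divisible by s and by s^k, and each monomial of phi contains x^2 or x s, the
    right-hand side has order larger than k in s. *)
Lemma pure_identity : g (mon2 i k) = g' (mon2 0 k) *+ (i == 0%N).
Proof.
have E := @Heq D; set G := ev2 g _ _ _ in E; set G' := ev2 g' _ _ _ in E.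
have nND : ~ on3 ND (mon3 i 0 k) by rewrite /on3 !mon3E; lia.
have {}E : ((2 * iota)^-1 *: (G - G'))@_(mon3 i 0 k) = 0.
  rewrite (eqmod_degE E); last by rewrite mdeg3 !mon3E; lia.
  have EQ : graph_param' iota phi D = s + (- iota) *: fps_trunc D phi by rewrite scaleNr.
  have GE (F : fps K 2) (u : {mpoly K[3]}) e : (forall j, (0 < k)%N -> F (mon2 j 0) = 0) ->
      supp3 (fun a b c => ND a b c \/ k = 0%N \/ 1 <= c)%N (ev2 F D u (s + e *: fps_trunc D phi)).
    move=> HF; rewrite ev2E; apply: supp3_sum => m _ nz.
    apply: (supp3M (E1 := fun _ _ _ => True) _ (@pure_param_supp e _)) => //.
    have m0 : (m : 'X_{1..2}) ord_max = 0%N -> k = 0%N.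
      by move=> e0; case: (posnP k) => // k0; move: nz; rewrite -[X in F X]mon2K e0 HF ?eqxx.
    by move=> *; lia.
  have Zs : supp3 (fun a b c => ND a b c \/ k = 0%N \/ 1 <= c)%N (2^-1 *: (G + G')).
    apply: supp3Z; apply: supp3D; first by apply: GE => j k0; apply: Hg.
    by rewrite /G' EQ; apply: GE => j k0; apply: Hg'.
  have Ys : supp3 (fun a b c => ND a b c \/ (1 <= c /\ k <= c))%N (ev2 f' D x (graph_param' iota phi D)).
    rewrite EQ ev2E; apply: supp3_sum => m _ nz.
    apply: (supp3M (E1 := fun a b c => b = (m : 'X_{1..2}) ord0) _ (@pure_param_supp _ _)).
      exact: supp3x.
    have m0 : (m : 'X_{1..2}) ord0 = 0%N -> (0 < (m : 'X_{1..2}) ord_max)%N /\ (k <= (m : 'X_{1..2}) ord_max)%N.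
      move=> e0; split.
        rewrite lt0n; apply: contra_neq nz => e1; by rewrite -[X in f' X]mon2K e0 e1.
      by rewrite leqNgt; apply: contraNN nz => /Hf' e1; rewrite -[X in f' X == _]mon2K e0 e1.
    by move=> *; lia.
  apply: (@coef3_supp _ ND); last by lia.
  rewrite ev3E; apply: supp3_sum => m _ nz.
  have m1 := phi_x nz; have m2 := phi_x1 nz.
  rewrite -mulrA; apply: (supp3M (E1 := fun _ _ _ => True) (E2 := ND)) => //; last by move=> *; lia.
  have YYs : supp3 (fun a b c => ND a b c \/ ((m : 'X_{1..3}) i1 <= c /\ (m : 'X_{1..3}) i1 * k <= c))%N
     (ev2 f' D x (graph_param' iota phi D) ^+ (m : 'X_{1..3}) i1).
    apply: (supp3Xn (E := fun e a b c => ND a b c \/ (e <= c /\ e * k <= c))%N) => [|//|]; first by lia.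
      by apply: (supp3W Ys) => *; lia.
    by move=> *; nia.
  have ZZs : supp3 (fun a b c => ND a b c \/ k = 0%N \/ (m : 'X_{1..3}) i2 <= c)%N
     ((2^-1 *: (G + G')) ^+ (m : 'X_{1..3}) i2).
    by apply: (supp3Xn (E := fun e a b c => ND a b c \/ k = 0%N \/ e <= c)%N) => [|//|*]; lia.
  apply: (supp3M YYs ZZs) => a b c a' b' c'.
  have : ((m : 'X_{1..3}) i1 = 1%N /\ (0 < (m : 'X_{1..3}) i2)%N) \/ (2 <= (m : 'X_{1..3}) i1)%N by lia.
  by nia.
move: E; rewrite mcoeffZ mcoeffB => /eqP; rewrite mulf_eq0 invr_eq0 mulf_eq0 pnatr_eq0 (negbTE iota0) /=.
rewrite subr_eq0 => /eqP; rewrite /G (pure_coef iota g false) => ->.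
by rewrite /G' /graph_param' -scaleNr (pure_coef (- iota) g' true).
Qed.

End Pure.

(** * The mapping equation at order zero *)

Section ZeroStage.
Variables (K : numClosedFieldType) (iota : K).
Hypothesis iota0 : iota != 0.

Local Notation z := (zv K).
Local Notation x := (xv K).
Local Notation s := (sv K).

Variables (phi : fps K 3) (f g f' g' : fps K 2).
Hypothesis Heq : mapping_equation iota phi f g f' g'.
Variables (al mu N : nat).
Hypotheses (al_gt0 : (0 < al)%N) (almu : (1 < al + mu)%N) (N_gt0 : (0 < N)%N).
Hypothesis Hphi : forall m, phi m != 0 ->
  [/\ (0 < m i0)%N, (0 < m i1)%N &
      [\/ m i0 = al /\ m i2 = mu, (mu < m i2)%N | (al + mu < m i0 + m i2)%N]].
Hypothesis Hf00 : f (mon2 0 0) = 0.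
Hypothesis Hf'00 : f' (mon2 0 0) = 0.
Variable r : K.
Hypotheses (Hg0 : forall i, g (mon2 i 0) = 0) (Hg'0 : forall i, g' (mon2 i 0) = 0).
Hypotheses (Hg1 : forall i, g (mon2 i 1) = r *+ (i == 0%N))
  (Hg'1 : forall i, g' (mon2 i 1) = r *+ (i == 0%N)).

(* The target z^al x^N s^mu of the previous comparison, with k = 0 and de = 1;
   the sums are kept unreduced to match it. *)
Local Notation D := (al + N + mu + 0)%N.
Local Notation ND := (fun a b c : nat => al < a \/ N < b \/ mu + 0 < c)%N.
Local Notation P := (fps_trunc D phi).
Local Notation w := (graph_param iota phi D).
Local Notation w' := (graph_param' iota phi D).
Local Notation tgt := (mon3 al N (mu + 0)).
Local Notation lam := (f (mon2 1 0)).
Local Notation lam' := (f' (mon2 1 0)).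
Local Notation tail l F u v := (\sum_(m : 'X_{1..2 < D.+1} | (l <= (m : 'X_{1..2}) ord_max)%N)
     F m *: (u ^+ (m : 'X_{1..2}) ord0 * v ^+ (m : 'X_{1..2}) ord_max)).

Lemma zeroW e l :
  supp3 (fun a b c => ND a b c \/ l <= c \/ (al <= a /\ l + mu <= c + 1))%N ((s + e *: P) ^+ l).
Proof. exact: (stageW iota0 al_gt0 almu al_gt0 (erefl (al + 1)%N) (leqnn 1) N_gt0 Hphi). Qed.

Lemma zero_ideal (p q : {mpoly K[3]}) : supp3 ND p -> supp3 ND (p * q).
Proof. by apply: supp_ideal => m1 m2; rewrite /on3 !mnmDE; lia. Qed.

Lemma zero_g (F : fps K 2) (u v : {mpoly K[3]}) : (forall i, F (mon2 i 0) = 0) ->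
  ev2 F D u v = tail 1 F u v.
Proof.
move=> HF; rewrite ev2E (bigID (fun m : 'X_{1..2 < D.+1} => 0 < (m : 'X_{1..2}) ord_max)%N) /=.
rewrite [X in _ + X]big1 ?addr0 // => m; rewrite -eqn0Ngt => /eqP m0.
by rewrite -[X in F X]mon2K m0 HF scale0r.
Qed.

Lemma zeroLHS : ((2 * iota)^-1 *: (ev2 g D z w - ev2 g' D x w'))@_tgt = r * phi (mon3 al N mu).
Proof.
rewrite (zero_g _ _ Hg0) (zero_g _ _ Hg'0) mcoeffZ mcoeffB.
rewrite [X in _ * (X - _)](stage_tail iota0 al_gt0 almu al_gt0 (erefl (al + 1)%N) (leqnn 1) N_gt0 Hphi iota (or_introl erefl) (fun=> Hg1)).
rewrite /graph_param' -scaleNr.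
rewrite [X in _ * (_ - X)](stage_tail iota0 al_gt0 almu al_gt0 (erefl (al + 1)%N) (leqnn 1) N_gt0 Hphi (- iota) (or_intror erefl) (fun=> Hg'1)).
by rewrite !mulr1n; field; rewrite iota0.
Qed.

Local Notation X := (ev2 f D z w).
Local Notation Y := (ev2 f' D x w').
Local Notation Z := (2^-1 *: (ev2 g D z w + ev2 g' D x w')).

Lemma zeroX e : supp3 (fun a b c => ND a b c \/ e <= a + c)%N (X ^+ e).
Proof.
apply: (supp3Xn (E := fun e a b c => ND a b c \/ e <= a + c)%N) => [||*]; [by lia| |by lia].
rewrite ev2E; apply: supp3_sum => m _ nz.
have m0 : (0 < (m : 'X_{1..2}) ord0)%N \/ (0 < (m : 'X_{1..2}) ord_max)%N.
  case: (posnP ((m : 'X_{1..2}) ord0)) => [e0|]; last by left.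
  case: (posnP ((m : 'X_{1..2}) ord_max)) => [e1|]; last by right.
  by move: nz; rewrite -[X in f X]mon2K e0 e1 Hf00 eqxx.
apply: (supp3M (E1 := fun a b c => a = (m : 'X_{1..2}) ord0) _ (@zeroW iota _)).
  exact: supp3z.
by move=> *; lia.
Qed.

Lemma zeroXD : supp3 (fun a b c => ND a b c \/ 2 <= a \/ 1 <= c)%N (X - lam *: z).
Proof.
have lt : (mdeg (mon2 1 0) < D.+1)%N by rewrite mdeg2 !mon2E; lia.
rewrite ev2E (bigD1 (BMultinom lt)) //= !mon2E expr0 mulr1 expr1 addrAC subrr add0r.
apply: supp3_sum => m nem nz.
have m0 : (1 < (m : 'X_{1..2}) ord0)%N \/ (0 < (m : 'X_{1..2}) ord_max)%N.
  case: (posnP ((m : 'X_{1..2}) ord_max)) => [e1|]; last by right.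
  left; rewrite ltn_neqAle eq_sym lt0n; apply/andP; split.
    by apply: contra_neq nem => e0; apply/val_inj; rewrite /= -[LHS]mon2K e0 e1.
  by apply: contra_neq nz => e0; rewrite -[X in f X]mon2K e0 e1.
apply: (supp3M (E1 := fun a b c => a = (m : 'X_{1..2}) ord0) _ (@zeroW iota _)).
  exact: supp3z.
by move=> *; lia.
Qed.

Lemma zeroZD : supp3 (fun a b c => ND a b c \/ 2 <= c \/ (al <= a /\ mu + 1 <= c))%N (Z - r *: s).
Proof.
have lt : (mdeg (mon2 0 1) < D.+1)%N by rewrite mdeg2 !mon2E; lia.
have H (F : fps K 2) u e : (forall i, F (mon2 i 0) = 0) ->
    (forall i, F (mon2 i 1) = r *+ (i == 0%N)) ->
    supp3 (fun a b c => ND a b c \/ 2 <= c \/ (al <= a /\ mu + 1 <= c))%N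
     (ev2 F D u (s + e *: P) - r *: (s + e *: P)).
  move=> HF0 HF1; rewrite ev2E (bigD1 (BMultinom lt)) //= !mon2E HF1 /= mulr1n expr0 mul1r expr1.
  rewrite addrAC subrr add0r; apply: supp3_sum => m nem nz.
  apply: (supp3M (E1 := fun _ _ _ => True) _ (@zeroW e _)) => //.
  have m0 : (1 < (m : 'X_{1..2}) ord_max)%N.
    rewrite ltn_neqAle eq_sym lt0n; apply/andP; split.
      move: nz; apply: contraNneq => e1; rewrite -[X in F X]mon2K e1 HF1.
      case: ((m : 'X_{1..2}) ord0 =P 0%N) => [e0|_]; last by rewrite mulr0n.
      by case/eqP: nem; apply/val_inj; rewrite /= -[LHS]mon2K e0 e1.
    by apply: contra_neq nz => e0; rewrite -[X in F X]mon2K e0 HF0.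
  by move=> *; lia.
have -> : Z - r *: s = 2^-1 *: ((ev2 g D z w - r *: w) + (ev2 g' D x w' - r *: w')).
  have wE : s = 2^-1 *: (w + w').
    rewrite /graph_param /graph_param' addrACA subrr addr0 -mulr2n -scaler_nat scalerA.
    by rewrite mulVf ?pnatr_eq0 // scale1r.
  rewrite [X in _ - _ *: X]wE scalerA [r * _]mulrC -scalerA -scalerBr; congr (_ *: _).
  by rewrite scalerDr opprD addrACA.
apply: supp3Z; apply: supp3D; first exact: H.
by rewrite /graph_param' -scaleNr; apply: H.
Qed.

Lemma zeroZ e : supp3 (fun a b c => ND a b c \/ e <= c)%N (Z ^+ e).
Proof.
apply: (supp3Xn (E := fun e a b c => ND a b c \/ e <= c)%N) => [||*]; [by lia| |by lia].
rewrite -[Z](subrK (r *: s)); apply: supp3D; first by apply: (supp3W zeroZD) => *; lia.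
by apply: supp3Z; rewrite -[s]expr1; apply: supp3s; lia.
Qed.

(** f'(x, 0): modulo z^al and s, the argument w' of f' can be replaced by 0. *)
Definition fiber : {mpoly K[3]} :=
  \sum_(m : 'X_{1..2 < D.+1}) f' m *: (x ^+ (m : 'X_{1..2}) ord0 * ((m : 'X_{1..2}) ord_max == 0%N)%:R).

Lemma zeroYD : supp3 (fun a b c => ND a b c \/ 1 <= c \/ al <= a)%N (Y - fiber).
Proof.
rewrite ev2E -sumrB; apply: supp3_big => m _; rewrite -scalerBr -mulrBr; apply: supp3Z.
apply: (supp3M (E1 := fun _ _ _ => True) (E2 := (fun a b c => ND a b c \/ 1 <= c \/ al <= a)%N)) => //.
  case: eqP => [->|/eqP ml]; first by rewrite expr0 subrr; apply: supp_in0.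
  by rewrite subr0 /graph_param' -scaleNr; apply: (supp3W (@zeroW (- iota) _)) => *; lia.
by move=> *; lia.
Qed.

(** The map is not close to the identity here; but each argument has the order of
    the variable it replaces, so the monomials outside the slice (al, mu) still miss the
    target and the slice only sees lam z, f'(x, 0) and r s. *)
Lemma zero_monomial be j nu : (0 < be)%N ->
  [\/ be = al /\ nu = mu, (mu < nu)%N | (al + mu < be + nu)%N] ->
  eqmod (on3 ND) (X ^+ be * Y ^+ j * Z ^+ nu)
   (if (be == al) && (nu == mu) then (lam ^+ al * r ^+ mu) *: (z ^+ al * fiber ^+ j * s ^+ mu) else 0).
Proof.
move=> be_gt0 H.
case: ifP => [/andP[/eqP -> /eqP ->]|main]; last first.
  rewrite /eqmod subr0 mulrAC -/(supp3 ND _); apply: zero_ideal.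
  apply: (supp3M (@zeroX be) (@zeroZ nu)) => a b c a' b' c' H1 H2.
  by case: H => [[e1 e2]|lt|lt]; [rewrite e1 e2 !eqxx in main | lia | lia].
rewrite /eqmod -/(supp3 ND _).
have -> : (lam ^+ al * r ^+ mu) *: (z ^+ al * fiber ^+ j * s ^+ mu) =
    (lam *: z) ^+ al * fiber ^+ j * (r *: s) ^+ mu.
  by rewrite !exprZn -!scalerAl -scalerAr scalerA.
have E (X1 X2 Y1 Y2 Z1 Z2 : {mpoly K[3]}) : X1 * Y1 * Z1 - X2 * Y2 * Z2 =
  (X1 - X2) * Z1 * Y1 + X2 * (Z1 - Z2) * Y1 + X2 * (Y1 - Y2) * Z2 by ring.
rewrite E {E}; apply: supp3D; first apply: supp3D.
- apply: zero_ideal; rewrite subrXX.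
  apply: (supp3M (E1 := (fun a b c => ND a b c \/ 1 <= c)%N) _ (@zeroZ mu)); last by move=> *; lia.
  apply: (supp3M zeroXD (E2 := (fun a b c => ND a b c \/ al <= a + c + 1)%N)); last by move=> *; lia.
  apply: supp3_big => i _; have il := ltn_ord i.
  apply: (supp3M (@zeroX _) (E2 := fun a b c => a = i)).
    by rewrite exprZn; apply: supp3Z; apply: supp3z.
  by move=> *; lia.
- apply: zero_ideal; rewrite exprZn -scalerAl; apply: supp3Z.
  apply: (supp3M (E1 := fun a b c => a = al) (E2 := (fun a b c => ND a b c \/ mu < c \/ al <= a)%N)).
  + exact: supp3z.
  + rewrite subrXX; apply: (supp3M zeroZD (E2 := (fun a b c => ND a b c \/ mu <= c + 1)%N)); last by move=> *; lia.
    apply: supp3_big => i _; have il := ltn_ord i.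
    apply: (supp3M (@zeroZ _) (E2 := fun a b c => c = i)).
      by rewrite exprZn; apply: supp3Z; apply: supp3s.
    by move=> *; lia.
  + by move=> *; lia.
- rewrite -mulrA !exprZn -scalerAl -!scalerAr; do 2 apply: supp3Z.
  apply: (supp3M (E1 := fun a b c => a = al) (E2 := (fun a b c => ND a b c \/ mu < c \/ al <= a)%N)).
  + exact: supp3z.
  + apply: (supp3M (E1 := (fun a b c => ND a b c \/ 1 <= c \/ al <= a)%N) (E2 := fun a b c => c = mu)).
    * rewrite subrXX; apply: (supp3M zeroYD (E2 := fun _ _ _ => True)) => //.
      by move=> *; lia.
    * exact: supp3s.
    * by move=> *; lia.
  + by move=> *; lia.
Qed.

Variables (n q : nat).
Hypotheses (n_gt0 : (0 < n)%N) (q_gt1 : (1 < q)%N) (Nnq : (N < n + q)%N).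
Hypothesis Hn : forall j, (j < n)%N -> phi (mon3 al j mu) = 0.
Hypothesis Hq : forall i, (1 < i)%N -> (i < q)%N -> f' (mon2 i 0) = 0.

(** f'(x, 0) = lam' x + c x^q + ..., expanded to first order in c; with N < n + q
    no other monomial of f' can intervene. *)
Lemma zero_fiber j : (n <= j)%N ->
  (z ^+ al * fiber ^+ j * s ^+ mu)@_tgt =
  lam' ^+ j *+ (j == N) + lam' ^+ j.-1 * f' (mon2 q 0) *+ (j.-1 + q == N)%N *+ j.
Proof.
move=> nj.
have mE (m : 'X_{1..2}) : f' m != 0 -> m ord_max = 0%N -> m ord0 = 1%N \/ (q <= m ord0)%N.
  move=> nz e1; case: (posnP (m ord0)) => [e0|m0].
    by move: nz; rewrite -[X in f' X]mon2K e0 e1 Hf'00 eqxx.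
  case: (ltnP (m ord0) q) => [lt|]; last by right.
  left; apply/eqP; rewrite eqn_leq m0 andbT leqNgt; apply: contraNN nz => gt1.
  by rewrite -[X in f' X]mon2K e1 Hq.
have lin : supp3 (fun a b c => b = 1)%N (lam' *: x).
  by apply: supp3Z; rewrite -[x]expr1; apply: supp3x.
have D1 : supp3 (fun a b c => q <= b)%N (fiber - lam' *: x).
  have lt : (mdeg (mon2 1 0) < D.+1)%N by rewrite mdeg2 !mon2E; lia.
  rewrite /fiber (bigD1 (BMultinom lt)) //= !mon2E mulr1 expr1 addrAC subrr add0r.
  apply: supp3_sum => m nem nz; case: eqP => [e1|_]; last by rewrite mulr0; apply: supp_in0.
  rewrite mulr1; apply: supp3x; case: (mE _ nz e1) => // e0.
  by case/eqP: nem; apply/val_inj; rewrite /= -[LHS]mon2K e0 e1.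
have F1 e : supp3 (fun a b c => e <= b)%N (fiber ^+ e).
  apply: (supp3Xn (E := fun e a b c => e <= b)%N) => [//||*]; last by lia.
  rewrite -[fiber](subrK (lam' *: x)); apply: supp3D; first by apply: (supp3W D1) => *; lia.
  by apply: (supp3W lin) => *; lia.
have L e : supp3 (fun a b c => b = e)%N ((lam' *: x) ^+ e).
  by rewrite exprZn; apply: supp3Z; apply: supp3x.
have D2 e : supp3 (fun a b c => e + q <= b + 1)%N (fiber ^+ e - (lam' *: x) ^+ e).
  rewrite subrXX; apply: (supp3M D1 (E2 := (fun a b c => e <= b + 1)%N)); last by move=> *; lia.
  apply: supp3_big => i _; have il := ltn_ord i.
  by apply: (supp3M (F1 _) (L _)) => *; lia.
have D3 : supp3 (fun a b c => j + q <= b)%N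
    (fiber ^+ j - (lam' *: x) ^+ j - ((lam' *: x) ^+ j.-1 *+ j) * (fiber - lam' *: x)).
  rewrite subrX_linear; apply: (supp3M D1 (E2 := (fun a b c => j <= b)%N)); last by move=> *; lia.
  apply: supp3_big => i _; have il := ltn_ord i.
  by apply: (supp3M (D2 _) (L _)) => *; lia.
pose c' := f' (mon2 q 0).
have D4 : supp3 (fun a b c => (q < b \/ N < b)%N) (fiber - lam' *: x - c' *: x ^+ q).
  case: (leqP q D) => qD; last first.
    apply: supp3D; first by apply: (supp3W D1) => *; lia.
    by rewrite -scaleNr; apply: supp3Z; apply: supp3x; lia.
  have lt : (mdeg (mon2 1 0) < D.+1)%N by rewrite mdeg2 !mon2E; lia.
  have ltq : (mdeg (mon2 q 0) < D.+1)%N by rewrite mdeg2 !mon2E; lia.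
  have cancel_l (u v : {mpoly K[3]}) : u + v - u = v by rewrite addrC addKr.
  rewrite /fiber (bigD1 (BMultinom lt)) //= !mon2E mulr1 expr1 cancel_l.
  rewrite (bigD1 (BMultinom ltq)) /=; last first.
    apply/eqP => /(congr1 val) /= /(congr1 (fun m : 'X_{1..2} => m ord0)).
    by rewrite !mon2E; lia.
  rewrite !mon2E mulr1 cancel_l.
  apply: supp3_sum => m /andP[nem nem'] nz; case: eqP => [e1|_]; last by rewrite mulr0; apply: supp_in0.
  rewrite mulr1; apply: supp3x; left; case: (mE _ nz e1) => [e0|].
    by case/eqP: nem; apply/val_inj; rewrite /= -[LHS]mon2K e0 e1.
  rewrite leq_eqVlt => /predU1P[e0|//].
  by case/eqP: nem'; apply/val_inj; rewrite /= -[LHS]mon2K -e0 e1.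
have -> : fiber ^+ j = (fiber ^+ j - (lam' *: x) ^+ j - ((lam' *: x) ^+ j.-1 *+ j) * (fiber - lam' *: x))
   + ((lam' *: x) ^+ j.-1 *+ j) * (fiber - lam' *: x - c' *: x ^+ q)
   + ((lam' *: x) ^+ j + ((lam' *: x) ^+ j.-1 *+ j) * (c' *: x ^+ q)) by ring.
rewrite mulrDr mulrDl mcoeffD [X in X + _](_ : _ = 0) ?add0r; last first.
  apply: stage_coef0.
  apply: (supp3M (E1 := (fun _ b _ => N < b)%N) _ (E2 := fun _ _ _ => True)); [|by []|by move=> *; lia].
  apply: (supp3M (E1 := fun _ _ _ => True) (E2 := (fun _ b _ => N < b)%N)); [by []| |by move=> *; lia].
  apply: supp3D; first by apply: (supp3W D3) => *; lia.
  apply: (supp3M (E1 := fun _ b _ => b = j.-1) _ D4); last by move=> *; lia.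
  by apply: supp_inMn; apply: L.
rewrite mulrDr mulrDl mcoeffD; congr (_ + _).
  by rewrite exprZn -scalerAr -scalerAl mcoeffZ coef3m addn0 !eqxx andbT /= mulr_natr.
have -> : z ^+ al * ((lam' *: x) ^+ j.-1 *+ j * (c' *: x ^+ q)) * s ^+ mu =
   (lam' ^+ j.-1 * c') *: (z ^+ al * x ^+ (j.-1 + q) * s ^+ mu) *+ j.
  rewrite exprZn mulrnAl mulrnAr mulrnAl -scalerAl -scalerAr -!scalerAr -!scalerAl scalerA exprD.
  by congr (_ *: _ *+ _); ring.
by rewrite mcoeffMn mcoeffZ coef3m addn0 !eqxx andbT /= mulr_natr.
Qed.

(** For N = n and q = 2 the last term is absent, and this is the multiplicative
    balance equation; N = n + q - 1 isolates the coefficient of x^q in f'. *)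
Lemma zero_identity :
  r * phi (mon3 al N mu) = lam ^+ al * r ^+ mu * (lam' ^+ N * phi (mon3 al N mu) +
     n%:R * lam' ^+ n.-1 * f' (mon2 q 0) * phi (mon3 al n mu) *+ (N.+1 == n + q)%N).
Proof.
have nND : ~ on3 ND tgt by rewrite /on3 !mon3E; lia.
have E := etrans (esym zeroLHS) (eqmod_degE (@Heq D) (_ : (mdeg tgt <= D)%N)).
rewrite E; last by rewrite mdeg3 !mon3E; lia.
rewrite {E} ev3E [LHS](raddf_sum (mcoeff tgt)).
pose A := lam ^+ al * r ^+ mu * lam' ^+ N.
pose B := lam ^+ al * r ^+ mu * (n%:R * lam' ^+ n.-1 * f' (mon2 q 0)) *+ (N.+1 == n + q)%N.
transitivity (phi (mon3 al N mu) * A + phi (mon3 al n mu) * B); last first.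
  by rewrite /A /B -mulr_natr -[X in _ * (_ + X)]mulr_natr; ring.
rewrite -(@sum_slice _ phi D al mu N A); last by left; lia.
rewrite -(@sum_slice _ phi D al mu n B); last first.
  by rewrite /B; case: eqP => [e|_]; [left; lia | right; rewrite mulr0n].
rewrite -!big_split /=; apply: eq_bigr => m _.
rewrite [LHS]mcoeffZ -!mulrDr.
have [->|nz] := eqVneq (phi m) 0; first by rewrite !mul0r.
congr (_ * _); have [m0 m1 mc] := Hphi nz.
rewrite (eqmod_coef (@zero_monomial _ ((m : 'X_{1..3}) i1) _ m0 mc) nND).
case: (boolP (((m : 'X_{1..3}) i0 == al) && ((m : 'X_{1..3}) i2 == mu))) =>
  [/andP[/eqP e0 /eqP e2]|_]; last by rewrite mcoeff0 /= addr0.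
have nm : (n <= (m : 'X_{1..3}) i1)%N.
  by rewrite leqNgt; apply: contraNN nz => /Hn e; rewrite -[X in phi X]mon3K e0 e2 e.
rewrite mcoeffZ zero_fiber //=; move: ((m : 'X_{1..3}) i1) nm => j nj.
rewrite /A /B mulrDr -mulrnAr; congr (_ + _).
  by case: eqP => [->|_]; rewrite ?mulr1n ?mulr0n ?mulr0.
have [->|nej] := eqVneq j n; last first.
  have jn : (n < j)%N by rewrite ltn_neqAle eq_sym nej nj.
  have -> : (j.-1 + q == N)%N = false by apply/eqP; lia.
  by rewrite /= !mulr0n mulr0 mul0rn mulr0.
have -> : (n.-1 + q == N)%N = (N.+1 == n + q)%N by apply/eqP/eqP; lia.
by case: eqP => _; rewrite /= ?mulr1n ?mulr0n ?mulr0 ?mul0rn ?mulr0 // -mulr_natl; ring.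
Qed.

End ZeroStage.

(** * The balance equations *)

Section Arithmetic.
Variable L : nat * nat * nat -> Prop.
Variables (a n m : nat).
Hypotheses (L_anm : L (a, n, m)) (n_neq_a : n <> a).
Hypothesis L_slope :
    (exists a' n' m', [/\ L (a', n', m'), (a', n', m') <> (a, n, m)
                        & (a + n = a' + n')%N])
    \/
    ~ (exists k : nat, (0 < k)%N /\
         forall a' n' m', L (a', n', m') -> (a', n', m') <> (a, n, m) ->
           slope (a, n, m) (a', n', m') = k%:R).
Hypothesis L_gt0 : forall a' n' m', L (a', n', m') -> (0 < a')%N /\ (0 < n')%N.
Hypothesis L_anti : forall a' n' m', L (a', n', m') -> (a', n', m') <> (a, n, m) -> m' <> m.

Lemma slopeE k a' n' m' : (a' + n' <> a + n)%N ->
  ((a' + n') * k + (a + n) * m' = (a + n) * k + (a' + n') * m)%N ->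
  slope (a, n, m) (a', n', m') = k%:R.
Proof.
move=> ne e; rewrite /slope.
have nz : (a' + n')%:R - (a + n)%:R != 0 :> rat by rewrite subr_eq0 eqr_nat; apply/eqP.
apply: (mulIf nz); rewrite divfK //.
rewrite mulrBr -!natrM; apply/eqP; rewrite subr_eq addrAC eq_sym subr_eq -!natrD eqr_nat.
by apply/eqP; lia.
Qed.

(** With the denominators cleared, the equation says that the slope is [k].  If the
    denominator is zero it says m' = m, which is impossible in an antichain; this
    is how the alternative a + n = a' + n' is used. *)
Lemma no_common_slope k : (0 < k)%N ->
  (forall a' n' m', L (a', n', m') -> (a', n', m') <> (a, n, m) ->
    (a' + n') * k + (a + n) * m' = (a + n) * k + (a' + n') * m)%N -> False.
Proof.
move=> k0 H; case: L_slope => [[a' [n' [m' [La ne e]]]]|[]].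
  have := H _ _ _ La ne; have := L_anti La ne; have [a0 _] := L_gt0 L_anm.
  by rewrite -e; move=> mm /addnI /eqP; rewrite eqn_pmul2l ?addn_gt0 ?a0 // => /eqP.
exists k; split=> // a' n' m' La ne; apply: slopeE; last exact: H.
move=> e; have := H _ _ _ La ne; have := L_anti La ne; have [a0 _] := L_gt0 L_anm.
by rewrite e; move=> mm /addnI /eqP; rewrite eqn_pmul2l ?addn_gt0 ?a0 // => /eqP.
Qed.

Lemma no_common_slope_witness k : (0 < k)%N ->
  exists a' n' m', [/\ L (a', n', m'), (a', n', m') <> (a, n, m) &
    ((a' + n') * k + (a + n) * m' <> (a + n) * k + (a' + n') * m)%N].
Proof.
move=> k0; have [//|nex] := boolp.EM (exists a' n' m', [/\ L (a', n', m'), (a', n', m') <> (a, n, m) &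
    ((a' + n') * k + (a + n) * m' <> (a + n) * k + (a' + n') * m)%N]).
exfalso; apply: (no_common_slope k0) => a' n' m' La ne.
by apply/eqP/negPn/negP => /eqP ne'; apply: nex; exists a', n', m'.
Qed.

Variable K : numClosedFieldType.

(** Subtracting the equation at (a, n, m) from its conjugate gives
    (a - n) (c - conj(c)) = 0, so c is real; then (a' + n') c = (k - m') G for all
    elements of [L], and by the hypothesis on slopes one of these equations is
    independent of the one at (a, n, m). *)
Lemma balance_linear k (c G : K) : (0 < k)%N -> G^* = G ->
  (forall a' n' m', L (a', n', m') ->
     k%:R * G = a'%:R * c + n'%:R * c^* + m'%:R * G) -> c = 0 /\ G = 0.
Proof.
move=> k0 Gr H.
have cr : c^* = c.
  have := H _ _ _ L_anm => E; have := congr1 Num.conj E.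
  rewrite !rmorphD !rmorphM /= !conjC_nat Gr conjCK {1}E => /addIr E'.
  have /eqP : (a%:R - n%:R) * (c - c^*) = 0.
    have -> : (a%:R - n%:R) * (c - c^*) = a%:R * c + n%:R * c^* - (a%:R * c^* + n%:R * c) by ring.
    by rewrite E' subrr.
  rewrite mulf_eq0 !subr_eq0 eqr_nat => /orP[/eqP e|/eqP //].
  by case: n_neq_a.
have {}H a' n' m' : L (a', n', m') -> (a' + n')%:R * c = (k%:R - m'%:R) * G.
  by move=> /H; rewrite cr => E; rewrite mulrBl E natrD; ring.
have [a' [n' [m' [La' ne e]]]] := no_common_slope_witness k0.
have E1 := H _ _ _ L_anm; have E2 := H _ _ _ La'.
have G0 : G = 0.
  apply/eqP/negPn/negP => Gn0.
  have : (a' + n')%:R * (a + n)%:R * c = (a + n)%:R * (a' + n')%:R * c by rewrite [X in X * c]mulrC.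
  rewrite -!mulrA E1 E2 !mulrA => /(mulIf Gn0); rewrite !mulrBr -!natrM => /eqP.
  by rewrite subr_eq addrAC eq_sym subr_eq -!natrD eqr_nat => /eqP; lia.
split=> //; move: E1; rewrite G0 mulr0 => /eqP; rewrite mulf_eq0 pnatr_eq0 => /orP[|/eqP //].
by have [a0 _] := L_gt0 L_anm; rewrite addn_eq0 eqn0Ngt a0.
Qed.

Hypothesis Hgcd : gcd_parity_condition L.

(** [u] is a root of unity since a <> n, and its order divides all n' - a'. *)
Lemma order_trivial (u : K) : u != 0 ->
  (forall a' n' m', L (a', n', m') -> u ^+ a' = u ^+ n') -> u = 1.
Proof.
move=> u0 H.
have [d prim_d] : exists d, d.-primitive_root u.
  have ex j l : (j < l)%N -> u ^+ j = u ^+ l -> exists d, d.-primitive_root u.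
    move=> lt e; have [|//|d prim_d _] := @prim_order_exists _ (l - j) u; first by rewrite subn_gt0.
      have := congr1 (fun v => v / u ^+ j) e; rewrite divff ?expf_neq0 // => ->.
      by rewrite -expfB.
    by exists d.
  have := H _ _ _ L_anm; case: (ltngtP a n) => [lt /ex|lt /esym /ex|e]; try exact.
  by case: n_neq_a.
have [[_ gcdP] _ _] := Hgcd.
have : (d%:Z %| 1%:Z)%Z.
  apply: gcdP => _ [a' [n' [m' [La ->]]]].
  have /eqP := H _ _ _ La; rewrite (eq_prim_root_expr prim_d) => e.
  by rewrite -eqz_mod_dvd !modz_nat eqz_nat eq_sym.
rewrite dvdz1 => /eqP /= d1; have := prim_expr_order prim_d; rewrite d1; exact.
Qed.

(** The absolute values satisfy the equations of [balance_linear] with k = 1 in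
    multiplicative form, so they are 1.  Then r = 1 or r = -1, and conj(lam) is the
    inverse of lam: lam^a r^m = r lam^n.  If r = 1 this is [order_trivial].  If
    r = -1 it applies to lam^2, and both values lam = 1 and lam = -1 contradict the
    parities. *)
Lemma balance_multiplicative (lam r : K) : lam != 0 -> r != 0 -> r^* = r ->
  (forall a' n' m', L (a', n', m') -> lam ^+ a' * lam^* ^+ n' * r ^+ m' = r) ->
  lam = 1 /\ r = 1.
Proof.
move=> lam0 r0 rr H.
have Hn a' n' m' : L (a', n', m') -> `|lam| ^+ (a' + n') * `|r| ^+ m' = `|r|.
  by move=> /H /(congr1 Num.norm); rewrite !normrM !normrX norm_conjC exprD.
have lpos : 0 < `|lam| by rewrite normr_gt0.
have rpos : 0 < `|r| by rewrite normr_gt0.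
have [a' [n' [m' [La' ne e]]]] := no_common_slope_witness (ltn0Sn 0).
have E1 := Hn _ _ _ L_anm; have E2 := Hn _ _ _ La'.
have r1 : `|r| = 1.
  apply/eqP/negPn/negP => rn1; apply: e.
  have : `|r| ^+ (a' + n') * `|r| ^+ (m' * (a + n)) = `|r| ^+ (a + n) * `|r| ^+ (m * (a' + n')).
    have -> : `|r| ^+ (a' + n') = `|lam| ^+ ((a + n) * (a' + n')) * `|r| ^+ (m * (a' + n')).
      by rewrite !exprM -exprMn E1.
    have -> : `|r| ^+ (a + n) = `|lam| ^+ ((a + n) * (a' + n')) * `|r| ^+ (m' * (a + n)).
      by rewrite mulnC !exprM -exprMn E2.
    by rewrite mulrAC.
  rewrite -!exprD => /(ieexprIn rpos rn1); lia.
have [a0 _] := L_gt0 L_anm.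
have l1 : `|lam| = 1.
  move: E1; rewrite r1 expr1n mulr1 => /eqP; rewrite pexpr_eq1 ?(ltW lpos) //.
    by move/eqP.
  by rewrite addn_gt0 a0.
have ll : lam * lam^* = 1 by rewrite -normCK l1 expr1n.
have rpm : r = 1 \/ r = -1.
  have /eqP : r ^+ 2 = 1 by rewrite expr2 -{2}rr -normCK r1 expr1n.
  by rewrite sqrf_eq1 => /orP[] /eqP; [left|right].
have rr2 : r ^+ 2 = 1 by case: rpm => ->; rewrite ?expr1n ?sqrrN ?expr1n.
have Hs x y z : L (x, y, z) -> lam ^+ x * r ^+ z = r * lam ^+ y.
  move=> /H E; rewrite -{2}E; transitivity (lam ^+ x * (lam * lam^*) ^+ y * r ^+ z).
    by rewrite ll expr1n mulr1.
  by rewrite exprMn; ring.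
case: rpm => re; [split=> //|exfalso].
  apply: order_trivial => // x y z /Hs; by rewrite re expr1n mulr1 mul1r.
have lam2 : lam ^+ 2 = 1.
  apply: order_trivial; first by rewrite expf_neq0.
  move=> x y z /Hs E; rewrite -!exprM ![(2 * _)%N]mulnC !exprM.
  have := congr1 (fun v => v ^+ 2) E; rewrite !exprMn rr2 mul1r => <-.
  by rewrite -[X in _ * X]exprM mulnC exprM rr2 expr1n mulr1.
have sgn b b' : (-1) ^+ b = (-1) ^+ b' :> K -> odd b = odd b'.
  rewrite -signr_odd -[RHS]signr_odd => /eqP; case: (odd b); case: (odd b') => //=;
  by rewrite ?expr0 ?expr1 1?[_ == 1]eq_sym -subr_eq0 opprK -(natrD _ 1 1) pnatr_eq0.
have [_ [x [y [z [Lxyz ez]]]] Hpar] := Hgcd.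
move/eqP: lam2; rewrite sqrf_eq1 => /orP[] /eqP le.
  have := Hs _ _ _ Lxyz; rewrite le re !expr1n mul1r mulr1 -{2}[-1]expr1.
  by move=> /sgn /=; rewrite (negbTE ez).
have {}Hs x' y' z' : L (x', y', z') -> odd (x' + z') = odd y'.+1.
  by move=> /Hs; rewrite le re -exprD -exprS => /sgn.
case: Hpar => -[x' [y' [z' [Lx oz]]]] /=.
  by have := Hs _ _ _ Lx; lia.
by have := Hs _ _ _ Lx; lia.
Qed.

End Arithmetic.

(** * Solving the mapping equation *)

Section Rigidity.
Variables (K : numClosedFieldType) (iota : K).
Hypothesis iota0 : iota != 0.
Variable L : nat * nat * nat -> Prop.
Variable phi : fps K 3.

Hypothesis phi_supp : forall a n m, L (a, n, m) -> forall u, phi u != 0 ->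
  [/\ (0 < u i0)%N, (0 < u i1)%N &
      [\/ u i0 = a /\ u i2 = m, (m < u i2)%N | (a + m < u i0 + u i2)%N]].
Hypothesis phi_lead : forall a n m, L (a, n, m) -> phi (mon3 a n m) != 0.
Hypothesis phi_low : forall a n m, L (a, n, m) ->
  forall j, (j < n)%N -> phi (mon3 a j m) = 0.
Hypothesis phi_x1 : forall u, phi u != 0 -> ~ (u i1 = 1%N /\ u i2 = 0%N).
Hypothesis L_gt1 : forall a n m, L (a, n, m) -> (1 < a + m)%N.
Hypothesis L_big : exists a n m, L (a, n, m) /\ (1 < a)%N.
(* Provided by [balance_linear] and [balance_multiplicative]. *)
Hypothesis L_linear : forall k (c G : K), (0 < k)%N -> G^* = G ->
  (forall a n m, L (a, n, m) ->
     k%:R * G = a%:R * c + n%:R * c^* + m%:R * G) -> c = 0 /\ G = 0.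
Hypothesis L_multiplicative : forall lam r : K, lam != 0 -> r != 0 -> r^* = r ->
  (forall a n m, L (a, n, m) -> lam ^+ a * lam^* ^+ n * r ^+ m = r) ->
  lam = 1 /\ r = 1.

Variables f g : fps K 2.
Definition conj_fps (h : fps K 2) : fps K 2 := fun m => (h m)^*.
Local Notation f' := (conj_fps f).
Local Notation g' := (conj_fps g).

Hypothesis Heq : mapping_equation iota phi f g f' g'.
Hypotheses (f00 : f (mon2 0 0) = 0) (g00 : g (mon2 0 0) = 0).
Hypothesis jac : f (mon2 1 0) * g (mon2 0 1) - f (mon2 0 1) * g (mon2 1 0) != 0.

Let L_pos a n m : L (a, n, m) -> (0 < a)%N /\ (0 < n)%N.
Proof. by move=> La; have := phi_supp La (phi_lead La); rewrite !mon3E => -[]. Qed.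

Let phi_x u : phi u != 0 -> (0 < u i1)%N.
Proof. by have [a [n [m [La _]]]] := L_big => /(phi_supp La) []. Qed.

Let cancel_lead a n m (c : K) : L (a, n, m) -> n%:R * c * phi (mon3 a n m) = 0 -> c = 0.
Proof.
move=> La /eqP; have [_ n0] := L_pos La.
by rewrite !mulf_eq0 pnatr_eq0 (negbTE (phi_lead La)) orbF eqn0Ngt n0 => /eqP.
Qed.

Lemma g_pure0 i : g (mon2 i 0) = 0.
Proof.
rewrite (@pure_identity _ _ iota0 _ _ _ _ _ Heq phi_x phi_x1 i 0) //.
- by rewrite /conj_fps g00 conjC0 mul0rn.
- by rewrite /conj_fps f00 conjC0.
Qed.

(** [pure_identity] for i = 0 says that the constant is its own conjugate. *)
Lemma g_pure k : (forall l, (l < k)%N -> f (mon2 0 l) = 0) -> (0 < k)%N ->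
  exists G, G^* = G /\ forall i, g (mon2 i k) = G *+ (i == 0%N).
Proof.
move=> fl k0.
have H i : g (mon2 i k) = g' (mon2 0 k) *+ (i == 0%N).
  apply: (@pure_identity _ _ iota0 _ _ _ _ _ Heq phi_x phi_x1 i k).
  - by rewrite /conj_fps f00 conjC0.
  - by move=> l /fl; rewrite /conj_fps => ->; apply: conjC0.
  - by move=> _; apply: g_pure0.
  - by move=> _ j; rewrite /conj_fps g_pure0 conjC0.
exists (g' (mon2 0 k)); split=> //.
by rewrite /conj_fps conjCK; have := H 0%N; rewrite mulr1n.
Qed.

Lemma conj_pure k G : G^* = G -> (forall i, g (mon2 i k) = G *+ (i == 0%N)) ->
  forall i, g' (mon2 i k) = G *+ (i == 0%N).
Proof. by move=> Gr HG i; rewrite /conj_fps HG rmorphMn /= Gr. Qed.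

(** The start of the induction.  The Jacobian condition enters here: since
    g(z, 0) = 0 it says that the leading coefficients lam and r are non-zero. *)
Lemma rigid0 : [/\ f (mon2 1 0) = 1, g (mon2 0 1) = 1,
  (forall i, (1 < i)%N -> f (mon2 i 0) = 0) & forall i, (0 < i)%N -> g (mon2 i 1) = 0].
Proof.
have [r [rr Hr]] : exists G, G^* = G /\ forall i, g (mon2 i 1) = G *+ (i == 0%N).
  by apply: g_pure => // -[|//] _.
have Hr' := conj_pure rr Hr.
have f'00 : f' (mon2 0 0) = 0 by rewrite /conj_fps f00 conjC0.
have g'0 i : g' (mon2 i 0) = 0 by rewrite /conj_fps g_pure0 conjC0.
have stage a n m N q : L (a, n, m) -> (0 < N)%N -> (1 < q)%N -> (N < n + q)%N ->
    (forall i, (1 < i)%N -> (i < q)%N -> f' (mon2 i 0) = 0) -> _ := fun La N0 q1 Nq Hq =>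
  zero_identity iota0 Heq (L_pos La).1 (L_gt1 La) N0 (phi_supp La) f00 f'00 g_pure0 g'0 Hr Hr'
    (L_pos La).2 q1 Nq (phi_low La) Hq.
move: jac; rewrite g_pure0 mulr0 subr0 mulf_eq0 negb_or => /andP[lam0 r0].
have r01 : g (mon2 0 1) = r by rewrite Hr mulr1n.
rewrite r01 in r0.
have [lam1 r1] : f (mon2 1 0) = 1 /\ r = 1.
  apply: L_multiplicative => // a n m La.
  have nq : (n < n + 2)%N by lia.
  have Hq2 i : (1 < i)%N -> (i < 2)%N -> f' (mon2 i 0) = 0 by case: i => [|[|i]].
  have := stage a n m n 2%N La (L_pos La).2 isT nq Hq2.
  have -> : (n.+1 == n + 2)%N = false by apply/eqP; lia.
  rewrite mulr0n addr0 mulrA => /(mulIf (phi_lead La)) E.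
  by rewrite [RHS]E mulrAC.
have f'10 : f' (mon2 1 0) = 1 by rewrite /conj_fps lam1 conjC1.
split=> //; first by rewrite r01.
  move=> q q1; elim/ltn_ind: q q1 => q IH q1.
  have [a [n [m [La _]]]] := L_big; have [a0 n0] := L_pos La.
  have Nq : ((n + q).-1 < n + q)%N by lia.
  have N0 : (0 < (n + q).-1)%N by lia.
  have Hq i : (1 < i)%N -> (i < q)%N -> f' (mon2 i 0) = 0.
    by move=> i1 iq; rewrite /conj_fps IH // conjC0.
  have := stage a n m _ q La N0 q1 Nq Hq.
  rewrite lam1 r1 f'10 !expr1n !mul1r prednK ?addn_gt0 ?n0 // eqxx mulr1n mulr1 => /eqP.
  rewrite -subr_eq0 opprD addrA subrr sub0r oppr_eq0 => /eqP H.
  by apply/eqP; rewrite -conjC_eq0; apply/eqP/(cancel_lead La H).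
by move=> i i0; rewrite Hr eqn0Ngt i0.
Qed.

(** At each order the unknowns are determined in the sequence f(0, w), then G and
    the coefficient of z w^k, then the remaining coefficients of f.  The first has
    to come before G, because [g_pure] uses it. *)
Lemma rigid : (forall u, f u = (u == mon2 1 0)%:R) /\ (forall u, g u = (u == mon2 0 1)%:R).
Proof.
suff H k : (0 < k)%N -> (forall u : 'X_{1..2}, (u ord_max < k)%N -> f u = (u == mon2 1 0)%:R) /\
    (forall u : 'X_{1..2}, (u ord_max < k.+1)%N -> g u = (u == mon2 0 1)%:R).
  by split=> u; have [] := H (u ord_max).+1 isT; [move=> + _ | move=> _ +]; apply; rewrite ltnS.
have mon2_eq i l i' l' : (mon2 i l == mon2 i' l') = (i == i') && (l == l').
  apply/eqP/andP => [e|[/eqP-> /eqP->] //].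
  have := congr1 (fun u : 'X_{1..2} => u ord0) e.
  have := congr1 (fun u : 'X_{1..2} => u ord_max) e.
  by rewrite !mon2E => -> ->.
have [f1 g1 fz gz] := rigid0.
case: k => // k _; elim: k => [|k [IHf IHg]].
  split=> u; rewrite -[u]mon2K mon2_eq; move: (u ord0) (u ord_max) => i l /=.
    rewrite mon2E ltnS leqn0 => /eqP ->; rewrite eqxx andbT.
    by case: i => [|[|i]] //=; rewrite fz.
  rewrite mon2E; case: l => [|[|//]] _; first by rewrite g_pure0 andbF.
  by case: i => [|i] //=; rewrite gz.
have f0l l : (l < k.+1)%N -> f (mon2 0 l) = 0.
  by move=> lk; rewrite IHf ?mon2E // mon2_eq.
have IHf' (u : 'X_{1..2}) : (u ord_max < k.+1)%N -> f' u = (u == mon2 1 0)%:R.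
  by move=> /IHf; rewrite /conj_fps => ->; rewrite conjC_nat.
have IHg' (u : 'X_{1..2}) : (u ord_max < k.+2)%N -> g' u = (u == mon2 0 1)%:R.
  by move=> /IHg; rewrite /conj_fps => ->; rewrite conjC_nat.
(* de = 0: the target z^(a-1) x^n s^(m+k) exists because a > 1. *)
have f0k : f (mon2 0 k.+1) = 0.
  have [a [n [m [La a1]]]] := L_big; have [a0 n0] := L_pos La.
  have T1 : (0 < a.-1)%N by lia.
  have T2 : (a.-1 + 1 = a + 0)%N by lia.
  have := stage_identity iota0 Heq a0 (L_gt1 La) T1 T2 isT n0 (phi_supp La) (G := 0)
    (ltn0Sn k) IHf IHf' IHg IHg' _ _ _ n0 (ltn0Sn 0) (erefl _) (phi_low La) _.
  rewrite !mulr0n addr0 => E.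
  have /esym/eqP := E (fun e => False_ind _ (n_Sn _ e)) (fun e => False_ind _ (n_Sn _ e))
     (fun e => False_ind _ (n_Sn _ e)) (fun e => False_ind _ (n_Sn _ e)).
  rewrite !mulf_eq0 pnatr_eq0 (negbTE (phi_lead La)) orbF eqn0Ngt a0 => /eqP //.
have f0l' l : (l < k.+2)%N -> f (mon2 0 l) = 0.
  by rewrite ltnS leq_eqVlt => /predU1P[->|/f0l].
have [G [Gr HG]] := g_pure f0l' (ltn0Sn _).
have HG' := conj_pure Gr HG.
have stage a n m N q (La : L (a, n, m)) (N0 : (0 < N)%N) (q0 : (0 < q)%N) (Nq : (N + 1 = n + q)%N)
    (Hq : 1%N = 1%N -> forall i, (i < q)%N -> f' (mon2 i k.+1) = 0) :=
  stage_identity iota0 Heq (L_pos La).1 (L_gt1 La) (L_pos La).1 (erefl (a + 1)%N) isT N0 (phi_supp La)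
    (ltn0Sn k) IHf IHf' IHg IHg' (fun _ => f0k) (fun _ => HG) (fun _ => HG') (L_pos La).2 q0 Nq
    (phi_low La) Hq.
have f'0k : f' (mon2 0 k.+1) = 0 by rewrite /conj_fps f0k conjC0.
have [f1k G0] : f (mon2 1 k.+1) = 0 /\ G = 0.
  apply: (L_linear (k := k.+2)) => // a n m La.
  have Hq : 1%N = 1%N -> forall i, (i < 1)%N -> f' (mon2 i k.+1) = 0 by move=> _ [|//].
  have := stage a n m n 1%N La (L_pos La).2 isT (erefl _) Hq.
  by rewrite !mulr1n -!mulrDl addrA => /(mulIf (phi_lead La)).
have fk i : f (mon2 i k.+1) = 0.
  elim/ltn_ind: i => -[|[|i]] IH //.
  have [a [n [m [La _]]]] := L_big; have [a0 n0] := L_pos La.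
  have Hq : 1%N = 1%N -> forall j, (j < i.+2)%N -> f' (mon2 j k.+1) = 0.
    by move=> _ j ji; rewrite /conj_fps IH // conjC0.
  have N0 : (0 < n + i.+1)%N by lia.
  have Nq : (n + i.+1 + 1 = n + i.+2)%N by lia.
  have := stage a n m _ i.+2 La N0 isT Nq Hq.
  rewrite f1k G0 !(mulr0, mul0r, addr0, add0r) !mulr1n => /esym H.
  by apply/eqP; rewrite -conjC_eq0; apply/eqP/(cancel_lead La H).
split=> u; rewrite ltnS leq_eqVlt => /predU1P[e|].
- by rewrite -[u]mon2K e fk mon2_eq andbF.
- exact: IHf.
- by rewrite -[u]mon2K e HG G0 mul0rn mon2_eq andbF.
- exact: IHg.
Qed.

End Rigidity.

(** * Formal inverses *)

Section Linearisation.
Variable K : comNzRingType.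
Variables (k n : nat).
Implicit Types (p : {mpoly K[k]}) (G e : 'I_k -> {mpoly K[n]}).

Lemma mcomp_monomial_perturb G e d (m : 'X_{1..k}) : nonconst G ->
  (forall i, supp_in (deg_ge d.+1) (e i)) ->
  supp_in (deg_ge (d + mdeg m))
    (mcomp 'X_[m] (fun i => G i + e i) - mcomp 'X_[m] G).
Proof.
move=> G1 He; elim: {m}(mdeg m) {-2}m (erefl (mdeg m)) => [|l IH] m ml.
  have /eqP -> : m == 0%MM by rewrite -mdeg_eq0 ml.
  by rewrite mpolyX0 -mpolyC1 !mcompC subrr; apply: supp_in0.
have [i mi] : exists i, m i != 0%N.
  apply/existsP; apply: contra_eqT ml => /existsPn H.
  by rewrite mdegE big1 // => i _; have /negPn/eqP := H i.
have Um : (U_(i) <= m)%MM by rewrite lep1mP.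
have -> : m = (U_(i) + (m - U_(i)))%MM by rewrite addmC submK.
move: (m - U_(i))%MM (congr1 mdeg (submK Um)) => m'; rewrite mdegD mdeg1 ml addn1 => -[m'l].
have {}IH := IH _ m'l; rewrite mpolyXD !mcompM !mcompU.
set A := mcomp _ _ in IH *; set B := mcomp _ _ in IH *.
have -> : (G i + e i) * A - G i * B = e i * A + G i * (A - B) by ring.
have A1 : supp_in (deg_ge (mdeg m')) A.
  apply: mcomp_supp_deg; first by apply: supp_inX.
  move=> j; apply: supp_inD => //; apply: supp_inW (He j) => u /=; lia.
rewrite mdegD mdeg1; apply: supp_inD.
  by apply: (supp_inM (He i) A1) => u v /=; rewrite mdegD; lia.
by apply: (supp_inM (G1 i) IH) => u v /=; rewrite mdegD m'l; lia.
Qed.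

(** Taylor expansion at first order: the terms of degree at least 2 in [p] multiply
    the perturbation by something of positive degree. *)
Lemma mcomp_perturb p G e d : nonconst G ->
  (forall i, supp_in (deg_ge d.+1) (e i)) ->
  mcomp p (fun i => G i + e i) =[d.+2]= mcomp p G + \sum_i p@_U_(i) *: e i.
Proof.
move=> G1 He.
pose lin : {mpoly K[k]} := (p@_0%MM)%:MP + \sum_i p@_U_(i) *: 'X_i.
have lin_coef (m : 'X_{1..k}) : (mdeg m < 2)%N -> lin@_m = p@_m.
  rewrite /lin mcoeffD mcoeffC raddf_sum /= => m2.
  have [m0|m0] := eqVneq m 0%MM.
    rewrite m0 mulr1 big1 ?addr0 // => i _; rewrite mcoeffZ mcoeffX.
    by rewrite mnm1_eq0 mulr0.
  have /mdeg1P[i /eqP ->] : mdeg m == 1%N by rewrite -mdeg_eq0 in m0; lia.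
  rewrite mulr0 add0r (bigD1 i) //= mcoeffZ mcoeffX eqxx mulr1 big1 ?addr0 // => j ji.
  by rewrite mcoeffZ mcoeffX eq_mnm1 (negbTE ji) mulr0.
have q2 : supp_in (deg_ge 2) (p - lin).
  by move=> m; rewrite mcoeffB subr_eq0 ltnNge -ltnS => nz; apply/negP => /lin_coef e0; rewrite e0 eqxx in nz.
have pE n' (H : 'I_k -> {mpoly K[n']}) : mcomp p H = mcomp lin H + mcomp (p - lin) H.
  by rewrite -mcompD addrC subrK.
have linE : mcomp lin (fun i => G i + e i) = mcomp lin G + \sum_i p@_U_(i) *: e i.
  rewrite /lin !mcompD !mcompC -addrA; congr (_ + _).
  rewrite !mcomp_sum -big_split; apply: eq_bigr => i _ /=.
  by rewrite !mcompZ !mcompU scalerDr.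
rewrite !pE linE /eqmod.
set S := \sum_i _; set A := mcomp lin G; move: (p - lin) q2 => q q2.
have -> (u v : {mpoly K[n]}) : A + S + u - (A + v + S) = u - v by ring.
rewrite [q]mpolyE !mcomp_sum -sumrB big_seq; apply: supp_in_sum => m.
rewrite mcoeff_msupp !mcompZ -scalerBr => /q2 m2; apply: supp_inZ.
by apply: (supp_inW _ (mcomp_monomial_perturb G1 He)) => u /=; lia.
Qed.

Lemma mcomp_linear_coef p G (j : 'I_n) : nonconst G ->
  (mcomp p G)@_U_(j) = \sum_i p@_U_(i) * (G i)@_U_(j).
Proof.
move=> G1; have z1 : nonconst (fun _ : 'I_k => 0 : {mpoly K[n]}) by move=> i; apply: supp_in0.
have := mcomp_perturb (p := p) (d := 0) z1 G1.
move=> /(eqmod_degE (m := U_(j)%MM)); rewrite mdeg1 => /(_ isT).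
rewrite (eq_mcomp (H := G)); last by move=> i; rewrite add0r.
rewrite mcoeffD raddf_sum /= => ->; rewrite [X in X + _](_ : _ = 0) ?add0r; last first.
  rewrite [p]mpolyE mcomp_sum raddf_sum big1 // => m _ /=; rewrite mcompZ mcoeffZ mcompX.
  have [->|m0] := eqVneq m 0%MM.
    by rewrite big1 => [|i _]; rewrite ?mnm0E ?expr0 // mcoeff1 mnm1_eq0 mulr0.
  have [i mi] : exists i, m i != 0%N.
    apply/existsP; apply: contra_neqT m0 => /existsPn H.
    by apply/mnmP => i; have /negPn/eqP := H i; rewrite mnm0E.
  by rewrite (bigD1 i) //= expr0n (negbTE mi) mul0r mcoeff0 mulr0.
by apply: eq_bigr => i _; rewrite mcoeffZ.
Qed.

End Linearisation.

Definition lin_mx (K : comNzRingType) k n (P : 'I_k -> fps K n) : 'M[K]_(k, n) :=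
  \matrix_(i, j) P i U_(j)%MM.

Section Inverse.
Variables (K : comUnitRingType) (n : nat).
Variable P : 'I_n -> fps K n.
Hypotheses (P0 : forall i, P i 0%MM = 0) (Pu : lin_mx P \in unitmx).

(** Newton's iteration with the linear part kept fixed: by [mcomp_perturb] each
    step cancels the residual in one more degree. *)
Fixpoint newton d : 'I_n -> {mpoly K[n]} :=
  if d is d'.+1 then
    fun i => newton d' i -
      \sum_j invmx (lin_mx P) i j *: (mcomp (fps_trunc d (P j)) (newton d') - 'X_j)
  else fun=> 0.

Lemma newton_correct d : nonconst (newton d) /\
  forall i, mcomp (fps_trunc d (P i)) (newton d) =[d.+1]= 'X_i.
Proof.
elim: d => [|d [IH1 IH2]].
  have z1 : nonconst (fun _ : 'I_n => 0 : {mpoly K[n]}) by move=> i; apply: supp_in0.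
  split=> //= i; apply: supp_inB; first by apply: mcomp_supp_deg => //; apply: trunc_nonconst.
  by apply: supp_inX; rewrite /= mdeg1.
pose res j := mcomp (fps_trunc d.+1 (P j)) (newton d) - 'X_j.
have res_supp j : supp_in (deg_ge d.+1) (res j).
  apply: eqmod_trans (IH2 j); apply: eqmod_mcomp => //; first exact: trunc_le.
  by move=> i; apply: eqmod_refl.
pose e i := - \sum_j invmx (lin_mx P) i j *: res j.
have e_supp i : supp_in (deg_ge d.+1) (e i).
  by apply: supp_inN; apply: supp_in_sum => j _; apply: supp_inZ.
split=> [i|i] /=.
  by apply: supp_inD => //; apply: supp_inW (e_supp i) => m /=; lia.
apply: (eqmod_trans (mcomp_perturb (p := fps_trunc d.+1 (P i)) IH1 e_supp)).
rewrite (_ : _ + _ = 'X_i); first exact: eqmod_refl.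
have -> : \sum_l (fps_trunc d.+1 (P i))@_U_(l) *: e l = - res i.
  rewrite (eq_bigr (fun l => - \sum_j (lin_mx P i l * invmx (lin_mx P) l j) *: res j)); last first.
    move=> l _; rewrite truncE mdeg1 /= /e scalerN scaler_sumr; congr (- _).
    by apply: eq_bigr => j _; rewrite scalerA mxE.
  rewrite sumrN; congr (- _); rewrite exchange_big /=.
  rewrite (eq_bigr (fun j => (1%:M : 'M[K]_n) i j *: res j)); last first.
    by move=> j _; rewrite -(mulmxV Pu) mxE scaler_suml.
  rewrite (bigD1 i) //= mxE eqxx scale1r big1 ?addr0 // => j ji.
  by rewrite mxE eq_sym (negbTE ji) scale0r.
by rewrite /res opprB addrC subrK.
Qed.

Lemma newton_stable d i : newton d.+1 i =[d.+1]= newton d i.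
Proof.
rewrite /eqmod /= addrAC subrr add0r; apply: supp_inN; apply: supp_in_sum => j _.
apply: supp_inZ; have [IH1 IH2] := newton_correct d.
apply: eqmod_trans (IH2 j); apply: eqmod_mcomp => //; first exact: trunc_le.
by move=> l; apply: eqmod_refl.
Qed.

Definition formal_inverse : 'I_n -> fps K n := fun i m => (newton (mdeg m) i)@_m.

Lemma trunc_formal_inverse d i : fps_trunc d (formal_inverse i) =[d.+1]= newton d i.
Proof.
apply: eqmod_deg => m md; rewrite truncE md /formal_inverse.
elim: d md => [|d IH]; first by rewrite leqn0 => /eqP ->.
rewrite leq_eqVlt => /predU1P[-> //|]; rewrite ltnS => md.
by rewrite IH //; symmetry; apply: (eqmod_degE (@newton_stable d i) md).
Qed.

Lemma formal_inverse0 i : formal_inverse i 0%MM = 0.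
Proof. by rewrite /formal_inverse mdeg0 /= mcoeff0. Qed.

Lemma formal_inverseK d i :
  mcomp (fps_trunc d (P i)) (fun j => fps_trunc d (formal_inverse j)) =[d.+1]= 'X_i.
Proof.
have [N1 N2] := newton_correct d; apply: eqmod_trans (N2 i).
apply: eqmod_mcomp => // [|j]; first exact: eqmod_refl.
exact: trunc_formal_inverse.
Qed.

Lemma formal_inverse_unit : lin_mx formal_inverse \in unitmx.
Proof.
have e : lin_mx P *m lin_mx formal_inverse = 1%:M.
  apply/matrixP => i j; rewrite !mxE.
  have := eqmod_degE (m := U_(j)%MM) (@formal_inverseK 1 i).
  rewrite mdeg1 mcomp_linear_coef; last exact: trunc_nonconst formal_inverse0.
  rewrite mcoeffX eq_mnm1 => <- //; apply: eq_bigr => l _.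
  by rewrite !truncE !mdeg1 !mxE.
by have [] := mulmx1_unit e.
Qed.

End Inverse.

(** The right inverse Q of P has a right inverse S of its own, and
    P = P(Q(S)) = S. *)
Lemma formal_inverseKl (K : comUnitRingType) n (P : 'I_n -> fps K n)
    (P0 : forall i, P i 0%MM = 0) (Pu : lin_mx P \in unitmx) d i :
  mcomp (fps_trunc d (formal_inverse P i)) (fun j => fps_trunc d (P j)) =[d.+1]= 'X_i.
Proof.
set Q := formal_inverse P; have Q0 := formal_inverse0 P : forall i, Q i 0%MM = 0.
have Qu := formal_inverse_unit P0 Pu : lin_mx Q \in unitmx.
set S := formal_inverse Q; have S0 := formal_inverse0 Q : forall i, S i 0%MM = 0.
have PT := trunc_nonconst (D := d) P0; have QT := trunc_nonconst (D := d) Q0; have ST := trunc_nonconst (D := d) S0.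
have PS j : fps_trunc d (P j) =[d.+1]= fps_trunc d (S j).
  apply: (@eqmod_trans _ _ _ _ (mcomp (fps_trunc d (P j)) (fun l => mcomp (fps_trunc d (Q l)) (fun j => fps_trunc d (S j))))).
    rewrite -[X in X =[_]= _]mcomp_id; apply: eqmod_mcomp.
    - exact: eqmod_refl.
    - by move=> l; apply: eqmod_sym; apply: formal_inverseK.
    - exact: mcomp_nonconst.
  rewrite -mcompA -[X in _ =[_]= X](mcompU (fun j => fps_trunc d (S j))).
  apply: eqmod_mcomp => //; last by move=> l; apply: eqmod_refl.
  exact: formal_inverseK.
apply: eqmod_trans (@formal_inverseK _ _ _ Q0 Qu d i).
by apply: eqmod_mcomp => //; apply: eqmod_refl.
Qed.

(** * Conjugation and evaluation on pairs of points *)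

Section Pairs.
Variable R : realType.
Local Notation C := R[i].

Definition cmap n (p : {mpoly C[n]}) : {mpoly C[n]} := map_mpoly (@Num.conj C) p.

Lemma cmap_coef n (p : {mpoly C[n]}) m : (cmap p)@_m = (p@_m)^*.
Proof. exact: mcoeff_map_mpoly. Qed.

Lemma cmap_trunc n d (f : fps C n) : fps_trunc d (fps_conj f) = cmap (fps_trunc d f).
Proof.
apply/mpolyP => m; rewrite cmap_coef !truncE; case: ifP => // _.
by rewrite rmorph0.
Qed.

Lemma cmap_eqmod n d (p q : {mpoly C[n]}) : p =[d]= q -> cmap p =[d]= cmap q.
Proof.
move=> H m; rewrite -rmorphB mcoeff_map_mpoly fmorph_eq0; exact: H.
Qed.

Lemma cmap_comp k n (p : {mpoly C[k]}) (G : 'I_k -> {mpoly C[n]}) :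
  cmap (mcomp p G) = mcomp (cmap p) (fun i => cmap (G i)).
Proof.
rewrite [p]mpolyE mcomp_sum /cmap !rmorph_sum mcomp_sum; apply: eq_bigr => m _.
rewrite mcompZ /= !map_mpolyZ mcompZ map_mpolyX !mcompX rmorph_prod; congr (_ *: _).
by apply: eq_bigr => i _; rewrite rmorphXn.
Qed.

Lemma cmapX n i : cmap 'X_i = 'X_i :> {mpoly C[n]}.
Proof. exact: map_mpolyX. Qed.

(** A point of C^2 and a point of the conjugate space, as an argument for series in
    (Z, conj Z). *)
Definition glue n (u v : 'I_2 -> {mpoly C[n]}) : 'I_(2 + 2) -> {mpoly C[n]} :=
  fun i => match split i with inl j => u j | inr j => v j end.

Lemma gluel n (u v : 'I_2 -> {mpoly C[n]}) j : glue u v (lshift 2 j) = u j.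
Proof. by rewrite /glue (unsplitK (inl j)). Qed.

Lemma gluer n (u v : 'I_2 -> {mpoly C[n]}) j : glue u v (rshift 2 j) = v j.
Proof. by rewrite /glue (unsplitK (inr j)). Qed.

Lemma glue_nonconst n (u v : 'I_2 -> {mpoly C[n]}) :
  nonconst u -> nonconst v -> nonconst (glue u v).
Proof. by move=> Hu Hv i; rewrite /glue; case: split. Qed.

Lemma glue_eqmod n d (u v u' v' : 'I_2 -> {mpoly C[n]}) :
  (forall i, u i =[d]= u' i) -> (forall i, v i =[d]= v' i) ->
  forall i, glue u v i =[d]= glue u' v' i.
Proof. by move=> Hu Hv i; rewrite /glue; case: split. Qed.

Lemma fps_comp0 (K : comNzRingType) k n (F : fps K k) (G : 'I_k -> fps K n) :
  fps_comp F G 0%MM = F 0%MM.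
Proof.
rewrite /fps_comp -mcompE mdeg0 mcomp_trunc raddf_sum /=.
rewrite (bigD1 (bm0 : 'X_{1..k < 1})) //= [X in _ + X]big1 ?addr0 => [|m m0].
  by rewrite mcoeffZ big1 => [|i _]; [rewrite mcoeff1 eqxx mulr1 | rewrite (mnm0E i) expr0].
by case/eqP: m0; apply/val_inj/eqP; rewrite /= -mdeg_eq0 -leqn0 -ltnS bmdeg.
Qed.

(** The components of [H] without their constant terms: the series that [pullback]
    substitutes. *)
Definition shift (q : 'rV[C]_2) (H : formal_map R) : formal_map R :=
  fun j => fps_sub (H j) (fps_poly (q 0 j)%:MP).

Lemma shift0 (q : 'rV[C]_2) (H : formal_map R) : (forall i, H i 0%MM = q 0 i) ->
  forall i, shift q H i 0%MM = 0.
Proof. by move=> H0 i; rewrite /shift /fps_sub /fps_poly H0 mcoeffC eqxx mulr1 subrr. Qed.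

Lemma shift_jacobian (q : 'rV[C]_2) (H : formal_map R) : lin_mx (shift q H) = jacobian H.
Proof.
apply/matrixP => i j; rewrite !mxE /shift /fps_sub /fps_poly mcoeffC mnm1_eq0 mulr0 subr0 //.
Qed.

(** Evaluating at independent points (u, v) replaces the identities between series
    in (Z, conj Z) by the geometric statement that pairs of points are mapped to
    pairs of points. *)
Lemma pullback_at n d (q : 'rV[C]_2) rho (H : formal_map R) (u v : 'I_2 -> {mpoly C[n]}) :
  (forall i, H i 0%MM = q 0 i) -> nonconst u -> nonconst v ->
  mcomp (fps_trunc d (pullback q rho H)) (glue u v) =[d.+1]=
  mcomp (fps_trunc d rho) (glue (fun j => mcomp (fps_trunc d (shift q H j)) u)
     (fun j => mcomp (cmap (fps_trunc d (shift q H j))) v)).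
Proof.
move=> H0 Hu Hv; have h0 := shift0 H0.
set h := shift q H in h0 *.
pose G (i : 'I_(2 + 2)) := match split i with
                         | inl j => in_Z (h j)
                         | inr j => in_conjZ (fps_conj (h j))
                         end.
have G0 i : G i 0%MM = 0.
  by rewrite /G; case: split => j; rewrite /in_Z /in_conjZ fps_comp0 /fps_conj h0 ?rmorph0.
have P1 := glue_nonconst Hu Hv.
have X1 (s : 'I_2 -> 'I_(2 + 2)) : nonconst (fun i => 'X_(s i) : {mpoly C[2 + 2]}).
  by move=> i; apply: supp_inX; rewrite /= mdeg1.
apply: (@eqmod_trans _ _ _ _ (mcomp (mcomp (fps_trunc d rho) (fun i => fps_trunc d (G i))) (glue u v))).
  by apply: eqmod_mcomp => // [|i]; [apply: trunc_mcomp | apply: eqmod_refl].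
rewrite mcompA; apply: eqmod_mcomp; first exact: eqmod_refl.
  have part (s : 'I_2 -> 'I_(2 + 2)) (F : fps C 2) (t : 'I_2 -> {mpoly C[n]}) :
      F 0%MM = 0 -> (forall j, glue u v (s j) = t j) ->
      mcomp (fps_trunc d (fps_comp F (fun i => fps_poly 'X_(s i)))) (glue u v) =[d.+1]=
      mcomp (fps_trunc d F) t.
    move=> F0 st.
    apply: (@eqmod_trans _ _ _ _ (mcomp (mcomp (fps_trunc d F) (fun i => 'X_(s i))) (glue u v))).
      apply: eqmod_mcomp => // [|i]; last exact: eqmod_refl.
      apply: (eqmod_trans (trunc_mcomp _)) => [i|].
        by rewrite /fps_poly mcoeffX mnm1_eq0.
      by apply: eqmod_mcomp => // [|i]; [apply: eqmod_refl | apply: trunc_poly].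
    rewrite mcompA (eq_mcomp (H := t)); first exact: eqmod_refl.
    by move=> i; rewrite mcompU.
  move=> i; rewrite /G /glue; case: (split i) => j.
    by apply: part => [|l]; rewrite ?h0 ?gluel.
  rewrite -cmap_trunc; apply: part => [|l]; last by rewrite gluer.
  by rewrite /fps_conj h0 rmorph0.
have h1 := trunc_nonconst (D := d) h0.
apply: glue_nonconst => j; apply: mcomp_supp_deg => //.
by move=> m; rewrite cmap_coef fmorph_eq0; apply: h1.
Qed.

End Pairs.

(** * Automorphisms in normal coordinates *)

Section NormalCoordinates.
Variable R : realType.
Local Notation C := R[i].

Definition pt n (u v : {mpoly C[n]}) : 'I_2 -> {mpoly C[n]} :=
  fun j => if j == ord0 then u else v.

Lemma pt_eq n (u v : 'I_2 -> {mpoly C[n]}) : u ord0 = v ord0 -> u ord_max = v ord_max -> u =1 v.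
Proof.
move=> e0 e1 j; case: (eqVneq j ord0) => [->//|j0].
have -> // : j = ord_max.
by apply/val_inj; case: j j0 => -[|[|//]].
Qed.

Lemma ev2_mcomp n d (F : fps C 2) (u : 'I_2 -> {mpoly C[n]}) :
  ev2 F d (u ord0) (u ord_max) = mcomp (fps_trunc d F) u.
Proof. by apply: eq_mcomp; apply: pt_eq. Qed.

Lemma graph_rho_at n d phi (u v : 'I_2 -> {mpoly C[n]}) :
  nonconst u -> nonconst v ->
  mcomp (fps_trunc d (graph_rho phi)) (glue u v) =[d.+1]=
  (2 * 'i%C)^-1 *: (u ord_max - v ord_max) -
    ev3 phi d (u ord0) (v ord0) (2^-1 *: (u ord_max + v ord_max)).
Proof.
move=> Hu Hv; have P1 := glue_nonconst Hu Hv.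
rewrite /graph_rho trunc_sub mcompB; apply: eqmodB.
  apply: (@eqmod_trans _ _ _ _ (mcomp ((2 * 'i%C)^-1 *: ('X_(lshift 2 ord_max) - 'X_(rshift 2 ord_max))) (glue u v))).
    by apply: eqmod_mcomp => // [|i]; [apply: trunc_poly | apply: eqmod_refl].
  by rewrite mcompZ mcompB !mcompU gluel gluer; apply: eqmod_refl.
set T := [tuple _; _; _].
have T1 i : supp_in (deg_ge 1) (tnth T i).
  have X1 (j : 'I_(2 + 2)) : supp_in (deg_ge 1) ('X_j : {mpoly C[2 + 2]}).
    by apply: supp_inX; rewrite /= mdeg1.
  rewrite (tnth_nth 0); case: i => -[|[|[|//]]] lti //=.
  by apply: supp_inZ; apply: supp_inD.
have T0 i : fps_poly (tnth T i) 0%MM = 0.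
  apply/eqP; rewrite /fps_poly; apply: contraT => /T1 /=.
  by rewrite mdeg0.
apply: (@eqmod_trans _ _ _ _ (mcomp (mcomp (fps_trunc d phi) (tnth T)) (glue u v))).
  apply: eqmod_mcomp => // [|i]; last exact: eqmod_refl.
  apply: (eqmod_trans (trunc_mcomp T0)).
  by apply: eqmod_mcomp => // [|i]; [apply: eqmod_refl | apply: trunc_poly].
rewrite mcompA /ev3 (eq_mcomp (H := fun i : 'I_3 => if i == i0 then u ord0 else
   if i == i1 then v ord0 else 2^-1 *: (u ord_max + v ord_max))); first exact: eqmod_refl.
move=> i; rewrite (tnth_nth 0); case: i => -[|[|[|//]]] lti /=.
- by rewrite mcompU gluel.
- by rewrite mcompU gluer.
- by rewrite mcompZ mcompD !mcompU gluel gluer.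
Qed.

Lemma mcomp_const k n (p : {mpoly C[k]}) (G : 'I_k -> {mpoly C[n]}) :
  nonconst G -> (mcomp p G)@_0%MM = p@_0%MM.
Proof.
move=> G1; have pE : p = (p@_0%MM)%:MP + (p - (p@_0%MM)%:MP) by rewrite addrC subrK.
rewrite [in LHS]pE mcompD mcompC mcoeffD mcoeffC eqxx mulr1 -[RHS]addr0; congr (_ + _).
have H : supp_in (deg_ge 1) (mcomp (p - (p@_0%MM)%:MP) G).
  apply: mcomp_supp_deg => // m; rewrite lt0n mdeg_eq0; apply: contra_neqN => /eqP ->.
  by rewrite mcoeffB mcoeffC eqxx mulr1 subrr.
by apply/eqP; apply: contraT => /H /=; rewrite mdeg0.
Qed.

(** Induction on the degree: the constant term of [a] recovers the lowest part of
    [r].  It allows to pass from the vanishing of a * rho to that of rho. *)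
Lemma unit_cancel n d (a r : {mpoly C[n]}) : a@_0%MM != 0 ->
  a * r =[d]= 0 -> r =[d]= 0.
Proof.
move=> a0 ar; elim: d ar => [|d IH] ar; first by [].
have rd : supp_in (deg_ge d) r.
  rewrite -[r]subr0; apply: IH; apply: eqmodW ar => m /=; lia.
have a1 : supp_in (deg_ge 1) (a - (a@_0%MM)%:MP).
  move=> m; rewrite lt0n mdeg_eq0; apply: contra_neqN => /eqP ->.
  by rewrite mcoeffB mcoeffC eqxx mulr1 subrr.
have -> : r = (a@_0%MM)^-1 *: (a * r - (a - (a@_0%MM)%:MP) * r).
  by rewrite -mulrBl subKr mul_mpolyC scalerA mulVf // scale1r.
rewrite /eqmod subr0; apply: supp_inZ; apply: supp_inB.
  by rewrite -[a * r]subr0.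
by apply: (supp_inM a1 rd) => m1 m2 /=; rewrite mdegD; lia.
Qed.

Local Notation z := (zv C).
Local Notation x := (xv C).

Section Reduction.
Variables (M : hypersurface R) (phi : fps C 3) (Phi H : formal_map R).
Hypothesis phi_pure : forall m, phi m != 0 -> (0 < m i0)%N /\ (0 < m i1)%N.
Hypotheses (Phi_inv : formal_invertible_to 0 Phi)
  (H_inv : formal_invertible_to (hbase M) H).
Variables (a b : fps C (2 + 2)).
Hypothesis a0 : a 0%MM != 0.
Hypothesis Ha : pullback 0 (graph_rho phi) Phi =1 fps_mul a (hrho M).
Hypothesis Hb : pullback (hbase M) (hrho M) H =1 fps_mul b (hrho M).

Local Notation P := (shift 0 Phi).
Local Notation h := (shift (hbase M) H).
Local Notation Q := (formal_inverse P).

Let P0 : forall i, P i 0%MM = 0.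
Proof. by case: Phi_inv => ? _; apply: shift0. Qed.

Let h0 : forall i, h i 0%MM = 0.
Proof. by case: H_inv => ? _; apply: shift0. Qed.

Let Q0 : forall i, Q i 0%MM = 0.
Proof. exact: formal_inverse0. Qed.

Let Pu : lin_mx P \in unitmx.
Proof. by rewrite shift_jacobian; case: Phi_inv. Qed.

(** [H] in normal coordinates: the composite P h P^-1. *)
Definition conjugate : 'I_2 -> fps C 2 := fun i => fps_comp (fps_comp (P i) h) Q.

Lemma conjugate0 i : conjugate i 0%MM = 0.
Proof. by rewrite /conjugate !fps_comp0. Qed.

Lemma conjugate_trunc d i : fps_trunc d (conjugate i) =[d.+1]=
  mcomp (mcomp (fps_trunc d (P i)) (fun j => fps_trunc d (h j))) (fun j => fps_trunc d (Q j)).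
Proof.
apply: (eqmod_trans (trunc_mcomp Q0)); apply: eqmod_mcomp.
- exact: trunc_mcomp.
- by move=> j; apply: eqmod_refl.
- exact: trunc_nonconst.
Qed.

Lemma lin_mx_conjugate : lin_mx conjugate = lin_mx P *m lin_mx h *m lin_mx Q.
Proof.
have hT := trunc_nonconst (D := 1) h0; have QT := trunc_nonconst (D := 1) Q0.
apply/matrixP => i j; rewrite !mxE.
have := eqmod_degE (m := U_(j)%MM) (@conjugate_trunc 1 i).
rewrite mdeg1 truncE mdeg1 /= => -> //; rewrite mcomp_linear_coef //.
apply: eq_bigr => l _; rewrite mcomp_linear_coef // truncE mdeg1 /= !mxE; congr (_ * _).
by apply: eq_bigr => l' _; rewrite !truncE !mdeg1 !mxE.
Qed.

Lemma det2 (A : 'M[C]_2) : \det A = A ord0 ord0 * A ord_max ord_max - A ord0 ord_max * A ord_max ord0.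
Proof.
rewrite (expand_det_row _ ord0) !big_ord_recl big_ord0 /cofactor !det_mx11 !mxE /=.
rewrite addr0 expr0 mul1r expr1 mulN1r mulrN.
by congr (A _ _ * A _ _ - A _ _ * A _ _); apply/val_inj.
Qed.

Lemma mon2U0 : mon2 1 0 = U_(ord0)%MM.
Proof.
by apply/mnmP => i; rewrite /mon2 multinomE (tnth_nth 0%N) mnm1E; case: i => -[|[|//]].
Qed.

Lemma mon2U1 : mon2 0 1 = U_(ord_max)%MM.
Proof.
by apply/mnmP => i; rewrite /mon2 multinomE (tnth_nth 0%N) mnm1E; case: i => -[|[|//]].
Qed.

Lemma mon200 : mon2 0 0 = 0%MM.
Proof.
by apply/mnmP => i; rewrite /mon2 multinomE (tnth_nth 0%N) mnm0E; case: i => -[|[|//]].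
Qed.

Lemma conjugate_jac :
  conjugate ord0 (mon2 1 0) * conjugate ord_max (mon2 0 1)
  - conjugate ord0 (mon2 0 1) * conjugate ord_max (mon2 1 0) != 0.
Proof.
have : lin_mx conjugate \in unitmx.
  rewrite lin_mx_conjugate !unitmx_mul Pu formal_inverse_unit // andbT /=.
  by rewrite shift_jacobian; case: H_inv.
by rewrite unitmxE unitfE det2 !mxE mon2U0 mon2U1.
Qed.

Lemma mul_at n d (f g : fps C (2 + 2)) (G : 'I_(2 + 2) -> {mpoly C[n]}) : nonconst G ->
  mcomp (fps_trunc d (fps_mul f g)) G =[d.+1]=
  mcomp (fps_trunc d f) G * mcomp (fps_trunc d g) G.
Proof.
move=> G1; rewrite -mcompM; apply: eqmod_mcomp => // [|i]; last exact: eqmod_refl.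
exact: trunc_mul.
Qed.

Lemma cmap_nonconst m n (u : 'I_m -> {mpoly C[n]}) :
  nonconst u -> nonconst (fun i => cmap (u i)).
Proof. by move=> u1 i j; rewrite cmap_coef fmorph_eq0; apply: u1. Qed.

Section Image.
Variables (n d : nat) (u v : 'I_2 -> {mpoly C[n]}).
Hypotheses (u1 : nonconst u) (v1 : nonconst v).
Local Notation img F := (fun j => mcomp (fps_trunc d (F j)) u).
Local Notation img' F := (fun j => mcomp (cmap (fps_trunc d (F j))) v).

(** The following three facts say that P, h and P^-1 carry the zero set of one
    defining series into that of the other; the first cancels the unit [a]. *)
Lemma mem_of_graph :
  mcomp (fps_trunc d (graph_rho phi)) (glue (img P) (img' P)) =[d.+1]= 0 ->
  mcomp (fps_trunc d (hrho M)) (glue u v) =[d.+1]= 0.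
Proof.
move=> Hg; have uv1 := glue_nonconst u1 v1; have [Phi0 _] := Phi_inv.
apply: (@unit_cancel _ _ (mcomp (fps_trunc d a) (glue u v))).
  by rewrite (mcomp_const _ uv1) truncE mdeg0.
apply: (eqmod_trans (eqmod_sym (mul_at (d := d) (f := a) (g := hrho M) uv1))).
rewrite -(eq_trunc _ Ha).
exact: (eqmod_trans (pullback_at (rho := graph_rho phi) Phi0 u1 v1) Hg).
Qed.

Lemma graph_of_mem :
  mcomp (fps_trunc d (hrho M)) (glue u v) =[d.+1]= 0 ->
  mcomp (fps_trunc d (graph_rho phi)) (glue (img P) (img' P)) =[d.+1]= 0.
Proof.
move=> HM; have uv1 := glue_nonconst u1 v1; have [Phi0 _] := Phi_inv.
apply: (eqmod_trans (eqmod_sym (pullback_at (rho := graph_rho phi) Phi0 u1 v1))).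
rewrite (eq_trunc _ Ha); apply: (eqmod_trans (mul_at (d := d) (f := a) (g := hrho M) uv1)).
rewrite -[X in _ =[_]= X](mulr0 (mcomp (fps_trunc d a) (glue u v))).
by apply: eqmodM => //; apply: eqmod_refl.
Qed.

Lemma mem_of_mem :
  mcomp (fps_trunc d (hrho M)) (glue u v) =[d.+1]= 0 ->
  mcomp (fps_trunc d (hrho M)) (glue (img h) (img' h)) =[d.+1]= 0.
Proof.
move=> HM; have uv1 := glue_nonconst u1 v1; have [H0 _] := H_inv.
apply: (eqmod_trans (eqmod_sym (pullback_at (rho := hrho M) H0 u1 v1))).
rewrite (eq_trunc _ Hb); apply: (eqmod_trans (mul_at (d := d) (f := b) (g := hrho M) uv1)).
rewrite -[X in _ =[_]= X](mulr0 (mcomp (fps_trunc d b) (glue u v))).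
by apply: eqmodM => //; apply: eqmod_refl.
Qed.

End Image.

Lemma iC_neq0 : 'i%C != 0 :> C.
Proof. by rewrite eq_complex /= oner_eq0 andbF. Qed.

(** P^-1, h and P are applied in turn to a pair of points of the graph. *)
Lemma conjugate_graph n d (u v : 'I_2 -> {mpoly C[n]}) : nonconst u -> nonconst v ->
  mcomp (fps_trunc d (graph_rho phi)) (glue u v) =[d.+1]= 0 ->
  mcomp (fps_trunc d (graph_rho phi))
    (glue (fun j => mcomp (fps_trunc d (conjugate j)) u)
          (fun j => mcomp (cmap (fps_trunc d (conjugate j))) v)) =[d.+1]= 0.
Proof.
move=> u1 v1 Hg.
have PT := trunc_nonconst (D := d) P0; have hT := trunc_nonconst (D := d) h0.
have QT := trunc_nonconst (D := d) Q0.
have u'1 := mcomp_nonconst QT u1; have v'1 := mcomp_nonconst (cmap_nonconst QT) v1.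
have hu1 := mcomp_nonconst hT u'1; have hv1 := mcomp_nonconst (cmap_nonconst hT) v'1.
have Pu1 := mcomp_nonconst PT hu1; have Pv1 := mcomp_nonconst (cmap_nonconst PT) hv1.
have step : mcomp (fps_trunc d (hrho M)) (glue (fun j => mcomp (fps_trunc d (Q j)) u)
     (fun j => mcomp (cmap (fps_trunc d (Q j))) v)) =[d.+1]= 0.
  apply: (mem_of_graph u'1 v'1); apply: eqmod_trans Hg; apply: eqmod_mcomp.
  - exact: eqmod_refl.
  - apply: glue_eqmod => j.
      rewrite -mcompA -[X in _ =[_]= X](mcompU u).
      by apply: eqmod_mcomp => // [|i]; [apply: formal_inverseK | apply: eqmod_refl].
    rewrite -mcompA -[X in _ =[_]= X](mcompU v).
    apply: eqmod_mcomp => // [|i]; last exact: eqmod_refl.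
    by rewrite -cmap_comp -cmapX; apply: cmap_eqmod; apply: formal_inverseK.
  - exact: glue_nonconst.
have := graph_of_mem hu1 hv1 (mem_of_mem u'1 v'1 step).
apply: eqmod_trans; apply: eqmod_mcomp; first exact: eqmod_refl.
  apply: glue_eqmod => j.
    have := eqmod_mcomp (@conjugate_trunc d j) (fun i => @eqmod_refl _ _ (deg_ge d.+1) (u i)) u1.
    by rewrite !mcompA.
  have := eqmod_mcomp (cmap_eqmod (@conjugate_trunc d j)) (fun i => @eqmod_refl _ _ (deg_ge d.+1) (v i)) v1.
  by rewrite !cmap_comp !mcompA.
exact: (glue_nonconst Pu1 Pv1).
Qed.

(** The pair of points is (z, s + i phi) and (x, s - i phi), a parametrisation of the
    whole complexified graph. *)
Lemma mapping_of_graph (F : 'I_2 -> fps C 2) : (forall j, F j 0%MM = 0) ->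
  (forall n d (u v : 'I_2 -> {mpoly C[n]}), nonconst u -> nonconst v ->
    mcomp (fps_trunc d (graph_rho phi)) (glue u v) =[d.+1]= 0 ->
    mcomp (fps_trunc d (graph_rho phi))
      (glue (fun j => mcomp (fps_trunc d (F j)) u)
            (fun j => mcomp (cmap (fps_trunc d (F j))) v)) =[d.+1]= 0) ->
  mapping_equation 'i%C phi (F ord0) (F ord_max) (conj_fps (F ord0)) (conj_fps (F ord_max)).
Proof.
move=> F0 HF d /=.
pose u := pt z (graph_param 'i%C phi d); pose v := pt x (graph_param' 'i%C phi d).
have var1 i : supp_in (deg_ge 1) ('X_i : {mpoly C[3]}) by apply: supp_inX; rewrite /= mdeg1.
have phi1 : supp_in (deg_ge 1) (fps_trunc d phi).
  move=> m; rewrite truncE; case: ifP => [_ /phi_pure|]; last by rewrite eqxx.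
  by rewrite mdeg3; lia.
have u1 : nonconst u.
  move=> j; rewrite /u /pt; case: ifP => _; first exact: var1.
  by apply: supp_inD; [exact: var1 | exact: supp_inZ].
have v1 : nonconst v.
  move=> j; rewrite /v /pt; case: ifP => _; first exact: var1.
  by apply: supp_inB; [exact: var1 | exact: supp_inZ].
have Hg : mcomp (fps_trunc d (graph_rho phi)) (glue u v) =[d.+1]= 0.
  apply: (eqmod_trans (graph_rho_at u1 v1)); rewrite /u /v /pt /=.
  rewrite (_ : _ - _ = 0); first exact: eqmod_refl.
  apply/eqP; rewrite subr_eq0; apply/eqP.
  have -> : graph_param 'i%C phi d - graph_param' 'i%C phi d = (2 * 'i%C) *: fps_trunc d phi.
    by rewrite /graph_param /graph_param' opprB addrC addrA subrK -scalerDl mulr_natl mulr2n.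
  have -> : graph_param 'i%C phi d + graph_param' 'i%C phi d = 2 *: sv C.
    by rewrite /graph_param /graph_param' addrACA subrr addr0 scaler_nat mulr2n.
  rewrite !scalerA !mulVf ?mulf_neq0 ?pnatr_eq0 ?iC_neq0 // !scale1r.
  by rewrite ev3E trunc3E.
have CT := trunc_nonconst (D := d) F0.
have E1 := graph_rho_at (d := d) (phi := phi) (mcomp_nonconst CT u1) (mcomp_nonconst (cmap_nonconst CT) v1).
have E2 := eqmod_trans (eqmod_sym E1) (HF _ _ _ _ u1 v1 Hg).
have eu j : ev2 (F j) d z (graph_param 'i%C phi d) = mcomp (fps_trunc d (F j)) u.
  exact: (ev2_mcomp d (F j) u).
have ev j : ev2 (conj_fps (F j)) d x (graph_param' 'i%C phi d) =
    mcomp (cmap (fps_trunc d (F j))) v.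
  by rewrite -cmap_trunc; exact: (ev2_mcomp d (fps_conj (F j)) v).
rewrite (eu ord0) (eu ord_max) (ev ord0) (ev ord_max) /eqmod; move: E2; rewrite /eqmod subr0; exact.
Qed.

Lemma conjugate_mapping : mapping_equation 'i%C phi (conjugate ord0) (conjugate ord_max)
   (conj_fps (conjugate ord0)) (conj_fps (conjugate ord_max)).
Proof. exact: (mapping_of_graph conjugate0 conjugate_graph). Qed.

(** From P h P^-1 = id and P^-1 P = id: first P h = P, then h = id. *)
Lemma conjugate_cancel n d (P' h' Q' : 'I_n -> {mpoly C[n]}) :
  nonconst P' -> nonconst h' ->
  (forall i, mcomp (Q' i) P' =[d]= 'X_i) ->
  (forall i, mcomp (mcomp (P' i) h') Q' =[d]= 'X_i) ->
  forall j, h' j =[d]= 'X_j.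
Proof.
move=> P1 h1 QP PhQ j.
have X1 : nonconst (fun i => 'X_i : {mpoly C[n]}).
  by move=> l; apply: supp_inX; rewrite /= mdeg1.
have Ph i : mcomp (P' i) h' =[d]= P' i.
  have E1 := eqmod_mcomp (@eqmod_refl _ _ (deg_ge d) (mcomp (P' i) h')) QP X1.
  have E2 := eqmod_mcomp (PhQ i) (fun l => @eqmod_refl _ _ (deg_ge d) (P' l)) P1.
  rewrite mcomp_id -mcompA in E1; rewrite mcompU in E2.
  exact: (eqmod_trans (eqmod_sym E1) E2).
have E3 := eqmod_mcomp (QP j) (fun l => @eqmod_refl _ _ (deg_ge d) (h' l)) h1.
have E4 := eqmod_mcomp (@eqmod_refl _ _ (deg_ge d) (Q' j)) Ph P1.
rewrite mcompU mcompA in E3.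
exact: (eqmod_trans (eqmod_sym E3) (eqmod_trans E4 (QP j))).
Qed.

Lemma trivial_of_conjugate :
  (forall u, conjugate ord0 u = (u == mon2 1 0)%:R) ->
  (forall u, conjugate ord_max u = (u == mon2 0 1)%:R) -> H =2 formal_id (hbase M).
Proof.
move=> c0 c1.
have cX d j : fps_trunc d (conjugate j) =[d.+1]= 'X_j.
  apply: eqmod_deg => m md; rewrite truncE md mcoeffX.
  case: (eqVneq j ord0) => [->|j0]; first by rewrite c0 mon2U0 eq_sym.
  have -> : j = ord_max by apply/val_inj; case: j j0 => -[|[|//]].
  by rewrite c1 mon2U1 eq_sym.
have hX d j : fps_trunc d (h j) =[d.+1]= 'X_j.
  have PT := trunc_nonconst (D := d) P0; have hT := trunc_nonconst (D := d) h0.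
  have QT := trunc_nonconst (D := d) Q0.
  apply: (conjugate_cancel PT hT (fun i => formal_inverseKl P0 Pu (d := d) (i := i))) => i.
  exact: (eqmod_trans (eqmod_sym (@conjugate_trunc d i)) (cX d i)).
move=> j m; have := eqmod_degE (hX (mdeg m) j) (leqnn _).
rewrite truncE leqnn /shift /fps_sub /formal_id /fps_poly mcoeffD => <-.
by rewrite addrC subrK.
Qed.

End Reduction.

Lemma pullback_id (q : 'rV[C]_2) rho : pullback q rho (formal_id q) =1 rho.
Proof.
apply: fps_ext => d.
have id0 i : formal_id q i 0%MM = q 0 i.
  by rewrite /formal_id /fps_poly mcoeffD mcoeffC mcoeffX eqxx mnm1_eq0 mulr1 addr0.
pose u (j : 'I_2) : {mpoly C[2 + 2]} := 'X_(lshift 2 j).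
pose v (j : 'I_2) : {mpoly C[2 + 2]} := 'X_(rshift 2 j).
have u1 : nonconst u by move=> j; apply: supp_inX; rewrite /= mdeg1.
have v1 : nonconst v by move=> j; apply: supp_inX; rewrite /= mdeg1.
have uv : glue u v =1 (fun i => 'X_i).
  by move=> i; rewrite /glue /u /v -[in RHS](splitK i); case: split.
have := pullback_at (d := d) (rho := rho) id0 u1 v1.
rewrite (eq_mcomp _ uv) mcomp_id => E; apply: (eqmod_trans E).
have sX j : fps_trunc d (shift q (formal_id q) j) =[d.+1]= 'X_j.
  apply: eqmod_deg => m md.
  by rewrite truncE md /shift /fps_sub /formal_id /fps_poly mcoeffD addrC addKr.
rewrite -[X in _ =[_]= X](mcomp_id (fps_trunc d rho)).
apply: eqmod_mcomp; first exact: eqmod_refl.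
  move=> i; rewrite -uv; apply: glue_eqmod => {}i.
    rewrite -[X in _ =[_]= X](mcompU u); apply: eqmod_mcomp => // l; exact: eqmod_refl.
  rewrite -[X in _ =[_]= X](mcompU v); apply: eqmod_mcomp => // [|l]; last exact: eqmod_refl.
  by rewrite -cmapX; apply: cmap_eqmod.
by move=> i; apply: supp_inX; rewrite /= mdeg1.
Qed.

Lemma fps_mulC (c : C) n (f : fps C n) :
  fps_mul (fps_poly c%:MP) f =1 (fun m => c * f m).
Proof.
apply: fps_ext => d; apply: (eqmod_trans (@trunc_mul _ _ _ _ _)).
apply: (@eqmod_trans _ _ _ _ (c%:MP * fps_trunc d f)).
  by apply: eqmodM => //; [apply: trunc_poly | apply: eqmod_refl].
apply: eqmod_deg => m md; rewrite mcoeffCM !truncE md //.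
Qed.

Lemma formal_id_invertible (q : 'rV[C]_2) : formal_invertible_to q (formal_id q).
Proof.
split=> [i|]; first by rewrite /formal_id /fps_poly mcoeffD mcoeffC mcoeffX eqxx mnm1_eq0 mulr1 addr0.
suff -> : jacobian (formal_id q) = 1%:M by apply: unitmx1.
apply/matrixP => i j; rewrite !mxE /formal_id /fps_poly mcoeffD mcoeffC mcoeffX mnm1_eq0 mulr0 add0r.
by rewrite eq_mnm1 eq_sym eq_sym.
Qed.

Lemma formal_aut_id (M : hypersurface R) : formal_aut M (formal_id (hbase M)).
Proof.
split; first exact: formal_id_invertible.
by exists (fps_poly 1%:MP) => m; rewrite pullback_id fps_mulC mul1r.
Qed.

Lemma formal_map_ext (H H' : formal_map R) : H =2 H' -> H = H'.
Proof.
by move=> e; apply: boolp.funext => i; apply: boolp.funext.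
Qed.

(** * Invariant triples *)

Lemma deriv_at0E (f : nat -> C) k : deriv_at0 f k = f k *+ k`!.
Proof.
suff H j : iter k (@fps1_deriv C) f j = f (j + k)%N *+ ((j + k) ^_ k)%N.
  by rewrite /deriv_at0 H add0n ffactnn.
elim: k j => [|k IH] j; first by rewrite addn0 ffactn0 mulr1n.
rewrite iterS /fps1_deriv IH -mulrnA addSnnS ffactnSr; congr (_ *+ (_ * _)); lia.
Qed.

Lemma deriv_at0_eq0 (f : nat -> C) k : (deriv_at0 f k == 0) = (f k == 0).
Proof. by rewrite deriv_at0E mulrn_eq0 eqn0Ngt fact_gt0. Qed.

Section Invariants.
Variable phi : fps C 3.
Hypothesis phi_l : forall a m, phi_coef phi a 0 m = 0.
Hypothesis phi_r : forall n m, phi_coef phi 0 n m = 0.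
Local Notation T := (invariant_triple phi).

Lemma triple_lead a n m : T (a, n, m) -> phi (mon3 a n m) != 0.
Proof. by case=> _ [+ _]; rewrite deriv_at0_eq0. Qed.

Lemma triple_low a n m : T (a, n, m) -> forall j, (j < n)%N -> phi (mon3 a j m) = 0.
Proof. by case=> _ [_ H] j /H /eqP; rewrite deriv_at0_eq0 => /eqP. Qed.

Lemma phi_pos u : phi u != 0 -> (0 < u i0)%N /\ (0 < u i1)%N.
Proof.
move=> nz; rewrite !lt0n; split; apply: contra_neq nz => e; rewrite -[u]mon3K e.
  exact: phi_r.
exact: phi_l.
Qed.

(** The form in which minimality is used: a monomial of phi outside the slice
    (a, m) is not below it. *)
Lemma triple_supp a n m : T (a, n, m) -> forall u, phi u != 0 ->
  [/\ (0 < u i0)%N, (0 < u i1)%N &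
      [\/ u i0 = a /\ u i2 = m, (m < u i2)%N | (a + m < u i0 + u i2)%N]].
Proof.
case=> -[_ H] _ u nz; have [u0 u1] := phi_pos nz; split=> //.
case: (ltnP m (u i2)) => [|um]; first by constructor 2.
case: (ltnP (a + m) (u i0 + u i2)) => [|uam]; first by constructor 3.
case: (eqVneq (u i0, u i2) (a, m)) => [[-> ->]|ne]; first by constructor 1.
case/eqP: nz; rewrite -[u]mon3K; apply: (H (u i0, u i2)).
by rewrite /pair_lt /pair_le /= uam um.
Qed.

(** [L] is an antichain, with at most one element for each [m]. *)
Lemma triple_incomparable a n m a' n' m' : T (a, n, m) -> T (a', n', m') ->
  (a, n, m) <> (a', n', m') ->
  [/\ m <> m', (m < m' -> a' + m' < a + m)%N & (m' < m -> a + m < a' + m')%N].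
Proof.
move=> t t' ne.
have S := triple_supp t (triple_lead t'); have S' := triple_supp t' (triple_lead t).
rewrite !mon3E in S S'; case: S => _ _ S; case: S' => _ _ S'.
have ne' : ~ (a' = a /\ m' = m).
  case=> ea em; subst; apply: ne; congr (_, _, _).
  have L1 := triple_low t; have L2 := triple_low t'.
  case: (ltngtP n n') => // lt.
    by have := triple_lead t; rewrite L2 // eqxx.
  by have := triple_lead t'; rewrite L1 // eqxx.
split; by case: S => [[? ?]|?|?]; case: S' => [[? ?]|?|?]; lia.
Qed.

End Invariants.

(** What remains is to check the hypotheses of [rigid].  Those on small exponents
    use that the antichain has a second element: a + m > 1, an element with a > 1, and the
    absence of a monomial x z^l in phi, since (by conjugation) z x^l would be a
    monomial with z-exponent 1 and s-exponent 0. *)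
Lemma trivial_of_condition (L : nat * nat * nat -> Prop)
  (L_two : exists t1 t2, [/\ L t1, L t2 & t1 <> t2])
  (a n m : nat) (L_anm : L (a, n, m)) (n_neq_a : n <> a)
  (L_slope :
    (exists a' n' m', [/\ L (a', n', m'), (a', n', m') <> (a, n, m)
                        & (a + n = a' + n')%N])
    \/
    ~ (exists k : nat, (0 < k)%N /\
         forall a' n' m', L (a', n', m') -> (a', n', m') <> (a, n, m) ->
           slope (a, n, m) (a', n', m') = k%:R))
  (Hgcd : gcd_parity_condition L) (M : hypersurface R) :
  is_invariant_set M L -> trivial_aut M.
Proof.
case=> phi [[herm pl pr [Phi [Phi_inv [u [u0 Hu]]]]] LT] H; split; last first.
  by move=> /formal_map_ext ->; apply: formal_aut_id.
case=> H_inv [b Hb].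
have supp a' n' m' : L (a', n', m') -> _ := fun t => triple_supp pl pr (iffLR (LT _) t).
have lead a' n' m' : L (a', n', m') -> _ := fun t => triple_lead (iffLR (LT _) t).
have low a' n' m' : L (a', n', m') -> _ := fun t => triple_low (iffLR (LT _) t).
have inc a' n' m' a'' n'' m'' : L (a', n', m') -> L (a'', n'', m'') -> _ :=
  fun t t' => triple_incomparable pl pr (iffLR (LT _) t) (iffLR (LT _) t').
have pos a' n' m' : L (a', n', m') -> (0 < a')%N /\ (0 < n')%N.
  by move=> t; have := supp _ _ _ t _ (lead _ _ _ t); rewrite !mon3E => -[].
have other a' n' m' : L (a', n', m') -> exists a'' n'' m'',
    L (a'', n'', m'') /\ (a', n', m') <> (a'', n'', m'').
  move=> t; have [[[a1 n1] m1] [[[a2 n2] m2] [t1 t2 ne]]] := L_two.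
  have [e|ne1] := eqVneq (a', n', m') (a1, n1, m1); last by exists a1, n1, m1; split=> //; apply/eqP.
  by exists a2, n2, m2; split=> //; rewrite e.
have anti a' n' m' : L (a', n', m') -> (a', n', m') <> (a, n, m) -> m' <> m.
  by move=> t ne; have [] := inc _ _ _ _ _ _ t L_anm ne.
have gt1 a' n' m' : L (a', n', m') -> (1 < a' + m')%N.
  move=> t; have [a'' [n'' [m'' [t' ne]]]] := other _ _ _ t.
  have [? ? ?] := inc _ _ _ _ _ _ t t' ne; have [? ?] := pos _ _ _ t; have [? ?] := pos _ _ _ t'.
  by lia.
have big : exists a' n' m', L (a', n', m') /\ (1 < a')%N.
  have [a' [n' [m' [t ne]]]] := other _ _ _ L_anm; have [n1 i1 i2] := inc _ _ _ _ _ _ L_anm t ne.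
  have [? ?] := pos _ _ _ t; have [? ?] := pos _ _ _ L_anm.
  have [lt|lt] : (m < m')%N \/ (m' < m)%N by lia.
    by exists a, n, m; split=> //; have := i1 lt; lia.
  by exists a', n', m'; split=> //; have := i2 lt; lia.
have x1 v : phi v != 0 -> ~ (v i1 = 1%N /\ v i2 = 0%N).
  move=> nz [e1 e2]; have nz' : phi (mon3 1 (v i0) 0) != 0.
    move: nz; rewrite -[v]mon3K e1 e2 !mon3E.
    by rewrite [X in X != 0](herm (v i0) 1%N 0%N : phi (mon3 _ _ _) = _) conjC_eq0.
  have := supp _ _ _ L_anm _ nz'; rewrite !mon3E => -[_ _ [[? ?]|?|]]; have := gt1 _ _ _ L_anm; lia.
have mapping := conjugate_mapping (phi_pos pl pr) Phi_inv H_inv u0 Hu Hb.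
have := rigid iC_neq0 supp lead low x1 gt1 big _ _ mapping _ _ (conjugate_jac Phi_inv H_inv).
case.
- move=> k c G; exact: (balance_linear L_anm n_neq_a L_slope pos anti).
- move=> lam r; exact: (balance_multiplicative L_anm n_neq_a L_slope pos anti Hgcd).
- by rewrite mon200 conjugate0.
- by rewrite mon200 conjugate0.
- by move=> c0 c1; apply: (trivial_of_conjugate Phi_inv H_inv).
Qed.

End NormalCoordinates.

(** * Monomial coefficients of a graph *)

Section GraphCoefficients.

Definition j0 : 'I_(2 + 2) := lshift 2 ord0.
Definition j1 : 'I_(2 + 2) := lshift 2 ord_max.
Definition j2 : 'I_(2 + 2) := rshift 2 ord0.
Definition j3 : 'I_(2 + 2) := rshift 2 ord_max.

Definition mon4 (a i b l : nat) : 'X_{1..2 + 2} :=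
  (U_(j0) *+ a + U_(j1) *+ i + U_(j2) *+ b + U_(j3) *+ l)%MM.

Lemma mon4E a i b l : (mon4 a i b l j0 = a) * (mon4 a i b l j1 = i) *
  (mon4 a i b l j2 = b) * (mon4 a i b l j3 = l).
Proof. by rewrite /mon4 !mnmDE !mulmnE !mnm1E /= !mul0n !mul1n !addn0 !add0n. Qed.

Lemma ord4P (P : 'I_(2 + 2) -> Prop) : P j0 -> P j1 -> P j2 -> P j3 -> forall i, P i.
Proof.
move=> H0 H1 H2 H3 i.
have [||] : [\/ i = j0, i = j1 | i = j2 \/ i = j3].
  by case: i => -[|[|[|[|//]]]] lti; [constructor 1|constructor 2|constructor 3; left|constructor 3; right]; apply/val_inj.
- by move=> ->.
- by move=> ->.
- by case=> ->.
Qed.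

Lemma mon4K (m : 'X_{1..2 + 2}) : mon4 (m j0) (m j1) (m j2) (m j3) = m.
Proof. by apply/mnmP; apply: ord4P; rewrite mon4E. Qed.

Lemma mon4_eq a i b l (m : 'X_{1..2 + 2}) :
  (mon4 a i b l == m) = [&& a == m j0, i == m j1, b == m j2 & l == m j3].
Proof.
apply/eqP/and4P => [<-|[/eqP-> /eqP-> /eqP-> /eqP->]]; last exact: mon4K.
by rewrite !mon4E.
Qed.

Lemma mdeg4 (m : 'X_{1..2 + 2}) : mdeg m = (m j0 + m j1 + m j2 + m j3)%N.
Proof.
rewrite mdegE !big_ord_recr big_ord0 /= add0n.
by congr (_ + _ + _ + _)%N; congr (m _); apply/val_inj.
Qed.

Lemma prod_ord3 (S : comNzRingType) (F : 'I_3 -> S) : \prod_i F i = F i0 * F i1 * F i2.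
Proof.
rewrite !big_ord_recr big_ord0 /= mul1r.
by congr (F _ * F _ * F _); apply/val_inj.
Qed.

Lemma prod_ord4 (S : comNzRingType) (F : 'I_(2 + 2) -> S) :
  \prod_i F i = F j0 * F j1 * F j2 * F j3.
Proof.
rewrite !big_ord_recr big_ord0 /= mul1r.
by congr (F _ * F _ * F _ * F _); apply/val_inj.
Qed.

Variable R : realType.
Local Notation C := R[i].

Lemma mpolyX4 a i b l : 'X_[mon4 a i b l] =
  'X_j0 ^+ a * 'X_j1 ^+ i * 'X_j2 ^+ b * 'X_j3 ^+ l :> {mpoly C[2 + 2]}.
Proof. by rewrite /mon4 !mpolyXD !mpolyXn. Qed.

(** The coefficient of w^i conj(w)^l in (Re w)^(i+l). *)
Definition binom_weight (i l : nat) : C := 'C(i + l, i)%:R / 2 ^+ (i + l).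

Lemma re_power_coef a b c (m : 'X_{1..2 + 2}) :
  ('X_j0 ^+ a * 'X_j2 ^+ b * (2^-1 *: ('X_j1 + 'X_j3)) ^+ c : {mpoly C[2 + 2]})@_m =
  binom_weight (m j1) (m j3) *+ [&& a == m j0, b == m j2 & c == m j1 + m j3]%N.
Proof.
rewrite exprZn -scalerAr mcoeffZ exprDn mulr_sumr raddf_sum /=.
have E (i : 'I_c.+1) : ('X_j0 ^+ a * 'X_j2 ^+ b * ('X_j1 ^+ (c - i) * 'X_j3 ^+ i *+ 'C(c, i))
      : {mpoly C[2 + 2]})@_m = (mon4 a (c - i) b i == m)%:R *+ 'C(c, i).
  have -> : 'X_j0 ^+ a * 'X_j2 ^+ b * ('X_j1 ^+ (c - i) * 'X_j3 ^+ i *+ 'C(c, i)) =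
      'X_[mon4 a (c - i) b i] *+ 'C(c, i) :> {mpoly C[2 + 2]} by rewrite mpolyX4; ring.
  by rewrite mcoeffMn mcoeffX.
rewrite (eq_bigr _ (fun i _ => E i)).
have [/and3P[/eqP ea /eqP eb /eqP ec]|ne] := boolP [&& _, _ & _].
  have lt : (m j3 < c.+1)%N by lia.
  have cj : (c - m j3 = m j1)%N by lia.
  rewrite (bigD1 (Ordinal lt)) //= mon4_eq ea eb cj !eqxx /= big1 => [|i ni].
    rewrite addr0 mulr1n /binom_weight exprVn mulrC -ec; congr (_%:R / _).
    by rewrite -cj bin_sub.
  rewrite mon4_eq (_ : (i == m j3 :> nat) = false) ?andbF ?mul0rn //.
  by apply: contraNF ni => /eqP e; apply/eqP/val_inj.
rewrite mulr0n big1 ?mulr0 // => i _.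
rewrite mon4_eq (_ : [&& _, _, _ & _] = false) ?mul0rn //; apply: contraNF ne.
case/and4P => /eqP -> /eqP e1 /eqP -> /eqP e3; rewrite !eqxx /=; apply/eqP.
by have := ltn_ord i; lia.
Qed.

(** A monomial of the defining series comes from a single monomial of phi, because
    the exponent of s = Re w is the total exponent of w and its conjugate. *)
Lemma graph_rho_coef phi (m : 'X_{1..2 + 2}) : graph_rho phi m =
  (2%:R * 'i%C)^-1 * ((m == U_(j1)%MM)%:R - (m == U_(j3)%MM)%:R)
  - phi (mon3 (m j0) (m j2) (m j1 + m j3)) * binom_weight (m j1) (m j3).
Proof.
rewrite /graph_rho /fps_sub /fps_poly mcoeffZ mcoeffB !mcoeffX ![U_(_)%MM == m]eq_sym; congr (_ - _).
set T := [tuple _; _; _].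
have T1 i : supp_in (deg_ge 1) (tnth T i).
  have X1 (j : 'I_(2 + 2)) : supp_in (deg_ge 1) ('X_j : {mpoly C[2 + 2]}).
    by apply: supp_inX; rewrite /= mdeg1.
  rewrite (tnth_nth 0); case: i => -[|[|[|//]]] lti //=.
  by apply: supp_inZ; apply: supp_inD.
have T0 i : fps_poly (tnth T i) 0%MM = 0.
  by apply/eqP; rewrite /fps_poly; apply: contraT => /T1 /=; rewrite mdeg0.
have := eqmod_degE (m := m) (trunc_mcomp (D := mdeg m) (F := phi) (G := fun i => fps_poly (tnth T i)) T0) (leqnn _).
rewrite truncE leqnn => ->.
have E : mcomp (fps_trunc (mdeg m) phi) (fun i => fps_trunc (mdeg m) (fps_poly (tnth T i)))
    =[(mdeg m).+1]= mcomp (fps_trunc (mdeg m) phi) (tnth T).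
  by apply: eqmod_mcomp => // [|i]; [apply: eqmod_refl | apply: trunc_poly].
rewrite (eqmod_degE E (leqnn _)) mcomp_trunc raddf_sum /=.
have lt : (mdeg (mon3 (m j0) (m j2) (m j1 + m j3)) < (mdeg m).+1)%N.
  by rewrite mdeg3 !mon3E mdeg4; lia.
have prodE (u : 'X_{1..3}) : \prod_(i < 3) tnth T i ^+ u i =
    'X_j0 ^+ u i0 * 'X_j2 ^+ u i1 * (2^-1 *: ('X_j1 + 'X_j3)) ^+ u i2.
  by rewrite prod_ord3 !(tnth_nth 0).
rewrite (bigD1 (BMultinom lt)) //= mcoeffZ prodE re_power_coef !mon3E !eqxx mulr1n.
rewrite big1 ?addr0 // => u nu; rewrite mcoeffZ prodE re_power_coef.
rewrite (_ : [&& _, _ & _] = false) ?mulr0n ?mulr0 //; apply: contraNF nu.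
case/and3P => /eqP e0 /eqP e1 /eqP e2; apply/eqP/val_inj.
by rewrite /= -[LHS]mon3K e0 e1 e2.
Qed.

End GraphCoefficients.

(** * Models *)

Section Model.
Variable R : realType.
Local Notation C := R[i].
Variable L : nat * nat * nat -> Prop.
Hypothesis L_pos : forall a n m, L (a, n, m) -> (0 < a)%N /\ (0 < n)%N.
Hypothesis L_le : forall a n m, L (a, n, m) -> (a <= n)%N.
Hypothesis L_inc : forall a n m a' n' m', L (a, n, m) -> L (a', n', m') ->
  (a, n, m) <> (a', n', m') ->
  [/\ m <> m', (m < m' -> a' + m' < a + m)%N & (m' < m -> a + m < a' + m')%N].

(** Symmetrised, so that the model is Hermitian; a triple with a = n counts
    twice. *)
Definition mult a n m : nat := boolp.asbool (L (a, n, m)) + boolp.asbool (L (n, a, m)).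

Definition model : fps C 3 := fun u => (mult (u i0) (u i1) (u i2))%:R.

Lemma modelE a n m : model (mon3 a n m) = (mult a n m)%:R.
Proof. by rewrite /model !mon3E. Qed.

Lemma mult_neq0 a n m : reflect (L (a, n, m) \/ L (n, a, m)) (mult a n m != 0%N).
Proof.
rewrite /mult addn_eq0 negb_and !eqb0 !negbK.
by apply: (iffP orP) => -[/boolp.asboolP|/boolp.asboolP]; [left|right|left|right].
Qed.

Lemma multC a n m : mult a n m = mult n a m.
Proof. exact: addnC. Qed.

Lemma model_eq0 a n m : (model (mon3 a n m) == 0) = (mult a n m == 0%N).
Proof. by rewrite modelE pnatr_eq0. Qed.

Lemma model_neq0 a n m : model (mon3 a n m) != 0 -> L (a, n, m) \/ L (n, a, m).
Proof. by rewrite model_eq0 => /mult_neq0. Qed.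

Lemma model_real u : (model u)^* = model u.
Proof. exact: conjC_nat. Qed.

Lemma model_0n n m : model (mon3 0 n m) = 0.
Proof.
by apply/eqP; rewrite model_eq0; apply/negPn/negP => /mult_neq0[] /L_pos [].
Qed.

Lemma model_n0 n m : model (mon3 n 0 m) = 0.
Proof. by rewrite modelE multC -modelE model_0n. Qed.

(** The monomials added by the symmetrisation have z-exponent n >= a, so they are not
    below any pair of [L], and are above their mirror image when n > a. *)
Lemma model_triple t : invariant_triple model t <-> L t.
Proof.
case: t => -[a n] m; split=> [[[[k nz] Hlt] [+ Hlow]]|La].
  rewrite deriv_at0_eq0 => /model_neq0[//|Lna].
  have le := L_le Lna; have [e|ne] := eqVneq n a; first by move: Lna; rewrite e.
  have := Hlt (n, m) _ a; rewrite /phi_slice /phi_coef /= -/(mon3 n a m) => /(_ _)/eqP.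
  rewrite model_eq0 => H; case/negP: (introT (mult_neq0 n a m) (or_introl Lna)); apply: H.
  by rewrite /pair_lt /pair_le /= leq_add2r le leqnn xpair_eqE (negbTE ne).
have nz : model (mon3 a n m) != 0 by rewrite model_eq0; apply/mult_neq0; left.
split; split.
- by exists n.
- move=> [y1 y2]; rewrite /pair_lt /pair_le /= => /andP[/andP[le1 le2] ne] k.
  have {}ne : ~ (y1 = a /\ y2 = m) by case=> e1 e2; case/eqP: ne; rewrite e1 e2.
  apply/eqP; rewrite /phi_slice /phi_coef /= -/(mon3 y1 k y2) model_eq0.
  apply/negPn/negP => /mult_neq0[Ly|Ly].
    have [e|/eqP d] := eqVneq (y1, k, y2) (a, n, m); first by case: e => *; apply: ne.
    by have [? ? ?] := L_inc Ly La d; lia.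
  have le := L_le Ly.
  have [e|/eqP d] := eqVneq (k, y1, y2) (a, n, m); first by case: e => *; apply: ne; lia.
  by have [? ? ?] := L_inc Ly La d; lia.
- by rewrite deriv_at0_eq0.
- move=> k lt; apply/eqP; rewrite deriv_at0_eq0 /phi_slice /phi_coef /= -/(mon3 a k m) model_eq0.
  apply/negPn/negP => /mult_neq0[Ly|Ly].
    have [e|/eqP d] := eqVneq (a, k, m) (a, n, m); first by case: e => ?; lia.
    by have [? ? ?] := L_inc Ly La d; lia.
  have [e|/eqP d] := eqVneq (k, a, m) (a, n, m); first by case: e => *; lia.
  by have [? ? ?] := L_inc Ly La d; lia.
Qed.

Lemma mswapE (m : 'X_{1..2 + 2}) :
  (mswap m j0 = m j2) * (mswap m j1 = m j3) * (mswap m j2 = m j0) * (mswap m j3 = m j1).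
Proof.
rewrite /mswap !mnmE.
by rewrite (unsplitK (inl ord0)) (unsplitK (inl ord_max)) (unsplitK (inr ord0)) (unsplitK (inr ord_max)).
Qed.

Lemma mswap_U1 m : (mswap m == U_(j1)%MM) = (m == U_(j3)%MM).
Proof.
have e1 : U_(j1)%MM = mon4 0 1 0 0 by apply/mnmP; apply: ord4P; rewrite mnm1E mon4E.
have e3 : U_(j3)%MM = mon4 0 0 0 1 by apply/mnmP; apply: ord4P; rewrite mnm1E mon4E.
by rewrite e1 e3 ![_ == mon4 _ _ _ _]eq_sym !mon4_eq !mswapE; apply/and4P/and4P => -[*]; split.
Qed.

Lemma mswap_U3 m : (mswap m == U_(j3)%MM) = (m == U_(j1)%MM).
Proof.
have e1 : U_(j1)%MM = mon4 0 1 0 0 by apply/mnmP; apply: ord4P; rewrite mnm1E mon4E.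
have e3 : U_(j3)%MM = mon4 0 0 0 1 by apply/mnmP; apply: ord4P; rewrite mnm1E mon4E.
by rewrite e1 e3 ![_ == mon4 _ _ _ _]eq_sym !mon4_eq !mswapE; apply/and4P/and4P => -[*]; split.
Qed.

Lemma binom_weightC i l : binom_weight R i l = binom_weight R l i.
Proof. by rewrite /binom_weight addnC -bin_sub ?leq_addl // addnK. Qed.

Lemma binom_weight_real i l : (binom_weight R i l)^* = binom_weight R i l.
Proof. by rewrite /binom_weight rmorphM /= fmorphV rmorphXn /= !conjC_nat. Qed.

Lemma model_hermitian m : graph_rho model m = (graph_rho model (mswap m))^*.
Proof.
rewrite !graph_rho_coef mswap_U1 mswap_U3 !mswapE [binom_weight R (m j3) _]binom_weightC.
move: (binom_weight R _ _) (binom_weight_real (m j1) (m j3)) => k kr.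
rewrite rmorphB rmorphM [in RHS]rmorphM /= model_real kr.
rewrite rmorphB /= !conjC_nat fmorphV rmorphM /= conjC_nat.
have -> : ('i%C : C)^* = - 'i%C by apply/eqP; rewrite eq_complex /= oppr0 !eqxx.
by rewrite mulrN invrN mulNr -mulrN opprB !modelE multC addnC.
Qed.

Lemma model_const : graph_rho model 0%MM = 0.
Proof.
rewrite graph_rho_coef ![0%MM == _]eq_sym !mnm1_eq0 subrr mulr0 !mnm0E model_0n mul0r.
exact: subrr.
Qed.

Lemma model_diff : exists i : 'I_(2 + 2), graph_rho model U_(i)%MM != 0.
Proof.
exists j1; rewrite graph_rho_coef !mnm1E /= model_0n mul0r subr0 eqxx eq_mnm1 /= subr0 mulr1.
by rewrite invr_eq0 mulf_eq0 pnatr_eq0 /= iC_neq0.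
Qed.

Definition model_surface : hypersurface R :=
  {| hbase := 0; hrho := graph_rho model; hrho_hermitian := model_hermitian;
     hrho_const := model_const; hrho_diff := model_diff |}.

Lemma model_invariant_set : is_invariant_set model_surface L.
Proof.
exists model; split; last by move=> t; rewrite model_triple.
split=> [a n m|a m|n m|].
- by rewrite /phi_coef -/(mon3 a n m) -/(mon3 n a m) model_real !modelE multC.
- exact: model_n0.
- exact: model_0n.
exists (formal_id 0); split; first exact: formal_id_invertible.
exists (fps_poly 1%:MP); split; first by rewrite /fps_poly mcoeffC eqxx mulr1 oner_neq0.
by move=> m; rewrite pullback_id fps_mulC mul1r.
Qed.

Definition diag_map (lam eps : C) : formal_map R :=
  fun i => fps_poly ((if i == ord0 then lam else eps) *: 'X_i).

(** The substitution multiplies each coefficient by a character of its exponent,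
    and the condition says that this character takes the value eps at all
    monomials of the defining series. *)
Lemma diag_aut (lam eps : C) : lam != 0 -> eps != 0 -> eps^* = eps ->
  (forall a n m, L (a, n, m) -> lam ^+ a * lam^* ^+ n * eps ^+ m = eps) ->
  formal_aut model_surface (diag_map lam eps).
Proof.
move=> lam0 eps0 epsr H.
have H0 i : diag_map lam eps i 0%MM = (0 : 'rV[C]_2) 0 i.
  by rewrite /diag_map /fps_poly mcoeffZ mcoeffX mnm1_eq0 mulr0 mxE.
split.
  split=> //; rewrite unitmxE unitfE det2 !mxE /diag_map /fps_poly !mcoeffZ !mcoeffX !eq_mnm1 /=.
  by rewrite !mulr1 !mulr0 subr0 mulf_neq0.
exists (fps_poly eps%:MP) => m; rewrite fps_mulC.
pose c : 'I_(2 + 2) -> C := fun i => match split i with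
   | inl j => if j == ord0 then lam else eps | inr j => if j == ord0 then lam^* else eps^* end.
have coefE : pullback 0 (graph_rho model) (diag_map lam eps) m =
    graph_rho model m * \prod_i c i ^+ m i.
  pose d := mdeg m.
  pose u (j : 'I_2) : {mpoly C[2 + 2]} := 'X_(lshift 2 j).
  pose v (j : 'I_2) : {mpoly C[2 + 2]} := 'X_(rshift 2 j).
  have u1 : nonconst u by move=> j; apply: supp_inX; rewrite /= mdeg1.
  have v1 : nonconst v by move=> j; apply: supp_inX; rewrite /= mdeg1.
  have uv : glue u v =1 (fun i => 'X_i).
    by move=> i; rewrite /glue /u /v -[in RHS](splitK i); case: split.
  have E := pullback_at (d := d) (rho := graph_rho model) H0 u1 v1.
  rewrite (eq_mcomp _ uv) mcomp_id in E.
  have := eqmod_degE E (leqnn (mdeg m)); rewrite truncE leqnn => ->.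
  have sX j : fps_trunc d (shift 0 (diag_map lam eps) j) =[d.+1]= (if j == ord0 then lam else eps) *: 'X_j.
    apply: eqmod_deg => l ld.
    by rewrite truncE ld /shift /fps_sub /diag_map /fps_poly mxE mcoeffC mul0r subr0.
  have E2 : mcomp (fps_trunc d (graph_rho model))
     (glue (fun j => mcomp (fps_trunc d (shift 0 (diag_map lam eps) j)) u)
       (fun j => mcomp (cmap (fps_trunc d (shift 0 (diag_map lam eps) j))) v)) =[d.+1]=
     mcomp (fps_trunc d (graph_rho model)) (fun i => c i *: 'X_i).
    apply: eqmod_mcomp; first exact: eqmod_refl.
      move=> i; rewrite -uv /c /glue; case: (split i) => j.
        rewrite -(mcompU u) -mcompZ; apply: eqmod_mcomp => // l; exact: eqmod_refl.
      rewrite -(mcompU v) -mcompZ; apply: eqmod_mcomp => // [|l]; last exact: eqmod_refl.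
      have := cmap_eqmod (sX j); rewrite /cmap map_mpolyZ map_mpolyX /=.
      by case: (j == ord0).
    by move=> i; apply: supp_inZ; apply: supp_inX; rewrite /= mdeg1.
  rewrite (eqmod_degE E2 (leqnn (mdeg m))) mcomp_trunc raddf_sum /=.
  rewrite (bigD1 (BMultinom (leqnn (mdeg m).+1))) //= [X in _ + X]big1 ?addr0 => [|l nl].
    rewrite mcoeffZ; congr (_ * _).
    rewrite (eq_bigr (fun i => (c i ^+ m i)%:MP * 'X_i ^+ m i)); last by move=> i _; rewrite exprZn mul_mpolyC.
    by rewrite big_split /= -mpolyXE_id -rmorph_prod /= mcoeffCM mcoeffX eqxx mulr1.
  rewrite mcoeffZ (eq_bigr (fun i => (c i ^+ (l : 'X_{1..2 + 2}) i)%:MP * 'X_i ^+ (l : 'X_{1..2 + 2}) i)); last first.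
    by move=> i _; rewrite exprZn mul_mpolyC.
  rewrite big_split /= -mpolyXE_id -rmorph_prod /= mcoeffCM mcoeffX.
  by rewrite (_ : (_ == m) = false) ?mulr0 //; apply: contraNF nl => /eqP e; apply/eqP/val_inj.
rewrite [LHS]coefE [RHS]mulrC /=.
have [->|nz] := eqVneq (graph_rho model m) 0; first by rewrite !mul0r.
congr (_ * _).
have -> : \prod_i c i ^+ m i = lam ^+ m j0 * lam^* ^+ m j2 * eps ^+ (m j1 + m j3).
  rewrite prod_ord4 /c (unsplitK (inl ord0)) (unsplitK (inl ord_max)).
  by rewrite (unsplitK (inr ord0)) (unsplitK (inr ord_max)) /= epsr exprD; ring.
have [e|ne1] := eqVneq m U_(j1)%MM; first by rewrite e !mnm1E /= !expr0 !mul1r expr1.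
have [e|ne3] := eqVneq m U_(j3)%MM; first by rewrite e !mnm1E /= !expr0 !mul1r expr1.
move: nz; rewrite graph_rho_coef (negbTE ne1) (negbTE ne3) subrr mulr0 sub0r oppr_eq0.
rewrite mulf_eq0 negb_or => /andP[/model_neq0[/H //|/H E] _].
have := congr1 Num.conj E; rewrite !rmorphM !rmorphXn /= conjCK epsr => {}E.
by rewrite -[RHS]E; congr (_ * _); apply: mulrC.
Qed.

Lemma diag_map_nontrivial (lam eps : C) : lam != 1 \/ eps != 1 ->
  ~ (diag_map lam eps =2 formal_id 0).
Proof.
move=> H e.
have E (i : 'I_2) : (if i == ord0 then lam else eps) = 1.
  have := e i U_(i)%MM; rewrite /diag_map /formal_id /fps_poly mxE mcoeffD mcoeffC mul0r add0r.
  by rewrite mcoeffZ mcoeffX eqxx mulr1.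
by case: H; [have /= -> := E ord0 | have /= -> := E ord_max]; rewrite eqxx.
Qed.

Lemma normc_le_nat (u : C) k : `|u| <= k%:R -> ComplexField.Normc.normc u <= k%:R.
Proof. by rewrite -(rmorph_nat (real_complex R)) -lecR. Qed.

Lemma norm_binom_weight i l : `|binom_weight R i l| <= 1.
Proof.
rewrite /binom_weight normrM normfV normrX !normr_nat ler_pdivrMr ?exprn_gt0 ?ltr0n // mul1r.
rewrite -natrX ler_nat (_ : (2 ^ (i + l) = (1 + 1) ^ (i + l))%N) // expnDn.
rewrite (bigD1 (inord i)) //= inordK ?ltnS ?leq_addr // !exp1n !muln1.
exact: leq_addr.
Qed.

Lemma norm_graph_rho m : `|graph_rho model m| <= 3.
Proof.
rewrite graph_rho_coef (_ : 3 = 1 + 2) -?natrD //; apply: (le_trans (ler_normB _ _)); apply: lerD.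
  rewrite normrM normfV normrM normr_nat complexiE normCi mulr1 mulrC ler_pdivrMr ?ltr0n // mul1r.
  apply: (le_trans (ler_normB _ _)); rewrite !normr_nat -natrD ler_nat.
  by case: (m == _); case: (m == _).
rewrite normrM -[leRHS]mulr1; apply: ler_pM => //; last exact: norm_binom_weight.
by rewrite modelE normr_nat ler_nat /mult; do 2 case: boolp.asbool.
Qed.

(** The sum is part of the k-th power of a truncated geometric series. *)
Lemma geometric_bound (k d : nat) :
  \sum_(m : 'X_{1..k < d}) (2^-1 : R) ^+ mdeg m <= 2 ^+ k.
Proof.
pose q : R := 2^-1; have q0 : 0 <= q by rewrite invr_ge0 ler0n.
pose hm (m : 'X_{1..k < d}) : {ffun 'I_k -> 'I_d.+1} := [ffun i => inord ((m : 'X_{1..k}) i)].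
have hE m i : hm m i = (m : 'X_{1..k}) i :> nat.
  rewrite ffunE inordK // ltnS; apply: leq_trans (ltnW (bmdeg m)).
  by rewrite mdegE (bigD1 i) //= leq_addr.
have hI : injective hm.
  move=> m1 m2 e; apply/val_inj/mnmP => i /=; by rewrite -!hE e.
have qE (m : 'X_{1..k < d}) : q ^+ mdeg m = \prod_i q ^+ hm m i.
  by rewrite mdegE -prodrXr; apply: eq_bigr => i _; rewrite hE.
rewrite (eq_bigr _ (fun m _ => qE m)).
rewrite -(big_imset (h := hm) (A := predT) (fun f : {ffun 'I_k -> 'I_d.+1} => \prod_i q ^+ f i)) /=; last first.
  by move=> m1 m2 _ _; apply: hI.
have G0 (f : {ffun 'I_k -> 'I_d.+1}) : 0 <= \prod_i q ^+ f i.
  by apply: prodr_ge0 => i _; apply: exprn_ge0.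
apply: (@le_trans _ _ (\sum_(f : {ffun 'I_k -> 'I_d.+1}) \prod_i q ^+ f i)).
  rewrite [leRHS](bigID (mem (hm @: predT))) /= lerDl; apply: sumr_ge0 => f _; exact: G0.
rewrite -(bigA_distr_bigA (fun (i : 'I_k) (j : 'I_d.+1) => q ^+ j)) /=.
rewrite prodr_const card_ord; apply: lerXn2r; rewrite ?nnegrE ?ler0n //.
  by apply: sumr_ge0 => j _; apply: exprn_ge0.
have -> : \sum_(j < d.+1) q ^+ j = 2 - q ^+ d.
  elim: d {hm hE hI qE G0} => [|d IH]; first by rewrite big_ord1 !expr0 -[2]/(1 + 1) addrK.
  by rewrite big_ord_recr /= IH exprS; move: (q ^+ d) => y; rewrite /q; field.
by rewrite lerBlDr lerDl exprn_ge0.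
Qed.

Lemma model_analytic : real_analytic model_surface.
Proof.
exists (2^-1 : R), (3 * 2 ^+ 4 : R); split=> [|d]; first by rewrite invr_gt0 ltr0n.
apply: (@le_trans _ _ (\sum_(m : 'X_{1..(2 + 2) < d}) (3 * 2^-1 ^+ mdeg m : R))).
  apply: ler_sum => m _; apply: ler_wpM2r; first by rewrite exprn_ge0 // invr_ge0 ler0n.
  exact: normc_le_nat (norm_graph_rho m).
rewrite -mulr_sumr; apply: ler_wpM2l; first exact: ler0n.
exact: geometric_bound.
Qed.

Lemma model_not_trivial (lam eps : C) : lam != 0 -> eps != 0 -> eps^* = eps ->
  (forall a n m, L (a, n, m) -> lam ^+ a * lam^* ^+ n * eps ^+ m = eps) ->
  lam != 1 \/ eps != 1 -> ~ trivial_aut model_surface.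
Proof.
move=> lam0 eps0 epsr H ne triv; apply: (diag_map_nontrivial ne).
by apply/triv; apply: diag_aut.
Qed.

End Model.

(** * Symmetries when the condition fails *)

Section Converse.
Variable K : numClosedFieldType.
Variable L : nat * nat * nat -> Prop.
Hypothesis L_le : forall a n m, L (a, n, m) -> (a <= n)%N.
Variables (a n m : nat).
Hypotheses (L_anm : L (a, n, m)) (n_neq_a : n <> a).

(** A root of 1 + X + ... + X^(g-1), which takes the value g at 1. *)
Lemma nontrivial_root g : (1 < g)%N -> exists2 lam : K, lam ^+ g = 1 & lam != 1.
Proof.
move=> g1; pose p : {poly K} := \sum_(i < g) 'X^i.
have pE (y : K) : p.[y] = \sum_(i < g) y ^+ i.
  by rewrite /p horner_sum; apply: eq_bigr => i _; rewrite hornerXn.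
have : size p != 1%N.
  have -> : p = \poly_(i < g) 1 by rewrite poly_def; apply: eq_bigr => i _; rewrite scale1r.
  by rewrite size_poly_eq ?oner_neq0 //; lia.
move=> /closed_rootP[lam]; rewrite rootE pE => /eqP e0; exists lam.
  by apply/eqP; rewrite -subr_eq0 subrX1 e0 mulr0.
apply: contra_eq_neq e0 => ->; rewrite (eq_bigr (fun=> 1)) => [|i _]; last by rewrite expr1n.
by rewrite sumr_const card_ord pnatr_eq0; lia.
Qed.

(** If d > 1 divides all n - a, take lam^d = 1 and eps = 1.  If all m are odd, take
    (1, -1).  Otherwise m and n - a have opposite parities on all of [L], and
    (-1, -1) works. *)
Lemma symmetry_of_failure : ~ gcd_parity_condition L ->
  exists lam eps : K, [/\ lam != 0, eps != 0, eps^* = eps,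
   (forall a n m, L (a, n, m) -> lam ^+ a * lam^* ^+ n * eps ^+ m = eps) &
   lam != 1 \/ eps != 1].
Proof.
move=> H.
have m1_neq1 : -1 != 1 :> K by rewrite -subr_eq0 -opprD oppr_eq0 -(natrD _ 1 1) pnatr_eq0.
have m1_neq0 : -1 != 0 :> K by rewrite oppr_eq0 oner_neq0.
have m1_real : (-1)^* = -1 :> K by rewrite rmorphN /= conjC1.
have [Hg|Hg] := boolp.EM (is_gcd (fun x => exists a n m, L (a, n, m) /\ x = n%:Z - a%:Z) 1); last first.
  have [d [dS d1]] : exists d : int, (forall x, (exists a n m, L (a, n, m) /\ x = n%:Z - a%:Z) -> (d %| x)%Z) /\
      ~ (d %| 1%:Z)%Z.
    apply: boolp.contrapT => nex; apply: Hg; split=> [x _|d dS]; first exact: dvd1z.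
    by apply: boolp.contrapT => nd; apply: nex; exists d.
  have dn a' n' m' : L (a', n', m') -> (`|d|%N %| n' - a')%N.
    move=> La; have le := L_le La.
    have : (d %| n'%:Z - a'%:Z)%Z by apply: dS; exists a', n', m'.
    by rewrite subzn // dvdzE.
  have g1 : (1 < `|d|)%N.
    have : `|d|%N != 1%N by apply/eqP => e; apply: d1; rewrite dvdzE e dvd1n.
    have : `|d|%N != 0%N.
      apply/eqP => e; have := dn _ _ _ L_anm; rewrite e dvd0n subn_eq0 => le.
      by apply: n_neq_a; apply/eqP; rewrite eqn_leq le (L_le L_anm).
    lia.
  have [lam lamg lam1] := nontrivial_root g1.
  have n1 : `|lam| = 1.
    have /eqP := congr1 Num.norm lamg; rewrite normrX normr1 pexpr_eq1 //; last lia.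
    by move/eqP.
  have ll : lam * lam^* = 1 by rewrite -normCK n1 expr1n.
  exists lam, 1; split; rewrite ?oner_neq0 ?conjC1 //; last by left.
    by rewrite -normr_eq0 n1 oner_neq0.
  move=> a' n' m' La; rewrite expr1n mulr1 -(subnKC (L_le La)) exprD mulrA -exprMn ll expr1n mul1r.
  have /dvdnP[q ->] := dn _ _ _ La.
  by rewrite mulnC exprM -rmorphXn /= lamg conjC1 expr1n.
have [He|He] := boolp.EM (exists a n m, L (a, n, m) /\ ~~ odd m); last first.
  exists 1, (-1); split; rewrite ?oner_neq0 //; last by right.
  move=> a' n' m' La; rewrite conjC1 !expr1n !mul1r -signr_odd.
  have -> : odd m' by apply/negPn/negP => om; apply: He; exists a', n', m'.
  by rewrite expr1.
exists (-1), (-1); split=> //; last by left.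
move=> a' n' m' La; rewrite m1_real -!exprD -signr_odd.
have par : (2 %| n'%:Z - a'%:Z)%Z = ~~ odd (n' - a').
  by rewrite subzn ?(L_le La) // dvdzE /= dvdn2.
suff -> : odd (a' + n' + m') by rewrite expr1.
have le := L_le La.
have -> : odd (a' + n' + m') = odd (n' - a') (+) odd m' by lia.
have [om|om] := boolP (odd m'); last first.
  rewrite addbF; apply/negPn/negP => ev; apply: H; split=> //; left.
  by exists a', n', m'; split=> //; rewrite par.
rewrite addbT; apply/negP => od; apply: H; split=> //; right.
by exists a', n', m'; split=> //; rewrite par od.
Qed.

End Converse.

(** * The theorem *)

Section InvariantSet.
Variables (R : realType) (L : nat * nat * nat -> Prop).
Hypothesis L_inv : exists M : hypersurface R, is_invariant_set M L.

Lemma invariant_set_pos a n m : L (a, n, m) -> (0 < a)%N /\ (0 < n)%N.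
Proof.
have [_ [phi [[_ pl pr _] LT]]] := L_inv.
by move=> /LT t; have := triple_supp pl pr t (triple_lead t); rewrite !mon3E => -[].
Qed.

Lemma invariant_set_le a n m : L (a, n, m) -> (a <= n)%N.
Proof.
have [_ [phi [[herm pl pr _] LT]]] := L_inv => /LT t.
have nz : phi (mon3 n a m) != 0.
  by have := triple_lead t; rewrite [X in X != 0](herm a n m : phi _ = _) conjC_eq0.
have := triple_supp pl pr t nz; rewrite !mon3E => -[_ _ [[? ?]|?|?]]; lia.
Qed.

Lemma invariant_set_incomparable a n m a' n' m' : L (a, n, m) -> L (a', n', m') ->
  (a, n, m) <> (a', n', m') ->
  [/\ m <> m', (m < m' -> a' + m' < a + m)%N & (m' < m -> a + m < a' + m')%N].
Proof.
have [_ [phi [[_ pl pr _] LT]]] := L_inv => /LT t /LT t'.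
exact: (triple_incomparable pl pr t t').
Qed.

End InvariantSet.

Theorem theorem3 (R : realType) (L : nat * nat * nat -> Prop)
  (L_inv : exists M : hypersurface R, is_invariant_set M L)
  (L_two : exists t1 t2, [/\ L t1, L t2 & t1 <> t2])
  (a n m : nat) (L_anm : L (a, n, m)) (n_neq_a : n <> a)
  (L_slope :
    (exists a' n' m', [/\ L (a', n', m'), (a', n', m') <> (a, n, m)
                        & (a + n = a' + n')%N])
    \/
    ~ (exists k : nat, (0 < k)%N /\
         forall a' n' m', L (a', n', m') -> (a', n', m') <> (a, n, m) ->
           slope (a, n, m) (a', n', m') = k%:R)) :
  ((forall M : hypersurface R, is_invariant_set M L -> trivial_aut M)
     <-> gcd_parity_condition L)
  /\
  ((forall M : hypersurface R,
       real_analytic M -> is_invariant_set M L -> trivial_aut M)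
     <-> gcd_parity_condition L).
Proof.
have suff_gcd (M : hypersurface R) : gcd_parity_condition L -> is_invariant_set M L -> trivial_aut M.
  by move=> Hgcd; apply: (trivial_of_condition (R := R) L_two L_anm n_neq_a L_slope Hgcd).
have nec : (forall M : hypersurface R,
    real_analytic M -> is_invariant_set M L -> trivial_aut M) -> gcd_parity_condition L.
  move=> triv; apply: boolp.contrapT => nH.
  have pos := invariant_set_pos L_inv; have le := invariant_set_le L_inv.
  have inc := invariant_set_incomparable L_inv.
  have [lam [eps [lam0 eps0 epsr H ne]]] := symmetry_of_failure R[i] le L_anm n_neq_a nH.
  apply: (model_not_trivial (L_pos := pos) lam0 eps0 epsr H ne).
  by apply: triv; [apply: model_analytic | apply: model_invariant_set].
split; split.
- by move=> triv; apply: nec => M _; apply: triv.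
- by move=> Hgcd M; apply: suff_gcd.
- exact: nec.
- by move=> Hgcd M _; apply: suff_gcd.
Qed.
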